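(* Let $T>1$ and $\gamma\in(1,T)$. Let two pairs of functions $(u_1,m_1),(u_2,m_2)\in Z(M_1)$ satisfy the Mean Field Games system in $Q_T$: $$u_t+\frac{\sigma_1^2(\mathbf{x})}{2}u_{xx}+\frac{\sigma_2^2(\mathbf{x})}{2}u_{yy}-\Big(\frac{\varphi_1^2(\mathbf{x})}{2a_0(\mathbf{x})}u_x^2+\frac{\varphi_2^2(\mathbf{x})}{2b_0(\mathbf{x})}u_y^2\Big)-c(\mathbf{x},t)+g\big(x-\overline m^{(y)}(x,t),\,y-\overline m^{(x)}(y,t)\big)=0,$$ $$m_t-\frac12\big(\sigma_1^2(\mathbf{x})m\big)_{xx}-\frac12\big(\sigma_2^2(\mathbf{x})m\big)_{yy}+\Big(\frac{\varphi_1^2(\mathbf{x})}{a_0(\mathbf{x})}mu_x\Big)_x+\Big(\frac{\varphi_2^2(\mathbf{x})}{b_0(\mathbf{x})}mu_y\Big)_y=0,$$ with the boundary conditions $$u|_{\Gamma_{0,T}}=\Psi|_{\Gamma_{0,T}},\quad\partial_\nu u|_{\Gamma_{1,T}}=0,\quad m|_{\Gamma_{0,T}}=0,\quad\partial_\nu m|_{\Gamma_{1,T}}=0 .$$ Set $\widetilde u=u_1-u_2$, $\widetilde m=m_1-m_2$, $\widetilde u_T(\mathbf{x})=\widetilde u(\mathbf{x},T)$, $\widetilde m_T(\mathbf{x})=\widetilde m(\mathbf{x},T)$, and suppose that $$\|\widetilde u_T\|_{H^1(\Omega)}\le\delta,\qquad\|\widetilde m_T\|_{H^1(\Omega)}\le\delta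 .$$ Then there exist a sufficiently small number $\delta_1\in(0,1)$, a number $\rho\in(0,1/6)$ and a number $C_2>0$, each depending only on $T,M_1,\gamma,\sigma_0,D,\varepsilon$, such that $$ \begin{aligned} &\|\widetilde u_t\|_{L_2(Q_{\gamma T})}+\|\widetilde u_{xx}\|_{L_2(Q_{\gamma T})}+\|\widetilde u_{xy}\|_{L_2(Q_{\gamma T})}+\|\widetilde u_{yy}\|_{L_2(Q_{\gamma T})}+\|\nabla\widetilde u\|_{L_2(Q_{\gamma T})}+\|\widetilde u\|_{L_2(Q_{\gamma T})}\\ &\quad+\|\nabla\widetilde m\|_{L_2(Q_{\gamma T})}+\|\widetilde m\|_{L_2(Q_{\gamma T})}\le C_2\delta^\rho,\qquad\forall\delta\in(0,\delta_1). \end{aligned} $$ In addition, the Mean Field Games system in $Q_T$ $$u_t+\frac{\sigma_1^2(\mathbf{x})}{2}u_{xx}+\frac{\sigma_2^2(\mathbf{x})}{2}u_{yy}-\Big(\frac{\varphi_1^2(\mathbf{x})}{2a_0(\mathbf{x})}u_x^2+\frac{\varphi_2^2(\mathbf{x})}{2b_0(\mathbf{x})}u_y^2\Big)-c(\mathbf{x},t)+g\big(x-\overline m^{(y)}(x,t),\,y-\overline m^{(x)}(y,t)\big)=0,$$ $$m_t-\frac12\big(\sigma_1^2(\mathbf{x})m\big)_{xx}-\frac12\big(\sigma_2^2(\mathbf{x})m\big)_{yy}+\Big(\frac{\varphi_1^2(\mathbf{x})}{a_0(\mathbf{x})}mu_x\Big)_x+\Big(\frac{\varphi_2^2(\mathbf{x})}{b_0(\mathbf{x})}mu_y\Big)_y=0,$$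 with the boundary conditions $u|_{\Gamma_{0,T}}=\Psi|_{\Gamma_{0,T}}$, $\partial_\nu u|_{\Gamma_{1,T}}=0$, $m|_{\Gamma_{0,T}}=0$, $\partial_\nu m|_{\Gamma_{1,T}}=0$ and with given terminal values $u(\mathbf{x},T)$, $m(\mathbf{x},T)$, $\mathbf{x}\in\Omega$, has at most one solution $(u,m)\in Z(M_1)$.
   Context: Let $\mathbf{x}=(x,y)$, let $\Omega$ be the unit square $0<x<1$, $0<y<1$, $\Gamma_0=\{(x,y)\in\partial\Omega:x=1\}$, $\Gamma_1=\partial\Omega\setminus\Gamma_0$, $Q_T=\Omega\times(0,T)$, $\Gamma_{i,T}=\Gamma_i\times(0,T)$ for $i=0,1$, $Q_{\gamma T}=\Omega\times(\gamma,T)$; $\partial_\nu$ is the outward normal derivative and $\nabla$ the gradient in $\mathbf{x}$. For $\varepsilon>0$ and a function $m\ge0$, $$\overline m^{(y)}(x,t)=\Big(\varepsilon+\int_0^1m(x,y,t)\,dy\Big)^{-1}\int_0^1y\,m(x,y,t)\,dy,\qquad \overline m^{(x)}(y,t)=\Big(\varepsilon+\int_0^1m(x,y,t)\,dx\Big)^{-1}\int_0^1x\,m(x,y,t)\,dx .$$ Assumptions on the data, with numbers $\sigma_0>0$, $D>0$: $g\in C^1(\mathbb{R}^2)$; $a_0,b_0>0$; $c\in C(\overline Q_T)$; $\sigma_1^2,\sigma_2^2\in C^1(\overline\Omega)$ with $\sigma_1^2(\mathbf{x})\ge2\sigma_0$, $\sigma_2^2(\mathbf{x})\ge2\sigma_0$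 in $\overline\Omega$; each of $\sigma_1^2(\mathbf{x})$ and $\sigma_2^2(\mathbf{x})$ is equal to a positive constant near $\partial\Omega$; $\varphi_1^2/a_0,\ \varphi_2^2/b_0\in C^1(\overline\Omega)$; and $$\|\sigma_1^2\|_{C^1(\overline\Omega)},\ \|\sigma_2^2\|_{C^1(\overline\Omega)},\ \|c\|_{C(\overline Q_T)},\ \|g\|_{C^1(\mathbb{R}^2)},\ \Big\|\frac{\varphi_1^2}{a_0}\Big\|_{C^1(\overline\Omega)},\ \Big\|\frac{\varphi_2^2}{b_0}\Big\|_{C^1(\overline\Omega)}\le D .$$ $\Psi$ is a given function (the Dirichlet data for $u$ on $\Gamma_{0,T}$). For $M_1>0$, $$Z(M_1)=\Big\{(u,m)\in C^{2,1}(\overline Q_T):\ \max_{t\in[0,T]}\|u(\cdot,t)\|_{C^2(\overline\Omega)}\le M_1,\ \max_{t\in[0,T]}\|m(\cdot,t)\|_{C^1(\overline\Omega)}\le M_1,\ m\ge0\text{ in }Q_T\Big\}.$$ The number $\delta\in(0,1)$ is the level of the error in the terminal data. *)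

(* Defs.v *)
From mathcomp Require Export all_boot all_order all_algebra.
From mathcomp Require Export all_classical all_reals all_analysis.
Export Order.TTheory GRing.Theory Num.Theory.
Export numFieldNormedType.Exports.

Set Implicit Arguments.
Unset Strict Implicit.
Unset Printing Implicit Defensive.

Local Open Scope classical_set_scope.
Local Open Scope ring_scope.

(* A point of space is p = (x, y) : R * R, a point of space-time is
   q = (x, y, t) = (p, t) : R * R * R. *)

Definition Omega (R : realType) : set (R * R) :=
  [set p | 0 < p.1 < 1 /\ 0 < p.2 < 1].

(* Q 0 T is Q_T and Q gamma T is Q_{gamma T}. *)
Definition Q (R : realType) (s T : R) : set (R * R * R) :=
  [set q | Omega q.1 /\ s < q.2 < T].

Definition bOmega (R : realType) : set (R * R) :=
  closure (@Omega R) `\` (@Omega R)°.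

Definition Gamma0 (R : realType) : set (R * R) := @bOmega R `&` [set p | p.1 = 1].
Definition Gamma1 (R : realType) : set (R * R) := @bOmega R `\` @Gamma0 R.

(* The corners, where there is no normal, are excluded. *)
Definition outward_normal (R : realType) (p nu : R * R) : Prop :=
  [\/ [/\ p.1 = 0, 0 < p.2 < 1 & nu = (-1, 0)],
      [/\ p.1 = 1, 0 < p.2 < 1 & nu = (1, 0)],
      [/\ p.2 = 0, 0 < p.1 < 1 & nu = (0, -1)] |
      [/\ p.2 = 1, 0 < p.1 < 1 & nu = (0, 1)]].

(* The boundary derivative is taken from inside: only values of v on the closed
   square are used. *)
Definition normal_derivative_is (R : realType) (v : R * R -> R) (p nu : R * R)
    (l : R) : Prop :=
  (fun h : R => (v p - v (p - h *: nu)) / h) @ 0^'+ --> l.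

Definition dx (R : realType) (v : R * R -> R) : R * R -> R := 'D_(1, 0) v.
Definition dy (R : realType) (v : R * R -> R) : R * R -> R := 'D_(0, 1) v.

Definition pdx (R : realType) (w : R * R * R -> R) : R * R * R -> R := 'D_(1, 0, 0) w.
Definition pdy (R : realType) (w : R * R * R -> R) : R * R * R -> R := 'D_(0, 1, 0) w.
Definition pdt (R : realType) (w : R * R * R -> R) : R * R * R -> R := 'D_(0, 0, 1) w.

Definition slice (R : realType) (w : R * R * R -> R) (t : R) : R * R -> R :=
  fun p => w (p, t).

(* For an open set A: the derivative along v exists in A and has a continuous
   extension to the closure of A.  The spaces C^k of the closure of A are those
   of functions continuous on the closure all of whose derivatives have this
   property. *)
Definition has_derivative_up_to_boundary (R : realType) (V : normedModType R)
    (A : set V) (v : V) (f : V -> R) : Prop :=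
  (forall p, A p -> derivable f p v) /\
  exists F : V -> R, {within closure A, continuous F} /\
                     (forall p, A p -> F p = 'D_v f p).

Definition C1 (R : realType) (A : set (R * R)) (v : R * R -> R) : Prop :=
  [/\ {within closure A, continuous v},
      has_derivative_up_to_boundary A (1, 0) v &
      has_derivative_up_to_boundary A (0, 1) v].

Definition C21 (R : realType) (A : set (R * R * R)) (w : R * R * R -> R) : Prop :=
  {within closure A, continuous w} /\
  [/\ has_derivative_up_to_boundary A (1, 0, 0) w,
      has_derivative_up_to_boundary A (0, 1, 0) w &
      has_derivative_up_to_boundary A (0, 0, 1) w] /\
  [/\ has_derivative_up_to_boundary A (1, 0, 0) (pdx w),
      has_derivative_up_to_boundary A (0, 1, 0) (pdx w),
      has_derivative_up_to_boundary A (1, 0, 0) (pdy w) &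
      has_derivative_up_to_boundary A (0, 1, 0) (pdy w)].

Definition sup_norm (R : realType) (U : Type) (A : set U) (f : U -> R) : \bar R :=
  ereal_sup [set `|f p|%:E | p in A].

(* The norm of C^k is the sum, over all multi-indices of order at most k, of the
   sup norms of the derivatives; by continuity the sup over the closure of A is
   the sup over A. *)
Definition C1_norm (R : realType) (A : set (R * R)) (v : R * R -> R) : \bar R :=
  (sup_norm A v + sup_norm A (dx v) + sup_norm A (dy v))%E.

Definition C2_norm (R : realType) (A : set (R * R)) (v : R * R -> R) : \bar R :=
  (C1_norm A v + sup_norm A (dx (dx v)) + sup_norm A (dy (dx v))
    + sup_norm A (dy (dy v)))%E.

Definition leb2 (R : realType) :
    {measure set (measurableTypeR R * measurableTypeR R) -> \bar R} :=
  (@lebesgue_measure R \x @lebesgue_measure R)%E.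
Definition leb3 (R : realType) :
    {measure set (measurableTypeR R * measurableTypeR R * measurableTypeR R) -> \bar R} :=
  (@lebesgue_measure R \x @lebesgue_measure R \x @lebesgue_measure R)%E.

Definition L2_norm d (U : measurableType d) (R : realType)
    (mu : {measure set U -> \bar R}) (A : set U) (f : U -> R) : \bar R :=
  ((\int[mu]_(p in A) (`|f p| ^+ 2)%:E) `^ 2^-1)%E.

Definition H1_norm (R : realType) (v : R * R -> R) : \bar R :=
  ((L2_norm (@leb2 R) (@Omega R) v `^ 2 + L2_norm (@leb2 R) (@Omega R) (dx v) `^ 2
    + L2_norm (@leb2 R) (@Omega R) (dy v) `^ 2) `^ 2^-1)%E.

Definition grad_length (R : realType) (w : R * R * R -> R) : R * R * R -> R :=
  fun q => Num.sqrt (pdx w q ^+ 2 + pdy w q ^+ 2).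

Definition mbar_y (R : realType) (eps : R) (m : R * R * R -> R) (x t : R) : R :=
  (eps + \int[lebesgue_measure]_(y in `[0, 1]) m (x, y, t))^-1
  * \int[lebesgue_measure]_(y in `[0, 1]) (y * m (x, y, t)).

Definition mbar_x (R : realType) (eps : R) (m : R * R * R -> R) (y t : R) : R :=
  (eps + \int[lebesgue_measure]_(x in `[0, 1]) m (x, y, t))^-1
  * \int[lebesgue_measure]_(x in `[0, 1]) (x * m (x, y, t)).

Record mfg_data (R : realType) := MfgData {
  gfun : R * R -> R;
  sigma1 : R * R -> R;
  sigma2 : R * R -> R;
  phi1 : R * R -> R;
  phi2 : R * R -> R;
  a0 : R * R -> R;
  b0 : R * R -> R;
  cfun : R * R * R -> R
}.

Definition sigma1sq (R : realType) (d : mfg_data R) : R * R -> R :=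
  fun p => sigma1 d p ^+ 2.
Definition sigma2sq (R : realType) (d : mfg_data R) : R * R -> R :=
  fun p => sigma2 d p ^+ 2.
Definition phi1sq_a0 (R : realType) (d : mfg_data R) : R * R -> R :=
  fun p => phi1 d p ^+ 2 / a0 d p.
Definition phi2sq_b0 (R : realType) (d : mfg_data R) : R * R -> R :=
  fun p => phi2 d p ^+ 2 / b0 d p.

Definition constant_near_boundary (R : realType) (v : R * R -> R) : Prop :=
  exists kappa : R, 0 < kappa /\
  exists U : set (R * R), [/\ open U, @bOmega R `<=` U &
    forall p, U p -> closure (@Omega R) p -> v p = kappa].

Definition admissible_data (R : realType) (T sigma0 D : R) (d : mfg_data R) : Prop :=
  C1 setT (gfun d) /\
  (forall p, closure (@Omega R) p -> 0 < a0 d p /\ 0 < b0 d p) /\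
  {within closure (Q 0 T), continuous (cfun d)} /\
  (C1 (@Omega R) (sigma1sq d) /\ C1 (@Omega R) (sigma2sq d)) /\
  (forall p, closure (@Omega R) p ->
     2 * sigma0 <= sigma1sq d p /\ 2 * sigma0 <= sigma2sq d p) /\
  (constant_near_boundary (sigma1sq d) /\ constant_near_boundary (sigma2sq d)) /\
  (C1 (@Omega R) (phi1sq_a0 d) /\ C1 (@Omega R) (phi2sq_b0 d)) /\
  [/\ (C1_norm (@Omega R) (sigma1sq d) <= D%:E)%E,
      (C1_norm (@Omega R) (sigma2sq d) <= D%:E)%E &
      (sup_norm (closure (Q 0 T)) (cfun d) <= D%:E)%E] /\
  [/\ (C1_norm setT (gfun d) <= D%:E)%E,
      (C1_norm (@Omega R) (phi1sq_a0 d) <= D%:E)%E &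
      (C1_norm (@Omega R) (phi2sq_b0 d) <= D%:E)%E].

Definition in_Z (R : realType) (T M1 : R) (u m : R * R * R -> R) : Prop :=
  (C21 (Q 0 T) u /\ C21 (Q 0 T) m) /\
  [/\ (ereal_sup [set C2_norm (@Omega R) (slice u t) | t in [set` `[0, T]%R]] <= M1%:E)%E,
      (ereal_sup [set C1_norm (@Omega R) (slice m t) | t in [set` `[0, T]%R]] <= M1%:E)%E &
      forall q, Q 0 T q -> 0 <= m q].

Definition hjb_equation (R : realType) (T eps : R) (d : mfg_data R)
    (u m : R * R * R -> R) : Prop :=
  forall x y t, Q 0 T (x, y, t) ->
    let p := (x, y) in let q := (x, y, t) in
    pdt u q + sigma1sq d p / 2 * pdx (pdx u) q + sigma2sq d p / 2 * pdy (pdy u) q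
    - (phi1 d p ^+ 2 / (2 * a0 d p) * pdx u q ^+ 2
       + phi2 d p ^+ 2 / (2 * b0 d p) * pdy u q ^+ 2)
    - cfun d q + gfun d (x - mbar_y eps m x t, y - mbar_x eps m y t) = 0.

Definition has_continuous_second_derivative (R : realType) (V : normedModType R)
    (A : set V) (v : V) (f : V -> R) : Prop :=
  forall p, A p ->
    [/\ derivable f p v, derivable ('D_v f) p v &
        {for p, continuous ('D_v ('D_v f))}].

(* Since sigma_i^2 is only C^1, the second derivatives of sigma_i^2 m are not
   provided by the regularity of m; the equation is understood in the classical
   sense, so they are required to exist and to be continuous in (the open) Q_T.
   All the other derivatives below exist for (u, m) in Z(M_1). *)
Definition fp_equation (R : realType) (T : R) (d : mfg_data R)
    (u m : R * R * R -> R) : Prop :=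
  let s1m := fun q => sigma1sq d q.1 * m q in
  let s2m := fun q => sigma2sq d q.1 * m q in
  [/\ has_continuous_second_derivative (Q 0 T) (1, 0, 0) s1m,
      has_continuous_second_derivative (Q 0 T) (0, 1, 0) s2m &
      forall q, Q 0 T q ->
        pdt m q - 2^-1 * pdx (pdx s1m) q - 2^-1 * pdy (pdy s2m) q
        + pdx (fun q' => phi1sq_a0 d q'.1 * m q' * pdx u q') q
        + pdy (fun q' => phi2sq_b0 d q'.1 * m q' * pdy u q') q = 0].

Definition boundary_conditions (R : realType) (T : R) (Psi u m : R * R * R -> R) : Prop :=
  (forall p t, Gamma0 p -> 0 < t < T -> u (p, t) = Psi (p, t) /\ m (p, t) = 0) /\
  (forall p nu t, Gamma1 p -> outward_normal p nu -> 0 < t < T ->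
     normal_derivative_is (slice u t) p nu 0 /\
     normal_derivative_is (slice m t) p nu 0).

Definition mfg_solution (R : realType) (T eps : R) (d : mfg_data R)
    (Psi u m : R * R * R -> R) : Prop :=
  [/\ hjb_equation T eps d u m, fp_equation T d u m & boundary_conditions T Psi u m].

(* Main.v *)
(* The difference (u, m) of two solutions satisfies a backward parabolic equation for u, whose
   right-hand side is controlled by |grad u|, |m| and one-dimensional means of |m|, and a forward
   equation for m in divergence form.  Since sigma^2 is only C^1, the latter is used weakly,
   (m_t, phi) = - a(m, phi) + (F, grad phi), and the Carleman estimate for m is proved in H^{-1}:
   m(., t) is expanded along finitely many a-orthonormal test functions, obtained by Gram-Schmidt
   from values m(., t_j) at times t_j so dense that the projection error is uniformly small.
   With the weight w = exp(2 lambda e^{K t}), completing a square in the equations for the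
   coefficients bounds the integral of w m^2 by that of w (m^2 + |grad u|^2) with a small
   constant, and the energy identity for u absorbs the gradient; the result is

     int w (|m|^2 + |grad u|^2) <= w(0) |m(0)|^2 + C w(T) (lambda |m(T)|^2 + |u(T)|^2).

   Taking w(T) = 1 / delta gives the Hoelder rate on (1, T), and lambda -> oo gives uniqueness.
   The gradient of m, u_t and the second derivatives of u are then bounded by energy identities;
   for the last ones, u_xx u_yy and u_xy^2 have the same weighted integral up to lower order. *)

(* The weight depends on time only, so it commutes with the means over lines: the square of a line
   mean of |m| integrates to at most that of m, and the nonlocal terms cost no more than local ones.
   For u, terminal data are the natural ones and an energy identity suffices; for m they are the
   ill-posed ones, whence the exponential weight and the Hoelder loss. The equation for the
   difference of densities contains m_1 times second derivatives of u. Tested against H^{-1}, this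
   coupling costs only grad u, which the energy identity for u supplies. An H^{-1} norm usually
   comes from solving a mixed elliptic problem. The finite orthonormal families replace that
   solution; no constant depends on the family, so its error can be sent to 0 at the end. Two
   obstacles of regularity remain. C^{2,1} contains no derivative such as u_xt, so energies are
   differentiated through difference quotients that are integrated by parts before the passage to
   the limit. Everything is known in the open cylinder only, so boundary values are reached by
   contracting towards the centre. *)
From HB Require Import structures.
Require Import Defs.
From mathcomp Require Import ring lra measurable_realfun.
Set Implicit Arguments.
Unset Strict Implicit.
Unset Printing Implicit Defensive.
Local Open Scope classical_set_scope.
Local Open Scope ring_scope.

(** * Continuous functions and integrals over intervals *)

(* A record rather than [continuous] itself: unification never unfolds it, so the tactic [cnt]
   below is purely syntactic. *)
Record cnt (T U : topologicalType) (f : T -> U) : Prop := Cnt { cnt_continuous :> continuous f }.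

Section Continuity.
Context {R : realType} {T : topologicalType}.
Implicit Types f g : T -> R.

Lemma cnt_id : cnt (fun x : T => x).
Proof. by split=> x; exact: cvg_id. Qed.
Lemma cnt_cst (U : topologicalType) (c : U) : cnt (fun _ : T => c).
Proof. by split=> x; exact: cvg_cst. Qed.
Lemma cnt_comp (U V : topologicalType) (h : U -> V) (k : T -> U) :
  cnt h -> cnt k -> cnt (fun x => h (k x)).
Proof. by move=> ch ck; split=> x; apply: (@continuous_comp _ _ _ k h); [exact: ck|exact: ch]. Qed.
Lemma cnt_pair (U V : topologicalType) (h : T -> U) (k : T -> V) :
  cnt h -> cnt k -> cnt (fun x => (h x, k x)).
Proof. by move=> ch ck; split=> x; apply: cvg_pair; [exact: ch|exact: ck]. Qed.
Lemma cnt_fst (U V : topologicalType) (k : T -> U * V) : cnt k -> cnt (fun x => (k x).1).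
Proof. by move=> ck; apply: (cnt_comp (h := fst)) => //; split=> x; exact: cvg_fst. Qed.
Lemma cnt_snd (U V : topologicalType) (k : T -> U * V) : cnt k -> cnt (fun x => (k x).2).
Proof. by move=> ck; apply: (cnt_comp (h := snd)) => //; split=> x; exact: cvg_snd. Qed.
Lemma cntD f g : cnt f -> cnt g -> cnt (fun x => f x + g x).
Proof. by move=> cf cg; split=> x; apply: cvgD; [exact: cf|exact: cg]. Qed.
Lemma cntN f : cnt f -> cnt (fun x => - f x).
Proof. by move=> cf; split=> x; apply: cvgN; exact: cf. Qed.
Lemma cntM f g : cnt f -> cnt g -> cnt (fun x => f x * g x).
Proof. by move=> cf cg; split=> x; apply: cvgM; [exact: cf|exact: cg]. Qed.
Lemma cntX f n : cnt f -> cnt (fun x => f x ^+ n).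
Proof.
move=> cf; elim: n => [|n IH]; first exact: cnt_cst.
rewrite [X in cnt X](_ : _ = fun x => f x * f x ^+ n); last by apply/funext => x; rewrite exprS.
exact: cntM.
Qed.
Lemma cnt_abs f : cnt f -> cnt (fun x => `|f x|).
Proof. by move=> cf; split=> x; apply: cvg_norm; exact: cf. Qed.
Lemma cnt_expR f : cnt f -> cnt (fun x => expR (f x)).
Proof. by move=> cf; apply: cnt_comp => //; split=> x; exact: continuous_expR. Qed.
Lemma cnt_sqrt f : cnt f -> cnt (fun x => Num.sqrt (f x)).
Proof. by move=> cf; apply: cnt_comp => //; split=> x; exact: sqrt_continuous. Qed.
Lemma cnt_sum n (f : 'I_n -> T -> R) :
  (forall i, cnt (f i)) -> cnt (fun x => \sum_i f i x).
Proof.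
move=> cf; split=> x; rewrite /continuous_at; apply: cvg_big => //; first exact: add_continuous.
by move=> i _; exact: cf.
Qed.
End Continuity.

Lemma cnt_add (R : realType) (V : normedModType R) (T : topologicalType) (f g : T -> V) :
  cnt f -> cnt g -> cnt (fun x => f x + g x).
Proof. by move=> cf cg; split=> x; apply: cvgD; [exact: cf|exact: cg]. Qed.
Lemma cnt_scale (R : realType) (V : normedModType R) (T : topologicalType) (f : T -> R) (g : T -> V) :
  cnt f -> cnt g -> cnt (fun x => f x *: g x).
Proof. by move=> cf cg; split=> x; apply: cvgZ; [exact: cf|exact: cg]. Qed.

(** Extension point of the tactic [cnt], redefined once test functions, and later regularity
    records, bring continuity facts of their own. *)
Ltac cnt_hook := fail.
Ltac cnt_hyp f :=
  match goal with H : cnt ?g |- _ => constr_eq f g; exact H end.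
Ltac cnt_step :=
  lazymatch goal with |- cnt ?F =>
  first [ cnt_hyp F | cnt_hook
  | lazymatch F with fun _ => ?c => exact (cnt_cst c) end
  | lazymatch F with
    | (fun x => x) => apply: cnt_id
    | (fun x => (@?f x, @?g x)) => apply: (cnt_pair (h := f) (k := g))
    | (fun x => (@?f x).1) => apply: (cnt_fst (k := f))
    | (fun x => (@?f x).2) => apply: (cnt_snd (k := f))
    | (fun x => @?f x + @?g x) =>
        first [apply: (cntD (f := f) (g := g)) | apply: (cnt_add (f := f) (g := g))]
    | (fun x => - @?f x) => apply: (cntN (f := f))
    | (fun x => @?f x * @?g x) => apply: (cntM (f := f) (g := g))
    | (fun x => @?f x *: @?g x) => apply: (cnt_scale (f := f) (g := g))
    | (fun x => @?f x ^+ _) => apply: (cntX (f := f))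
    | (fun x => `|@?f x|) => apply: (cnt_abs (f := f))
    | (fun x => expR (@?f x)) => apply: (cnt_expR (f := f))
    | (fun x => ?f (@?g x)) => apply: (cnt_comp (h := f) (k := g))
    end ] end.
Ltac cnt := repeat (cbv beta; cnt_step).

Definition itg (R : realType) (a b : R) (f : R -> R) : R :=
  \int[lebesgue_measure]_(x in `[a, b]) f x.

Section Integral.
Context {R : realType}.
Implicit Types (a b : R) (f g : R -> R).

Lemma itg_int a b f : cnt f ->
  lebesgue_measure.-integrable `[a, b] (EFin \o f).
Proof.
move=> cf; apply: continuous_compact_integrable; first exact: segment_compact.
apply: continuous_subspaceT; exact: cnt_continuous.
Qed.

Lemma eq_itg a b f g : (forall x, a <= x <= b -> f x = g x) -> itg a b f = itg a b g.
Proof. by move=> fg; apply: eq_Rintegral => x; rewrite inE /= in_itv /=; exact: fg. Qed.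

Lemma itgD a b f g : cnt f -> cnt g ->
  itg a b (fun x => f x + g x) = itg a b f + itg a b g.
Proof. by move=> cf cg; apply: RintegralD => //; exact: itg_int. Qed.
Lemma itgB a b f g : cnt f -> cnt g ->
  itg a b (fun x => f x - g x) = itg a b f - itg a b g.
Proof. by move=> cf cg; apply: RintegralB => //; exact: itg_int. Qed.
Lemma itgZ a b f c : cnt f -> itg a b (fun x => c * f x) = c * itg a b f.
Proof. by move=> cf; apply: RintegralZl => //; exact: itg_int. Qed.
Lemma itgN a b f : cnt f -> itg a b (fun x => - f x) = - itg a b f.
Proof.
move=> cf; rewrite -mulN1r -itgZ //; apply: eq_itg => x _; by rewrite mulN1r.
Qed.
Lemma itg_cst a b c : a <= b -> itg a b (fun=> c) = c * (b - a).
Proof.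
move=> ab; rewrite /itg Rintegral_cst //; congr (_ * _).
rewrite /= lebesgue_measure_itv /= lte_fin.
by case: ltP => //= ba; rewrite (le_anti (introT andP (conj ab ba))) subrr.
Qed.
Lemma itg_le a b f g : cnt f -> cnt g -> (forall x, a <= x <= b -> f x <= g x) ->
  itg a b f <= itg a b g.
Proof.
move=> cf cg fg; apply: le_Rintegral => //; try exact: itg_int.
Qed.
(** The end points are null sets. The differential equations hold in the open cylinder only, so
    integrands can often be compared on the open interval only. *)
Lemma itg_le_oo a b f g : cnt f -> cnt g -> (forall x, a < x < b -> f x <= g x) ->
  itg a b f <= itg a b g.
Proof.
move=> cf cg fg.
have E (h : R -> R) : cnt h -> itg a b h = \int[lebesgue_measure]_(x in `]a, b[) h x.
  move=> ch; rewrite /itg -(Rintegral_itv_obnd_cbnd (r := a)); last first.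
    by apply: (integrableS _ _ _ (itg_int a b ch)) => //; apply: subset_itvr; rewrite bnd_simp.
  rewrite -(Rintegral_itv_bndo_bndc (a := BRight a)) //.
  by apply: (integrableS _ _ _ (itg_int a b ch)) => //; apply: subset_itv; rewrite bnd_simp.
rewrite !E //; apply: le_Rintegral => //.
- by apply: (integrableS _ _ _ (itg_int a b cf)) => //; apply: subset_itv; rewrite bnd_simp.
- by apply: (integrableS _ _ _ (itg_int a b cg)) => //; apply: subset_itv; rewrite bnd_simp.
Qed.
Lemma itg_ge0 a b f : (forall x, a <= x <= b -> 0 <= f x) -> 0 <= itg a b f.
Proof. by move=> f0; apply: Rintegral_ge0 => x; rewrite /= in_itv /=; exact: f0. Qed.
Lemma itg_abs a b f : cnt f -> `|itg a b f| <= itg a b (fun x => `|f x|).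
Proof. by move=> cf; apply: le_normr_Rintegral => //; exact: itg_int. Qed.

Lemma itg_split a b c f : cnt f -> a <= b -> b <= c ->
  itg a c f = itg a b f + itg b c f.
Proof.
move=> cf ab bc; rewrite /itg.
have := @Rintegral_itvB R f (BLeft a) (BRight c) b (itg_int a c cf).
rewrite !bnd_simp => /(_ ab bc) h.
have -> : \int[lebesgue_measure]_(x in `[b, c]) f x = \int[lebesgue_measure]_(x in `]b, c]) f x.
  apply/esym; apply: Rintegral_itv_obnd_cbnd.
  by apply: (integrableS _ _ _ (itg_int b c cf)) => //; apply: subset_itvr; rewrite bnd_simp.
by rewrite -h addrC subrK.
Qed.

Lemma FTC a b F f : a <= b -> cnt F -> cnt f ->
  (forall x, a < x < b -> is_derive x 1 F (f x)) -> itg a b f = F b - F a.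
Proof.
rewrite le_eqVlt => /predU1P[<-|ab] cF cf dF.
  by rewrite /itg set_itv1 Rintegral_set1 subrr.
rewrite /itg /Rintegral (@continuous_FTC2 _ f F) //.
- apply: continuous_subspaceT; exact: cnt_continuous.
- split.
  + by move=> x; rewrite in_itv /= => /dF [].
  + by apply: cvg_at_right_filter; exact: cF.
  + by apply: cvg_at_left_filter; exact: cF.
- by move=> x; rewrite in_itv /= => /dF Fx; rewrite derive1E; exact: derive_val.
Qed.

(** Compactness of the segment makes the continuity of [F (v, x)] in [v] uniform in [x]. *)
Lemma cnt_itg (V : topologicalType) a b (F : V * R -> R) : a <= b -> cnt F ->
  cnt (fun v => itg a b (fun x => F (v, x))).
Proof.
move=> ab cF; split=> v; apply/cvgrPdist_lt => e e0.
have ba0 : 0 < b - a + 1 by rewrite ltr_wpDl // subr_ge0.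
(* The added 1 covers [a = b] and makes the last inequality strict. *)
pose e' := e / (b - a + 1).
have e'0 : 0 < e' by rewrite divr_gt0.
have H : \forall v' \near v, `[a, b] `<=` (fun x => `|F (v, x) - F (v', x)| < e').
  have /compact_near_coveringP := @segment_compact R a b.
  move=> /(_ _ (nbhs v) (fun v' x => `|F (v, x) - F (v', x)| < e')); apply.
  move=> x _.
  have /cvgrPdist_lt/(_ _ (divr_gt0 e'0 (ltr0n _ 2))) [[A B] [/= nA nB AB]] := cF (v, x).
  exists (B, A) => //= -[x' v'] /= [Bx' Av'].
  have h1 := AB (v', x') (conj Av' Bx').
  have h2 := AB (v, x') (conj (nbhs_singleton nA) Bx').
  rewrite /= distrC in h2.
  rewrite [e']splitr; apply: le_lt_trans (ltrD h2 h1).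
  by apply: le_trans (ler_normD _ _); rewrite addrA subrK.
apply: filterS H => v' Hv'.
have c1 (w : V) : cnt (fun x : R => F (w, x)) by cnt.
have c2 : cnt (fun x => F (v, x) - F (v', x)) by cnt.
rewrite -itgB //; apply: le_lt_trans (itg_abs _ _ c2) _.
apply: le_lt_trans (_ : itg a b (fun=> e') < e).
  by apply: itg_le; [cnt|cnt|move=> x xab; apply/ltW/Hv'; rewrite /= in_itv].
rewrite itg_cst // /e' -mulrA gtr_pMr // mulrC ltr_pdivrMr // mul1r.
by rewrite ltrDl.
Qed.

Lemma itg0_eq0 a b f : cnt f -> (forall x, a <= x <= b -> 0 <= f x) ->
  itg a b f = 0 -> forall x, a < x < b -> f x = 0.
Proof.
move=> cf f0 I0 x /andP[ax xb]; apply/eqP/negPn/negP => fx0.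
have fx : 0 < f x by rewrite lt0r fx0 f0 ?(ltW ax) ?(ltW xb).
have := cf x => /cvgrPdist_lt /(_ (f x / 2)) []; first by rewrite divr_gt0.
move=> e /= e0 He.
(* The first entry keeps [[x, x + d]] in the ball where [f] exceeds [f x / 2], the second keeps it
   inside [[a, b]]. *)
pose d := Num.min (e / 2) (b - x).
have d0 : 0 < d by rewrite lt_min divr_gt0 // subr_gt0.
have xdb : x + d <= b by rewrite -lerBrDl ge_min lexx orbT.
have : f x / 2 * d <= itg x (x + d) f.
  rewrite -[X in _ * X <= _](_ : x + d - x = d); last by rewrite addrAC subrr add0r.
  rewrite -itg_cst ?lerDl ?(ltW d0) //; apply: itg_le => //; first by cnt.
  move=> y /andP[xy yd].
  have : ball x e y.
    rewrite /ball /= distrC ger0_norm ?subr_ge0 //.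
    rewrite ltrBlDr; apply: le_lt_trans yd _; rewrite addrC ltrD2r.
    by apply: (@le_lt_trans _ _ (e / 2)); rewrite ?ge_min ?lexx // ltr_pdivrMr // mulr_natr mulr2n ltrDr.
  move=> /He /=; have := ler_norm (f x - f y); lra.
have h1 : 0 <= itg a x f by apply: itg_ge0 => y /andP[h1 h2]; apply: f0; rewrite h1 (le_trans h2 (ltW xb)).
have h2 : 0 <= itg (x + d) b f.
  apply: itg_ge0 => y /andP[h3 h4]; apply: f0; rewrite h4 andbT; apply: le_trans h3.
  by rewrite (le_trans (ltW ax)) // lerDl ltW.
have h3 := itg_split cf (ltW ax) (ltW xb).
have h4 : itg x b f = itg x (x + d) f + itg (x + d) b f by apply: itg_split => //; rewrite lerDl ltW.
have : 0 < f x / 2 * d by rewrite mulr_gt0 // divr_gt0.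
lra.
Qed.

End Integral.

(** * Integrals over the square *)

(** The measures of the statement live on product sigma-algebras, so continuity is turned into
    measurability one factor at a time. Rounding [t] down to a multiple of 1/(n+1) makes each
    preimage a countable union of rectangles, and the rounded functions converge by continuity in
    [t]. *)
Lemma measurable_fun_caratheodory (R : realType) d (Y : measurableType d)
    (f : Y * measurableTypeR R -> R) :
  (forall t, measurable_fun setT (fun y => f (y, t))) ->
  (forall y, cnt (fun t : R => f (y, t))) ->
  measurable_fun setT f.
Proof.
move=> mf cf.
pose r (n : nat) (t : R) : R := (Num.floor (n.+1%:R * t))%:~R / n.+1%:R.
have rt t : r n t @[n --> \oo] --> t.
  apply/cvgrPdist_lt => e e0.
  have := near_infty_natSinv_lt (PosNum e0); apply: filterS => n /= hn.
  apply: le_lt_trans hn; rewrite /r.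
  set z := n.+1%:R; have z0 : 0 < z :> R by rewrite ltr0n.
  rewrite -[t in `|t - _|](mulfK (lt0r_neq0 z0)) -mulrBl normrM.
  have h := floor_itv (z * t); have /andP[h1 h2] := h.
  have -> : `|z^-1| = z^-1 by rewrite ger0_norm // invr_ge0 ltW.
  rewrite -[leRHS]mul1r ler_wpM2r ?invr_ge0 ?(ltW z0) //.
  rewrite mulrC ger0_norm ?subr_ge0 // lerBlDl.
  by move: h2; rewrite intrD => /ltW.
apply: (@measurable_fun_cvg _ _ _ _ (fun n p => f (p.1, r n p.2))); last first.
  move=> -[y t] _ /=; have c := cf y t.
  exact: (cvg_comp _ _ (rt t) c).
move=> n _ B mB; rewrite setTI.
pose c (k : int) : R := k%:~R / n.+1%:R.
have -> : (fun p : Y * measurableTypeR R => f (p.1, r n p.2)) @^-1` B =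
  \bigcup_(k : int) ((fun y => f (y, c k)) @^-1` B `*` [set t : measurableTypeR R | Num.floor (n.+1%:R * t) = k]).
  apply/seteqP; split => -[y t] /=; first by exists (Num.floor (n.+1%:R * t)).
  by move=> [k _ [/= h1 h2]]; rewrite /r h2.
apply: countable_bigcupT_measurable; first exact: countableP.
move=> k; apply: measurableX; first by rewrite -[X in measurable X]setTI; apply: mf.
have -> : [set t : measurableTypeR R | Num.floor (n.+1%:R * t) = k] =
   [set` `[c k, c (k + 1)[].
  apply/seteqP; split => t /=; rewrite in_itv /= /c.
    move=> <-; have := floor_itv (n.+1%:R * t).
    by rewrite ler_pdivrMr ?ltr0n // ltr_pdivlMr ?ltr0n // mulrC.
  move=> h; apply: floor_def; move: h.
  by rewrite ler_pdivrMr ?ltr0n // ltr_pdivlMr ?ltr0n // mulrC.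
exact: measurable_itv.
Qed.

(** An iterated integral, so that all the calculus is one-dimensional; [leb2_J] and [leb3_itg] link
    it to the Lebesgue measures of the statement. *)
Definition J (R : realType) (f : R * R -> R) : R :=
  itg 0 1 (fun x => itg 0 1 (fun y => f (x, y))).

Section DoubleIntegral.
Context {R : realType}.
Implicit Types f g : R * R -> R.

Lemma cnt_J (V : topologicalType) (F : V * (R * R) -> R) : cnt F ->
  cnt (fun v => J (fun p => F (v, p))).
Proof.
move=> cF; apply: (cnt_itg (F := fun q => itg 0 1 (fun y => F (q.1, (q.2, y))))) => //.
apply: (cnt_itg (F := fun q : V * R * R => F (q.1.1, (q.1.2, q.2)))) => //; cnt.
Qed.
Lemma cnt_Jt (V : topologicalType) (F : V -> R * R -> R) :
  cnt (fun z : V * (R * R) => F z.1 z.2) -> cnt (fun v => J (F v)).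
Proof. exact: (@cnt_J V (fun z => F z.1 z.2)). Qed.

Lemma cnt_inner f : cnt f -> cnt (fun x => itg 0 1 (fun y => f (x, y))).
Proof. by move=> cf; apply: (cnt_itg (F := f)). Qed.

Lemma eq_J f g : (forall x y, 0 <= x <= 1 -> 0 <= y <= 1 -> f (x, y) = g (x, y)) -> J f = J g.
Proof. by move=> fg; apply: eq_itg => x hx; apply: eq_itg => y hy; exact: fg. Qed.

Lemma JD f g : cnt f -> cnt g -> J (fun p => f p + g p) = J f + J g.
Proof.
move=> cf cg; rewrite /J -itgD; try exact: cnt_inner.
by apply: eq_itg => x _; rewrite itgD //; cnt.
Qed.
Lemma JB f g : cnt f -> cnt g -> J (fun p => f p - g p) = J f - J g.
Proof.
move=> cf cg; rewrite /J -itgB; try exact: cnt_inner.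
by apply: eq_itg => x _; rewrite itgB //; cnt.
Qed.
Lemma JZ (c : R) f : cnt f -> J (fun p => c * f p) = c * J f.
Proof.
move=> cf; rewrite /J -itgZ; try exact: cnt_inner.
by apply: eq_itg => x _; rewrite itgZ //; cnt.
Qed.
Lemma JN f : cnt f -> J (fun p => - f p) = - J f.
Proof.
by move=> cf; rewrite -mulN1r -(JZ _ cf); apply: eq_J => x y _ _; rewrite mulN1r.
Qed.
Lemma J_cst (c : R) : J (fun=> c) = c.
Proof.
by rewrite /J (eq_itg (g := fun=> c)) => [|x _]; rewrite itg_cst // subr0 mulr1.
Qed.
(** The side has length 1, so integrating once more in [y] changes nothing. Through this identity
    and [J_marginal_x] the squared line means of the density difference are bounded by its L2
    norm. *)
Lemma J_marginal_y (f : R * R -> R) : cnt f ->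
  J (fun p => itg 0 1 (fun y => f (p.1, y))) = J f.
Proof.
move=> cf; rewrite /J; apply: eq_itg => x _.
by rewrite (eq_itg (g := fun=> itg 0 1 (fun y => f (x, y)))) // itg_cst // subr0 mulr1.
Qed.
Lemma J_le f g : cnt f -> cnt g ->
  (forall x y, 0 <= x <= 1 -> 0 <= y <= 1 -> f (x, y) <= g (x, y)) -> J f <= J g.
Proof.
move=> cf cg fg; apply: itg_le; try exact: cnt_inner.
by move=> x hx; apply: itg_le; [cnt|cnt|move=> y hy; exact: fg].
Qed.
Lemma J_le_oo f g : cnt f -> cnt g ->
  (forall x y, 0 < x < 1 -> 0 < y < 1 -> f (x, y) <= g (x, y)) -> J f <= J g.
Proof.
move=> cf cg fg; apply: itg_le_oo; [exact: (cnt_inner cf)|exact: (cnt_inner cg)|move=> x hx].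
by apply: itg_le_oo; [cnt|cnt|move=> y hy; exact: fg].
Qed.
Lemma eq_J_oo f g : cnt f -> cnt g ->
  (forall x y, 0 < x < 1 -> 0 < y < 1 -> f (x, y) = g (x, y)) -> J f = J g.
Proof.
move=> cf cg fg; apply/eqP; rewrite eq_le; apply/andP; split; apply: J_le_oo => // x y hx hy; by rewrite fg.
Qed.
Lemma J_ge0 f : (forall x y, 0 <= x <= 1 -> 0 <= y <= 1 -> 0 <= f (x, y)) -> 0 <= J f.
Proof. by move=> f0; apply: itg_ge0 => x hx; apply: itg_ge0 => y hy; exact: f0. Qed.
Lemma J_eq0 f : cnt f -> (forall p, 0 <= f p) -> J f = 0 ->
  forall x y, 0 < x < 1 -> 0 < y < 1 -> f (x, y) = 0.
Proof.
move=> cf f0 J0 x y hx hy.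
have cfx : cnt (fun y => f (x, y)) by cnt.
apply: (itg0_eq0 cfx) hy => //.
by apply: (itg0_eq0 (cnt_inner cf)) hx => // x' _; apply: itg_ge0.
Qed.
End DoubleIntegral.

(** * Product Lebesgue measures and iterated integrals *)

Section LebesgueBox.
Context {R : realType}.

Lemma cnt_measurable (f : R -> R) : cnt f -> measurable_fun setT (f : measurableTypeR R -> R).
Proof. by move=> cf; apply: continuous_measurable_fun; exact: cnt_continuous. Qed.

Lemma cnt_measurable2 (f : R * R -> R) : cnt f ->
  measurable_fun setT (f : measurableTypeR R * measurableTypeR R -> R).
Proof.
move=> cf; apply: measurable_fun_caratheodory => [t|y]; last by cnt.
have ct : cnt (fun y : R => f (y, t)) by cnt.
exact: cnt_measurable.
Qed.

Lemma cnt_measurable3 (f : R * R * R -> R) : cnt f ->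
  measurable_fun setT (f : measurableTypeR R * measurableTypeR R * measurableTypeR R -> R).
Proof.
move=> cf; apply: measurable_fun_caratheodory => [t|y]; last by cnt.
have ct : cnt (fun y : R * R => f (y, t)) by cnt.
exact: cnt_measurable2.
Qed.

Lemma integral_oo_itg a b (f : R -> R) : cnt f ->
  (\int[lebesgue_measure]_(x in [set` `]a, b[%R]) (f x)%:E)%E = (itg a b f)%:E.
Proof.
move=> cf; rewrite /itg /Rintegral.
have mf D : measurable_fun D (EFin \o f).
  by apply/measurable_EFinP/measurable_funTS; apply: cnt_measurable.
rewrite integral_itv_bndo_bndc; last exact: mf.
rewrite integral_itv_obnd_cbnd; last exact: mf.
by rewrite fineK //; apply: integrable_fin_num => //; apply: itg_int.
Qed.

Lemma tonelli_setX d1 d2 (X : measurableType d1) (Y : measurableType d2)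
    (m1 : {sigma_finite_measure set X -> \bar R}) (m2 : {sigma_finite_measure set Y -> \bar R})
    (A : set X) (B : set Y) (f : X * Y -> \bar R) :
  measurable A -> measurable B -> measurable_fun setT f -> (forall p, 0 <= f p)%E ->
  (\int[m1 \x m2]_(p in A `*` B) f p = \int[m1]_(x in A) \int[m2]_(y in B) f (x, y) /\
   \int[m1 \x m2]_(p in A `*` B) f p = \int[m2]_(y in B) \int[m1]_(x in A) f (x, y))%E.
Proof.
move=> mA mB mf f0.
have mAB : measurable (A `*` B) by exact: measurableX.
have mg : measurable_fun setT (f \_ (A `*` B)).
  by apply/(measurable_restrictT _ _).1 => //; exact: measurable_funTS.
have g0 p : (0 <= (f \_ (A `*` B)) p)%E by rewrite patchE; case: ifP.
rewrite integral_mkcond; split.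
  rewrite (fubini_tonelli1 _ mg g0) [in RHS]integral_mkcond; apply: eq_integral => x _.
  rewrite /fubini_F patchE; case: ifPn => xA.
    rewrite [in RHS]integral_mkcond; apply: eq_integral => y _.
    rewrite !patchE in_setX /= xA /=.
    by [].
  by apply: integral0_eq => y _; rewrite patchE in_setX /= (negbTE xA).
rewrite (fubini_tonelli2 _ mg g0) [in RHS]integral_mkcond; apply: eq_integral => y _.
rewrite /fubini_G patchE; case: ifPn => yB.
  rewrite [in RHS]integral_mkcond; apply: eq_integral => x _.
  by rewrite !patchE in_setX /= yB andbT.
by apply: integral0_eq => x _; rewrite patchE in_setX /= (negbTE yB) andbF.
Qed.

(** Three factors are handled as two, the first being a product; its measure must therefore carry
    the sigma-finite structure that Tonelli asks for. *)
Definition prod_sigma_finite d1 d2 (X : measurableType d1) (Y : measurableType d2)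
    (m1 : {sigma_finite_measure set X -> \bar R}) (m2 : {sigma_finite_measure set Y -> \bar R}) :
    {sigma_finite_measure set (X * Y)%type -> \bar R} :=
  HB.pack_for {sigma_finite_measure set (X * Y)%type -> \bar R} (m1 \x m2)%E
    (lebesgue_integral_fubini.measure_function_Measure_isSigmaFinite__to__measure_function_isSFinite m1 m2)
    (lebesgue_integral_fubini.measure_function_Measure_isSigmaFinite__to__measure_function_isSigmaFinite m1 m2).

Lemma tonelli_setX3 d1 d2 d3 (X : measurableType d1) (Y : measurableType d2) (Z : measurableType d3)
    (m1 : {sigma_finite_measure set X -> \bar R}) (m2 : {sigma_finite_measure set Y -> \bar R})
    (m3 : {sigma_finite_measure set Z -> \bar R})
    (A : set (X * Y)) (B : set Z) (f : X * Y * Z -> \bar R) :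
  measurable A -> measurable B -> measurable_fun setT f -> (forall p, 0 <= f p)%E ->
  (\int[m1 \x m2 \x m3]_(p in A `*` B) f p = \int[m3]_(y in B) \int[m1 \x m2]_(x in A) f (x, y))%E.
Proof.
move=> mA mB mf f0.
have h := proj2 (@tonelli_setX _ _ _ _ (prod_sigma_finite m1 m2) m3 A B f mA mB mf f0).
apply: etrans; last apply: (etrans h).
  by apply: eq_measure_integral => C mC _.
by apply: eq_integral => y _; apply: eq_measure_integral => C mC _.
Qed.

Lemma OmegaE : @Omega R = [set` `]0, 1[%R] `*` [set` `]0, 1[%R].
Proof. by apply/seteqP; split => -[x y]; rewrite /Omega /= !in_itv /=. Qed.

(** Tonelli gives both orders of integration at once; [J_swap] rests on their agreement. *)
Lemma leb2_J (f : R * R -> R) : cnt f -> (forall p, 0 <= f p) ->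
  (\int[@leb2 R]_(p in @Omega R) (f p)%:E = (J f)%:E)%E /\
  (\int[@leb2 R]_(p in @Omega R) (f p)%:E = (J (fun p => f (p.2, p.1)))%:E)%E.
Proof.
move=> cf f0; rewrite OmegaE /leb2.
have mf : measurable_fun setT ((EFin \o f) : measurableTypeR R * measurableTypeR R -> \bar R).
  by apply/measurable_EFinP; apply: cnt_measurable2.
have [h1 h2] := @tonelli_setX _ _ _ _ (@lebesgue_measure R) (@lebesgue_measure R)
   [set` `]0, 1[%R] [set` `]0, 1[%R] (EFin \o f) (measurable_itv _) (measurable_itv _) mf (fun p => f0 p).
split; [apply: (etrans h1)|apply: (etrans h2)].
  rewrite /J -integral_oo_itg; last by apply: (cnt_itg (F := f)).
  apply: eq_integral => x _ /=; apply: (@integral_oo_itg 0 1 (fun y => f (x, y))); cnt.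
rewrite /J -integral_oo_itg; last by apply: (cnt_itg (F := fun p => f (p.2, p.1))) => //; cnt.
apply: eq_integral => y _ /=; apply: (@integral_oo_itg 0 1 (fun x => f (x, y))); cnt.
Qed.

Lemma leb3_itg s T (f : R * R * R -> R) : cnt f -> (forall p, 0 <= f p) ->
  (\int[@leb3 R]_(q in Q s T) (f q)%:E = (itg s T (fun t => J (fun p => f (p, t))))%:E)%E.
Proof.
move=> cf f0.
have -> : Q s T = @Omega R `*` [set` `]s, T[%R].
  by apply/seteqP; split => -[p t]; rewrite /Q /= in_itv /=.
have mO : measurable (@Omega R : set (measurableTypeR R * measurableTypeR R)).
  by rewrite OmegaE; apply: measurableX; exact: measurable_itv.
have mf : measurable_fun setT ((EFin \o f) : measurableTypeR R * measurableTypeR R * measurableTypeR R -> \bar R).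
  by apply/measurable_EFinP; apply: cnt_measurable3.
have h := @tonelli_setX3 _ _ _ _ _ _ (@lebesgue_measure R) (@lebesgue_measure R) (@lebesgue_measure R)
   (@Omega R) [set` `]s, T[%R] (EFin \o f) mO (measurable_itv _) mf (fun p => f0 p).
apply: (etrans h).
rewrite -integral_oo_itg; last first.
  apply: (cnt_itg (F := fun q => itg 0 1 (fun y => f (q.2, y, q.1)))) => //.
  apply: (cnt_itg (F := fun q : R * R * R => f (q.1.2, q.2, q.1.1))) => //; cnt.
apply: eq_integral => t _ /=.
have ct : cnt (fun p => f (p, t)) by cnt.
exact: (leb2_J ct (fun p => f0 (p, t))).1.
Qed.

(** Tonelli covers nonnegative integrands, and [f] is the difference of the nonnegative functions
    [|f| + f] and [|f|]. *)
Lemma J_swap (f : R * R -> R) : cnt f -> J f = J (fun p => f (p.2, p.1)).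
Proof.
move=> cf.
have swap (g : R * R -> R) : cnt g -> (forall p, 0 <= g p) -> J g = J (fun p => g (p.2, p.1)).
  by move=> cg g0; have [h1 h2] := leb2_J cg g0; case: (etrans (esym h1) h2).
have cf2 : cnt (fun p => f (p.2, p.1)) by cnt.
have fE : f = fun p => (`|f p| + f p) - `|f p| by apply/funext => p; rewrite addrC addKr.
rewrite fE (JB (f := fun p => `|f p| + f p)); [|cnt|cnt].
rewrite (JB (f := fun p => `|f (p.2, p.1)| + f (p.2, p.1))); [|cnt|cnt].
rewrite (swap (fun p => `|f p| + f p)); [|cnt|by move=> p; rewrite -lerBlDr sub0r -normrN ler_norm].
by rewrite (swap (fun p => `|f p|)) //; cnt.
Qed.
End LebesgueBox.

(** * Differentiation *)

Section Derivatives.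
Context {R : realType}.
Implicit Types f g : R -> R.

Lemma drD (f g : R -> R) (x : R) a b : is_derive x 1 f a -> is_derive x 1 g b ->
  is_derive x 1 (fun z => f z + g z) (a + b).
Proof. by move=> df dg; exact: (is_deriveD df dg). Qed.
Lemma drB (f g : R -> R) (x : R) a b : is_derive x 1 f a -> is_derive x 1 g b ->
  is_derive x 1 (fun z => f z - g z) (a - b).
Proof. by move=> df dg; exact: (is_deriveB df dg). Qed.
Lemma drM (f g : R -> R) (x : R) a b : is_derive x 1 f a -> is_derive x 1 g b ->
  is_derive x 1 (fun z => f z * g z) (a * g x + f x * b).
Proof.
move=> df dg; apply: (is_derive_eq (is_deriveM df dg)).
by rewrite addrC mulrC [f x * b]mulrC mulrC; congr (_ + _); rewrite mulrC.
Qed.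
Lemma drZ (f : R -> R) (c x : R) a : is_derive x 1 f a -> is_derive x 1 (fun z => c * f z) (c * a).
Proof. by move=> df; exact: (is_deriveZ c df). Qed.
Lemma dr_cst (c x : R) : is_derive x 1 (fun=> c) 0.
Proof. exact: is_derive_cst. Qed.
Lemma dr_id (x : R) : is_derive x 1 (fun z => z) 1.
Proof. exact: is_derive_id. Qed.
Lemma dr_comp f g (x : R) a b : is_derive (g x) 1 f a -> is_derive x 1 g b ->
  is_derive x 1 (fun z => f (g z)) (a * b).
Proof. by move=> df dg; exact: (is_derive1_comp df dg). Qed.
Lemma dr_sum n (f : 'I_n -> R -> R) (a : 'I_n -> R) (x : R) :
  (forall i, is_derive x 1 (f i) (a i)) ->
  is_derive x 1 (fun z => \sum_i f i z) (\sum_i a i).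
Proof.
move=> df; rewrite (_ : (fun z => _) = \sum_i f i); first exact: is_derive_sum.
by apply/funext => z; rewrite fct_sumE.
Qed.

Lemma dr_near f g (x : R) a b d : a < x < b -> (forall z, a < z < b -> f z = g z) ->
  is_derive x 1 f d -> is_derive x 1 g d.
Proof.
move=> /andP[ax xb] fg; apply: near_eq_is_derive.
by near=> z; apply: fg; apply/andP; split; near: z; [exact: lt_nbhsr|exact: lt_nbhsl].
Unshelve. all: by end_near. Qed.

(** Caratheodory's criterion. Integrals with a parameter are differentiated below by exhibiting a
    continuous slope, usually the average of a derivative along a segment. *)
Lemma dr_carath f g (x : R) a b : a < x < b ->
  (forall z, a < z < b -> f z = f x + g z * (z - x)) -> cnt g -> is_derive x 1 f (g x).
Proof.
move=> axb fg cg; apply: (@dr_near (fun z => f x + g z * (z - x)) f x a b) => //.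
  by move=> z /fg.
apply/is_derive1_caratheodory; exists g; split=> //.
  by move=> z; rewrite subrr mulr0 addr0 addrC addKr.
exact: cg.
Qed.

Lemma dr_dir (V : normedModType R) (w : V -> R) (a v : V) (k x D : R) :
  is_derive (a + (x * k) *: v) v w D ->
  is_derive x 1 (fun z => w (a + (z * k) *: v)) (D * k).
Proof.
move=> [dw wD].
have h : is_derive (0 : R) (1 : R) (fun h : R => w (h *: v + (a + (x * k) *: v))) D.
  have dw' := (derivable1P _ _ _).1 dw; refine (DeriveDef dw' _).
  rewrite -wD /derive; set g1 := fun h => h^-1 *: _; set g2 := fun h => h^-1 *: _.
  suff -> : g1 = g2 by [].
  by apply/funext => h; rewrite /g1 /g2 /= addr0 scale0r add0r [_%:A]mulr1.
have l : is_derive x (1 : R) (fun z => (z - x) * k) k.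
  have := drM (drB (dr_id x) (dr_cst x x)) (dr_cst k x).
  by move=> h1; apply: (is_derive_eq h1); rewrite mulr0 addr0 subr0 mul1r.
have := @dr_comp (fun h : R => w (h *: v + (a + (x * k) *: v))) (fun z => (z - x) * k) x D k.
rewrite /= subrr mul0r => /(_ h l).
rewrite (_ : (fun z => w ((z - x) * k *: v + _)) = (fun z => w (a + (z * k) *: v))) //.
by apply/funext => z; rewrite addrCA -scalerDl -mulrDl subrK.
Qed.

Lemma zero_limit (E : R -> R) : cnt E -> (forall s, 0 < s <= 1 -> E s = 0) -> E 0 = 0.
Proof.
move=> cE E0; have h : E s @[s --> 0^'+] --> E 0 by apply: cvg_at_right_filter; exact: cE.
have h0 : E s @[s --> 0^'+] --> 0.
  apply: cvg_near_cst; near=> s; apply: E0; apply/andP; split => //.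
  by near: s; apply: nbhs_right_le.
exact: cvg_unique h h0.
Unshelve. all: by end_near. Qed.

(** The derivative is known in [A] only, while the segment from [q] to [q + h *: v] may lie in the
    boundary. Contracted towards [c] by the factor [1 - s] it enters [A], where the fundamental
    theorem applies; both sides are continuous in [s], and [s] tends to 0. *)
Lemma slope_closure (V : normedModType R) (A : set V) (c v : V) (w F : V -> R) (q : V) (h : R) :
  cnt w -> cnt F -> (forall p, A p -> is_derive p v w (F p)) ->
  (forall s th : R, 0 < s <= 1 -> 0 <= th <= 1 -> A ((1 - s) *: (q + (th * h) *: v) + s *: c)) ->
  w (q + h *: v) - w q = h * itg 0 1 (fun th : R => F (q + (th * h) *: v)).
Proof.
move=> cw cF dw Ain.
pose a s := (1 - s) *: q + s *: c.
pose E s := w (a s + ((1 - s) * h) *: v) - w (a s)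
   - ((1 - s) * h) * itg 0 1 (fun th : R => F (a s + (th * ((1 - s) * h)) *: v)).
have cE : cnt E.
  rewrite /E /a; apply: cntD; first by cnt.
  apply: cntN; apply: cntM; first by cnt.
  apply: (cnt_itg (F := fun p : R * R => F ((1 - p.1) *: q + p.1 *: c + (p.2 * ((1 - p.1) * h)) *: v))) => //.
  by cnt.
have : E 0 = 0.
  apply: zero_limit cE _ => s hs.
  rewrite /E -itgZ; last by cnt.
  have c1 : cnt (fun th : R => w (a s + (th * ((1 - s) * h)) *: v)) by cnt.
  have c2 : cnt (fun th : R => ((1 - s) * h) * F (a s + (th * ((1 - s) * h)) *: v)) by cnt.
  suff dd : forall th : R, 0 < th < 1 -> is_derive th 1 (fun th : R => w (a s + (th * ((1 - s) * h)) *: v))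
      (((1 - s) * h) * F (a s + (th * ((1 - s) * h)) *: v)).
    by rewrite (FTC ler01 c1 c2 dd) mul1r mul0r scale0r addr0 subrr.
  move=> th /andP[h0 h1]; rewrite [_ * h * _]mulrC.
  suff : is_derive (a s + (th * ((1 - s) * h)) *: v) v w (F (a s + (th * ((1 - s) * h)) *: v)).
    exact: dr_dir.
  apply: dw; have := Ain s th hs; rewrite (ltW h0) (ltW h1) => /(_ isT).
  rewrite /a scalerDr scalerA -!addrA [_ *: v + _]addrC.
  by rewrite [(1 - s) * (th * h)]mulrCA.
rewrite /E /a subr0 scale1r scale0r addr0 mul1r => /eqP.
by rewrite subr_eq0 => /eqP.
Qed.

End Derivatives.

(** * Partial derivatives on the square, integration by parts, mixed derivatives *)

Section Partial.
Context {R : realType}.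
Implicit Types (f g w wx wy : R * R -> R).

(** The variable of differentiation stays inside the open interval while the other one runs over the
    closed one: the fundamental theorem is then available on every line parallel to an axis, edges
    included. *)
Definition dX w wx := forall x y, 0 < x < 1 -> 0 <= y <= 1 ->
  is_derive (x : R) (1 : R) (fun z : R => w (z, y)) (wx (x, y)).
Definition dY w wy := forall x y, 0 <= x <= 1 -> 0 < y < 1 ->
  is_derive (y : R) (1 : R) (fun z : R => w (x, z)) (wy (x, y)).
Definition dT (T : R) (W Wt : R * R * R -> R) := forall x y t,
  0 <= x <= 1 -> 0 <= y <= 1 -> 0 < t < T ->
  is_derive (t : R) (1 : R) (fun z : R => W (x, y, z)) (Wt (x, y, t)).

Lemma dY_swap w wx : dX w wx -> dY (fun p => w (p.2, p.1)) (fun p => wx (p.2, p.1)).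
Proof. by move=> h x y hx hy; exact: h. Qed.

Lemma dXD f fx g gx : dX f fx -> dX g gx -> dX (fun p => f p + g p) (fun p => fx p + gx p).
Proof. by move=> df dg x y hx hy; apply: drD; [exact: df|exact: dg]. Qed.
Lemma dYD f fx g gx : dY f fx -> dY g gx -> dY (fun p => f p + g p) (fun p => fx p + gx p).
Proof. by move=> df dg x y hx hy; apply: drD; [exact: df|exact: dg]. Qed.
Lemma dXB f fx g gx : dX f fx -> dX g gx -> dX (fun p => f p - g p) (fun p => fx p - gx p).
Proof. by move=> df dg x y hx hy; apply: drB; [exact: df|exact: dg]. Qed.
Lemma dYB f fx g gx : dY f fx -> dY g gx -> dY (fun p => f p - g p) (fun p => fx p - gx p).
Proof. by move=> df dg x y hx hy; apply: drB; [exact: df|exact: dg]. Qed.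
Lemma dXM f fx g gx : dX f fx -> dX g gx ->
  dX (fun p => f p * g p) (fun p => fx p * g p + f p * gx p).
Proof.
move=> df dg x y hx hy.
exact: (drM (f := fun z => f (z, y)) (g := fun z => g (z, y)) (df x y hx hy) (dg x y hx hy)).
Qed.
Lemma dYM f fx g gx : dY f fx -> dY g gx ->
  dY (fun p => f p * g p) (fun p => fx p * g p + f p * gx p).
Proof.
move=> df dg x y hx hy.
exact: (drM (f := fun z => f (x, z)) (g := fun z => g (x, z)) (df x y hx hy) (dg x y hx hy)).
Qed.
Lemma dXZ (c : R) f fx : dX f fx -> dX (fun p => c * f p) (fun p => c * fx p).
Proof. by move=> df x y hx hy; apply: drZ; exact: df. Qed.
Lemma dYZ (c : R) f fx : dY f fx -> dY (fun p => c * f p) (fun p => c * fx p).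
Proof. by move=> df x y hx hy; apply: drZ; exact: df. Qed.

Lemma convex_in (a b x x' th : R) : a <= x <= b -> a <= x' <= b -> 0 <= th <= 1 ->
  a <= x + th * (x' - x) <= b.
Proof. by move=> /andP[? ?] /andP[? ?] /andP[? ?]; nra. Qed.

Lemma convex_in_oo (a b x x' th : R) : a <= x <= b -> a <= x' <= b -> x != x' -> 0 < th < 1 ->
  a < x + th * (x' - x) < b.
Proof.
move=> /andP[ax xb] /andP[ax' xb'] xx' /andP[t0 t1].
have -> : x + th * (x' - x) = (1 - th) * x + th * x' by ring.
have t1' : 0 < 1 - th by lra.
case: (ltgtP x x') xx' => // xx' _.
  have h1 : x < x' := xx'.
  have h2 : th * x < th * x' by rewrite ltr_pM2l.
  have h3 : (1 - th) * x < (1 - th) * x' by rewrite ltr_pM2l.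
  by apply/andP; split; lra.
have h2 : th * x' < th * x by rewrite ltr_pM2l.
have h3 : (1 - th) * x' < (1 - th) * x by rewrite ltr_pM2l.
by apply/andP; split; lra.
Qed.

(** The mean value theorem in integral form. Unlike an intermediate point, the averaged derivative
    depends continuously on the end points, as [dr_carath] demands. *)
Lemma slope1 (a b : R) (f df : R -> R) : cnt f -> cnt df ->
  (forall z : R, a < z < b -> is_derive z (1 : R) f (df z)) ->
  forall x x', a <= x <= b -> a <= x' <= b ->
  f x' = f x + (x' - x) * itg 0 1 (fun th : R => df (x + th * (x' - x))).
Proof.
move=> cf cdf dd x x' hx hx'; have [<-|nxx'] := eqVneq x x'; first by rewrite subrr mul0r addr0.
have c1 : cnt (fun th : R => f (x + th * (x' - x))) by cnt.
have c2 : cnt (fun th : R => (x' - x) * df (x + th * (x' - x))) by cnt.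
rewrite -itgZ; last by cnt.
suff dd' : forall th : R, 0 < th < 1 ->
    is_derive th (1 : R) (fun th : R => f (x + th * (x' - x))) ((x' - x) * df (x + th * (x' - x))).
  by rewrite (FTC ler01 c1 c2 dd') mul1r mul0r addr0 addrC subrK addrC subrK.
move=> th hth; rewrite mulrC.
have h := drD (dr_cst x th) (drM (dr_id th) (dr_cst (x' - x) th)).
apply: (@dr_comp _ f (fun th : R => x + th * (x' - x))).
  by apply: dd; exact: convex_in_oo.
by apply: (is_derive_eq h); rewrite add0r mulr0 addr0 mul1r.
Qed.

Lemma slopeX w wx : cnt w -> cnt wx -> dX w wx -> forall x x' y,
  0 <= x <= 1 -> 0 <= x' <= 1 -> 0 <= y <= 1 ->
  w (x', y) = w (x, y) + (x' - x) * itg 0 1 (fun th : R => wx (x + th * (x' - x), y)).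
Proof.
move=> cw cwx d x x' y hx hx' hy.
apply: (@slope1 0 1 (fun x => w (x, y)) (fun x => wx (x, y))) => //; [cnt|cnt|].
by move=> z hz; exact: d.
Qed.
Lemma slopeY w wy : cnt w -> cnt wy -> dY w wy -> forall x y y',
  0 <= x <= 1 -> 0 <= y <= 1 -> 0 <= y' <= 1 ->
  w (x, y') = w (x, y) + (y' - y) * itg 0 1 (fun th : R => wy (x, y + th * (y' - y))).
Proof.
move=> cw cwy d x y y' hx hy hy'.
apply: (@slope1 0 1 (fun y => w (x, y)) (fun y => wy (x, y))) => //; [cnt|cnt|].
by move=> z hz; exact: d.
Qed.
Lemma slopeT T (W Wt : R * R * R -> R) : cnt W -> cnt Wt -> dT T W Wt -> forall x y t t',
  0 <= x <= 1 -> 0 <= y <= 1 -> 0 <= t <= T -> 0 <= t' <= T ->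
  W (x, y, t') = W (x, y, t) + (t' - t) * itg 0 1 (fun th : R => Wt (x, y, t + th * (t' - t))).
Proof.
move=> cw cwy d x y t t' hx hy ht ht'.
apply: (@slope1 0 T (fun t => W (x, y, t)) (fun t => Wt (x, y, t))) => //; [cnt|cnt|].
by move=> z hz; exact: d.
Qed.

Lemma IBP1 (f df g dg : R -> R) : cnt f -> cnt df -> cnt g -> cnt dg ->
  (forall z : R, 0 < z < 1 -> is_derive z (1 : R) f (df z)) ->
  (forall z : R, 0 < z < 1 -> is_derive z (1 : R) g (dg z)) ->
  itg 0 1 (fun z => df z * g z) = f 1 * g 1 - f 0 * g 0 - itg 0 1 (fun z => f z * dg z).
Proof.
move=> cf cdf cg cdg hf hg.
have c1 : cnt (fun z => f z * g z) by cnt.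
have c2 : cnt (fun z => df z * g z + f z * dg z) by cnt.
have h : itg 0 1 (fun z => df z * g z + f z * dg z) = f 1 * g 1 - f 0 * g 0.
  by apply: (FTC ler01 c1 c2) => z hz; apply: drM; [exact: hf|exact: hg].
rewrite -h itgD; [by rewrite addrK|cnt|cnt].
Qed.

Lemma IBPy f fy g gy : cnt f -> cnt fy -> cnt g -> cnt gy -> dY f fy -> dY g gy ->
  (forall x, 0 <= x <= 1 -> f (x, 1) * g (x, 1) = f (x, 0) * g (x, 0)) ->
  J (fun p => fy p * g p) = - J (fun p => f p * gy p).
Proof.
move=> cf cfy cg cgy df dg bd.
have c1 : cnt (fun p => f p * gy p) by cnt.
have c2 : cnt (fun x => itg 0 1 (fun y => f (x, y) * gy (x, y))) by exact: (cnt_inner c1).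
rewrite /J -itgN //; apply: eq_itg => x hx.
have h1 (z : R) : 0 < z < 1 -> is_derive z (1 : R) (fun y => f (x, y)) (fy (x, z)).
  by move=> hz; exact: df.
have h2 (z : R) : 0 < z < 1 -> is_derive z (1 : R) (fun y => g (x, y)) (gy (x, z)).
  by move=> hz; exact: dg.
have c3 : cnt (fun y => f (x, y)) by cnt.
have c4 : cnt (fun y => fy (x, y)) by cnt.
have c5 : cnt (fun y => g (x, y)) by cnt.
have c6 : cnt (fun y => gy (x, y)) by cnt.
by rewrite (IBP1 c3 c4 c5 c6 h1 h2) bd // subrr sub0r.
Qed.

Lemma IBPx f fx g gx : cnt f -> cnt fx -> cnt g -> cnt gx -> dX f fx -> dX g gx ->
  (forall y, 0 <= y <= 1 -> f (1, y) * g (1, y) = f (0, y) * g (0, y)) ->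
  J (fun p => fx p * g p) = - J (fun p => f p * gx p).
Proof.
move=> cf cfx cg cgx df dg bd.
rewrite (J_swap (f := fun p => fx p * g p)); last by cnt.
rewrite (J_swap (f := fun p => f p * gx p)); last by cnt.
apply: (@IBPy (fun p => f (p.2, p.1)) (fun p => fx (p.2, p.1))
  (fun p => g (p.2, p.1)) (fun p => gx (p.2, p.1))); try cnt; try exact: dY_swap.
by move=> x hx; exact: bd.
Qed.

(** The increment from [t] to [z] is [z - t] times an average of [Wt], and the integral of this
    average is continuous in [z]. *)
Lemma dr_J T (W Wt : R * R * R -> R) : cnt W -> cnt Wt -> dT T W Wt ->
  forall t, 0 < t < T ->
  is_derive (t : R) (1 : R) (fun t => J (fun p => W (p, t))) (J (fun p => Wt (p, t))).
Proof.
move=> cW cWt dW t ht.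
pose k z (p : R * R) := itg 0 1 (fun th : R => Wt (p, t + th * (z - t))).
have ck : cnt (fun q : R * (R * R) => k q.1 q.2).
  by apply: (cnt_itg (F := fun q : R * (R * R) * R => Wt (q.1.2, t + q.2 * (q.1.1 - t)))) => //; cnt.
have cg : cnt (fun z => J (k z)) by exact: (cnt_J ck).
have -> : J (fun p => Wt (p, t)) = J (k t).
  by apply: eq_J => x y _ _; rewrite /k subrr (eq_itg (g := fun=> Wt (x, y, t)))
    ?itg_cst ?subr0 ?mulr1 // => th _; rewrite mulr0 addr0.
apply: (dr_carath ht _ cg) => z hz.
have hcc (v : R) : 0 < v < T -> 0 <= v <= T by move=> /andP[/ltW -> /ltW ->].
have ckz : cnt (k z).
  by apply: (cnt_itg (F := fun q : R * R * R => Wt (q.1, t + q.2 * (z - t)))) => //; cnt.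
rewrite mulrC -JZ // -JD; [|cnt|cnt].
apply: eq_J => x y hx hy; apply: (slopeT cW cWt dW) => //; exact: hcc.
Qed.

(** Schwarz's theorem, since [C21] provides both mixed derivatives but not their equality. The
    second difference of [w] over a square of side [d] is d^2 times the mean of [wxy], and also d^2
    times the mean of [wyx]; then [d] tends to 0. *)
Lemma mixed_partials w wx wy wxy wyx : cnt w -> cnt wx -> cnt wy -> cnt wxy -> cnt wyx ->
  dX w wx -> dY w wy -> dY wx wxy -> dX wy wyx ->
  forall x y, 0 < x < 1 -> 0 < y < 1 -> wxy (x, y) = wyx (x, y).
Proof.
move=> cw cwx cwy cwxy cwyx dwx dwy dwxy dwyx x y /andP[x0 x1] /andP[y0 y1].
(* The largest side for which the square with lower left corner [(x, y)] stays in the unit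
   square. *)
pose e := Num.min (1 - x) (1 - y).
have e0 : 0 < e by rewrite lt_min !subr_gt0 x1 y1.
have ex : e <= 1 - x by rewrite ge_min lexx.
have ey : e <= 1 - y by rewrite ge_min lexx orbT.
pose K (s : R) := J (fun p => wxy (x + p.1 * (s * e), y + p.2 * (s * e)))
  - J (fun p => wyx (x + p.1 * (s * e), y + p.2 * (s * e))).
have cK : cnt K.
  apply: cntD; [|apply: cntN].
    by apply: (cnt_J (F := fun q : R * (R * R) => wxy (x + q.2.1 * (q.1 * e), y + q.2.2 * (q.1 * e)))); cnt.
  by apply: (cnt_J (F := fun q : R * (R * R) => wyx (x + q.2.1 * (q.1 * e), y + q.2.2 * (q.1 * e)))); cnt.
have := zero_limit cK.
rewrite /K mul0r.
rewrite (@eq_J _ (fun p => wxy (x + p.1 * 0, y + p.2 * 0)) (fun=> wxy (x, y))); last first.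
  by move=> *; rewrite /= !mulr0 !addr0.
rewrite (@eq_J _ (fun p => wyx (x + p.1 * 0, y + p.2 * 0)) (fun=> wyx (x, y))); last first.
  by move=> *; rewrite /= !mulr0 !addr0.
rewrite !J_cst => h; apply/eqP; rewrite -subr_eq0; apply/eqP; apply: h => s /andP[s0 s1].
set d := s * e; have d0 : 0 < d by rewrite mulr_gt0.
have de : d <= e by rewrite ler_piMl // ltW.
have hx : 0 <= x <= 1 by rewrite !ltW.
have hy : 0 <= y <= 1 by rewrite !ltW.
have xdx : x + d - x = d by ring.
have ydy : y + d - y = d by ring.
have hxd : 0 <= x + d <= 1 by apply/andP; split; lra.
have hyd : 0 <= y + d <= 1 by apply/andP; split; lra.
have xd th : 0 <= th <= 1 -> 0 <= x + th * d <= 1.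
  by move=> hth; have := convex_in hx hxd hth; rewrite xdx.
have yd th : 0 <= th <= 1 -> 0 <= y + th * d <= 1.
  by move=> hth; have := convex_in hy hyd hth; rewrite ydy.
have D1 : w (x + d, y + d) - w (x, y + d) - (w (x + d, y) - w (x, y)) =
   d * (d * J (fun p => wxy (x + p.1 * d, y + p.2 * d))).
  rewrite (slopeX cw cwx dwx hx hxd hyd) (slopeX cw cwx dwx hx hxd hy).
  rewrite xdx; set I1 := itg _ _ _; set I2 := itg _ _ _.
  have -> : w (x, y + d) + d * I1 - w (x, y + d) - (w (x, y) + d * I2 - w (x, y)) = d * (I1 - I2) by ring.
  congr (_ * _); rewrite /I1 /I2.
  rewrite -itgB; [|cnt|cnt].
  rewrite /J -itgZ; last by apply: (cnt_inner (f := fun p => wxy (x + p.1 * d, y + p.2 * d))); cnt.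
  apply: eq_itg => th hth; rewrite (slopeY cwx cwxy dwxy (xd _ hth) hy hyd).
  by rewrite ydy addrAC subrr add0r.
have D2 : w (x + d, y + d) - w (x, y + d) - (w (x + d, y) - w (x, y)) =
   d * (d * J (fun p => wyx (x + p.1 * d, y + p.2 * d))).
  have -> : w (x + d, y + d) - w (x, y + d) - (w (x + d, y) - w (x, y)) =
    w (x + d, y + d) - w (x + d, y) - (w (x, y + d) - w (x, y)) by ring.
  rewrite (slopeY cw cwy dwy hxd hy hyd) (slopeY cw cwy dwy hx hy hyd).
  rewrite ydy; set I1 := itg _ _ _; set I2 := itg _ _ _.
  have -> : w (x + d, y) + d * I1 - w (x + d, y) - (w (x, y) + d * I2 - w (x, y)) = d * (I1 - I2) by ring.
  congr (_ * _); rewrite /I1 /I2.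
  rewrite -itgB; [|cnt|cnt].
  rewrite J_swap; last by cnt.
  rewrite /J -itgZ; last by apply: (cnt_inner (f := fun p => wyx (x + p.2 * d, y + p.1 * d))); cnt.
  apply: eq_itg => th hth; rewrite (slopeX cwy cwyx dwyx hx hxd (yd _ hth)).
  by rewrite xdx addrAC subrr add0r.
have := D1; rewrite D2 => /(mulfI (lt0r_neq0 d0)) /(mulfI (lt0r_neq0 d0)) ->.
by rewrite subrr.
Qed.

(** Formally f_x g_y - f_y g_x = (f g_y)_x - (f g_x)_y, but g_xy need not exist. So the function
    N(y), the integral of f g_x over x, is differentiated instead: the increment of g_x in y is
    integrated by parts in x before the limit, which leaves first derivatives only. The conditions
    at x = 0 and x = 1 remove the boundary terms, and g_x = 0 on the two other edges gives N(0) =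
    N(1) = 0. *)
Lemma null_lagrangian f fx fy g gx gy : cnt f -> cnt fx -> cnt fy -> cnt g -> cnt gx -> cnt gy ->
  dX f fx -> dY f fy -> dX g gx -> dY g gy ->
  (forall y, 0 <= y <= 1 -> f (0, y) = 0) -> (forall y, 0 <= y <= 1 -> g (1, y) = 0) ->
  (forall x, 0 <= x <= 1 -> gx (x, 0) = 0) -> (forall x, 0 <= x <= 1 -> gx (x, 1) = 0) ->
  J (fun p => fx p * gy p) = J (fun p => fy p * gx p).
Proof.
move=> cf cfx cfy cg cgx cgy dfx dfy dgx dgy f0 g1 gx0 gx1.
pose N (y : R) := itg 0 1 (fun x => f (x, y) * gx (x, y)).
pose dN (y : R) := itg 0 1 (fun x => fy (x, y) * gx (x, y) - fx (x, y) * gy (x, y)).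
have cN : cnt N.
  by apply: (cnt_inner (f := fun p => f (p.2, p.1) * gx (p.2, p.1))); cnt.
have cdN : cnt dN.
  by apply: (cnt_inner (f := fun p => fy (p.2, p.1) * gx (p.2, p.1) - fx (p.2, p.1) * gy (p.2, p.1))); cnt.
have hcc (v : R) : 0 < v < 1 -> 0 <= v <= 1 by move=> /andP[/ltW -> /ltW ->].
suff dd : forall y : R, 0 < y < 1 -> is_derive y (1 : R) N (dN y).
  have := FTC ler01 cN cdN dd.
  have -> : N 1 = 0.
    by rewrite /N (eq_itg (g := fun=> 0)) ?itg_cst ?mul0r // => x hx; rewrite gx1 // mulr0.
  have -> : N 0 = 0.
    by rewrite /N (eq_itg (g := fun=> 0)) ?itg_cst ?mul0r // => x hx; rewrite gx0 // mulr0.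
  rewrite subrr => h; apply/eqP; rewrite eq_sym -subr_eq0 -JB; [|cnt|cnt].
  rewrite J_swap; last by cnt.
  by rewrite /J /= -[X in _ == X]h /dN.
move=> y hy.
pose ky (k : R * R -> R) (q : R * R) := itg 0 1 (fun th : R => k (q.2, y + th * (q.1 - y))).
have cky k : cnt k -> cnt (ky k).
  move=> ck; apply: (cnt_itg (F := fun q : R * R * R => k (q.1.2, y + q.2 * (q.1.1 - y)))) => //; cnt.
have cfy' := cky _ cfy; have cgy' := cky _ cgy.
have kyy k x : ky k (y, x) = k (x, y).
  by rewrite /ky (eq_itg (g := fun=> k (x, y))) ?itg_cst ?subr0 ?mulr1 // => th _ /=;
    rewrite subrr mulr0 addr0.
pose g' (z : R) := itg 0 1 (fun x => ky fy (z, x) * gx (x, z) - fx (x, y) * ky gy (z, x)).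
have cg' : cnt g'.
  by apply: (cnt_inner (f := fun p => ky fy (p.1, p.2) * gx (p.2, p.1) - fx (p.2, y) * ky gy (p.1, p.2))); cnt.
have -> : dN y = g' y by apply: eq_itg => x _; rewrite !kyy.
apply: (dr_carath hy _ cg') => z hz.
have -> : N z = itg 0 1 (fun x => f (x, y) * gx (x, y))
   + (itg 0 1 (fun x => (f (x, z) - f (x, y)) * gx (x, z))
   + itg 0 1 (fun x => (gx (x, z) - gx (x, y)) * f (x, y))).
  rewrite -itgD; [|cnt|cnt]; rewrite -itgD; [|cnt|cnt].
  by apply: eq_itg => x _; ring.
congr (_ + _).
have h1 (x : R) : 0 < x < 1 ->
    is_derive x (1 : R) (fun x => g (x, z) - g (x, y)) (gx (x, z) - gx (x, y)).
  by move=> hx; apply: drB; apply: dgx => //; exact: hcc.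
have h2 (x : R) : 0 < x < 1 -> is_derive x (1 : R) (fun x => f (x, y)) (fx (x, y)).
  by move=> hx; apply: dfx => //; exact: hcc.
have c3 : cnt (fun x => g (x, z) - g (x, y)) by cnt.
have c4 : cnt (fun x => gx (x, z) - gx (x, y)) by cnt.
have c5 : cnt (fun x => f (x, y)) by cnt.
have c6 : cnt (fun x => fx (x, y)) by cnt.
rewrite (IBP1 c3 c4 c5 c6 h1 h2) !g1 ?hcc // f0 ?hcc // subrr mulr0 mul0r subr0 sub0r -itgB; [|cnt|cnt].
rewrite mulrC /g' -itgZ; last by cnt.
apply: eq_itg => x hx.
rewrite (slopeY cf cfy dfy hx (hcc _ hy) (hcc _ hz)) (slopeY cg cgy dgy hx (hcc _ hy) (hcc _ hz)).
by rewrite /ky /=; ring.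
Qed.
End Partial.

(** * Orthonormal families of test functions *)

Section SumCalculus.
Context {R : realType}.

Lemma cnt_sumn (T : topologicalType) n (f : nat -> T -> R) :
  (forall i, cnt (f i)) -> cnt (fun x => \sum_(i < n) f i x).
Proof. by move=> cf; apply: (cnt_sum (f := fun i : 'I_n => f i)) => i; exact: cf. Qed.

Lemma J_sum n (f : nat -> R * R -> R) : (forall i, cnt (f i)) ->
  J (fun p => \sum_(i < n) f i p) = \sum_(i < n) J (f i).
Proof.
move=> cf; elim: n => [|n IH].
  rewrite big_ord0 -[RHS](J_cst 0); apply: eq_J => x y _ _; by rewrite big_ord0.
rewrite big_ord_recr /= -IH -JD; [|exact: cnt_sumn|exact: cf].
by apply: eq_J => x y _ _; rewrite big_ord_recr.
Qed.

Lemma dX_sum n (f fx : nat -> R * R -> R) : (forall i, dX (f i) (fx i)) ->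
  dX (fun p => \sum_(i < n) f i p) (fun p => \sum_(i < n) fx i p).
Proof.
move=> df x y hx hy; apply: (dr_sum (f := fun (i : 'I_n) z => f i (z, y))) => i.
exact: df.
Qed.
Lemma dY_sum n (f fx : nat -> R * R -> R) : (forall i, dY (f i) (fx i)) ->
  dY (fun p => \sum_(i < n) f i p) (fun p => \sum_(i < n) fx i p).
Proof.
move=> df x y hx hy; apply: (dr_sum (f := fun (i : 'I_n) z => f i (x, z))) => i.
exact: df.
Qed.
End SumCalculus.

(** Only the Dirichlet condition on the side x = 1 is imposed. On the three other sides the flux of
    the Fokker-Planck equation vanishes, which is a natural condition of the weak form. *)
Record test (R : realType) := Test {
  tv : R * R -> R; tx : R * R -> R; ty : R * R -> R;
  cnt_tv : cnt tv; cnt_tx : cnt tx; cnt_ty : cnt ty;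
  dX_t : dX tv tx; dY_t : dY tv ty;
  tv1 : forall y, 0 <= y <= 1 -> tv (1, y) = 0
}.

Ltac cnt_hook ::= first [simple apply cnt_tv | simple apply cnt_tx | simple apply cnt_ty
  | lazymatch goal with |- cnt (fun t => J (fun p => @?F t p)) => apply: (cnt_Jt (F := F)) end].

Section Tests.
Context {R : realType}.

Program Definition tlin (k : nat) (c : nat -> R) (e : nat -> test R) : test R :=
  @Test R (fun p => \sum_(i < k) c i * tv (e i) p) (fun p => \sum_(i < k) c i * tx (e i) p)
    (fun p => \sum_(i < k) c i * ty (e i) p) _ _ _ _ _ _.
Next Obligation.
move=> k c e; apply: (@cnt_sumn R _ k (fun i p => c i * tv (e i) p)) => i.
cnt.
Qed.
Next Obligation.
move=> k c e; apply: (@cnt_sumn R _ k (fun i p => c i * tx (e i) p)) => i.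
cnt.
Qed.
Next Obligation.
move=> k c e; apply: (@cnt_sumn R _ k (fun i p => c i * ty (e i) p)) => i.
cnt.
Qed.
Next Obligation.
move=> k c e; apply: (@dX_sum R k (fun i p => c i * tv (e i) p)
  (fun i p => c i * tx (e i) p)) => i; apply: dXZ; exact: dX_t.
Qed.
Next Obligation.
move=> k c e; apply: (@dY_sum R k (fun i p => c i * tv (e i) p)
  (fun i p => c i * ty (e i) p)) => i; apply: dYZ; exact: dY_t.
Qed.
Next Obligation.
by move=> k c e y hy /=; rewrite big1 // => i _; rewrite tv1 // mulr0.
Qed.

(** With [l = 1] this is a residual; with [l] the inverse of its norm it is the next Gram-Schmidt
    vector. *)
Program Definition tres (l : R) (s r : test R) : test R :=
  @Test R (fun p => l * (tv s p - tv r p)) (fun p => l * (tx s p - tx r p))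
    (fun p => l * (ty s p - ty r p)) _ _ _ _ _ _.
Next Obligation. by move=> l s r; cnt. Qed.
Next Obligation. by move=> l s r; cnt. Qed.
Next Obligation. by move=> l s r; cnt. Qed.
Next Obligation. by move=> l s r; apply: dXZ; apply: dXB; exact: dX_t. Qed.
Next Obligation. by move=> l s r; apply: dYZ; apply: dYB; exact: dY_t. Qed.
Next Obligation. by move=> l s r y hy /=; rewrite !tv1 // subrr mulr0. Qed.

(** The function vanishes at x = 1 and the side has length 1, so each value is minus an integral of
    [tx] over at most unit length, and the constant is 1. *)
Lemma test_poincare (s : test R) : J (fun p => tv s p ^+ 2) <= J (fun p => tx s p ^+ 2).
Proof.
have cv := cnt_tv s; have cx := cnt_tx s.
have cv2 : cnt (fun p : R * R => tv s p ^+ 2) by cnt.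
have cx2 : cnt (fun p : R * R => tx s p ^+ 2) by cnt.
rewrite (J_swap cv2) (J_swap cx2).
apply: itg_le.
- by apply: (cnt_inner (f := fun p => tv s (p.2, p.1) ^+ 2)); cnt.
- by apply: (cnt_inner (f := fun p => tx s (p.2, p.1) ^+ 2)); cnt.
move=> y hy /=.
pose I2 := itg 0 1 (fun x => tx s (x, y) ^+ 2).
have cxy : cnt (fun x => tx s (x, y)) by cnt.
have cxy2 : cnt (fun x => tx s (x, y) ^+ 2) by cnt.
have cvy2 : cnt (fun x => tv s (x, y) ^+ 2) by cnt.
suff h x : 0 <= x <= 1 -> tv s (x, y) ^+ 2 <= I2.
  apply: (@le_trans _ _ (itg 0 1 (fun=> I2))); first by apply: itg_le => //; cnt.
  by rewrite itg_cst // subr0 mulr1.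
move=> /andP[x0 x1].
have FT : itg x 1 (fun x => tx s (x, y)) = - tv s (x, y).
  have c1 : cnt (fun x => tv s (x, y)) by cnt.
  have dd z : x < z < 1 -> is_derive (z : R) (1 : R) (fun x => tv s (x, y)) (tx s (z, y)).
    by move=> /andP[h1 h2]; apply: dX_t => //; rewrite h2 (le_lt_trans x0 h1).
  by rewrite (FTC x1 c1 cxy dd) tv1 // sub0r.
have FTsq : (tv s (x, y)) ^+ 2 <= itg x 1 (fun x => tx s (x, y) ^+ 2).
  set v := tv s (x, y) in FT *.
  (* This square replaces Cauchy-Schwarz: expanded with [FT], it says that v^2 (1 + x) is at most
     the integral of [tx] squared. *)
  have h : 0 <= itg x 1 (fun z => (tx s (z, y) + v) ^+ 2) by apply: itg_ge0 => z _; exact: sqr_ge0.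
  have E : itg x 1 (fun z => (tx s (z, y) + v) ^+ 2) =
    itg x 1 (fun x => tx s (x, y) ^+ 2) + (2 * v * - v + v ^+ 2 * (1 - x)).
    rewrite -FT -itgZ // -itg_cst // -itgD; [|cnt|cnt]; rewrite -itgD; [|cnt|cnt].
    by apply: eq_itg => z _; ring.
  rewrite E in h.
  have h2 : 0 <= v ^+ 2 * x by rewrite mulr_ge0 // sqr_ge0.
  nra.
apply: le_trans FTsq _.
rewrite /I2 (itg_split cxy2 x0 x1) lerDr; apply: itg_ge0 => z _; exact: sqr_ge0.
Qed.
End Tests.

Opaque J itg.

(** Best approximation in coordinates: [d] belongs to the projection, [c] to any competitor, and the
    hypothesis is |c - d|^2 >= 0. The unreduced shape is the one produced by [tform_res2]. *)
Lemma projection_algebra (R : realFieldType) (m cc cd dd : R) : 0 <= cc - 2 * cd + dd ->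
  1 ^+ 2 * (m - 2 * dd + dd) <= 1 ^+ 2 * (m - 2 * cd + cc).
Proof. by move=> h; rewrite expr1n !mul1r; lra. Qed.

(** * The elliptic bilinear form, Gram-Schmidt and the projection error *)

Section Galerkin.
Context {R : realType}.
Variables (al be : R * R -> R) (s0 : R).
Hypotheses (cal : cnt al) (cbe : cnt be) (s0_gt0 : 0 < s0).
Hypothesis al_ge : forall x y : R, 0 <= x <= 1 -> 0 <= y <= 1 -> s0 <= al (x, y).
Hypothesis be_ge : forall x y : R, 0 <= x <= 1 -> 0 <= y <= 1 -> s0 <= be (x, y).

Definition aform (fx fy gx gy : R * R -> R) : R :=
  J (fun p => al p * (fx p * gx p) + be p * (fy p * gy p)).
Definition tform (s r : test R) : R := aform (tx s) (ty s) (tx r) (ty r).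

Lemma aformC fx fy gx gy : aform fx fy gx gy = aform gx gy fx fy.
Proof. by apply: eq_J => x y _ _ /=; ring. Qed.

Lemma aform_ge (fx fy : R * R -> R) : cnt fx -> cnt fy ->
  s0 * J (fun p => fx p ^+ 2 + fy p ^+ 2) <= aform fx fy fx fy.
Proof.
move=> cx cy; rewrite -JZ; last by cnt.
apply: J_le; [cnt|cnt|move=> x y hx hy].
have h1 := al_ge hx hy; have h2 := be_ge hx hy.
have := sqr_ge0 (fx (x, y)); have := sqr_ge0 (fy (x, y)); rewrite -!expr2; nra.
Qed.

Lemma aform_ge0 (fx fy : R * R -> R) : cnt fx -> cnt fy -> 0 <= aform fx fy fx fy.
Proof.
move=> cx cy; apply: le_trans (aform_ge cx cy); rewrite mulr_ge0 ?(ltW s0_gt0) //.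
by apply: J_ge0 => x y _ _; rewrite addr_ge0 ?sqr_ge0.
Qed.

Lemma tform_ge0 s : 0 <= tform s s.
Proof. by apply: aform_ge0; [exact: cnt_tx|exact: cnt_ty]. Qed.

Lemma aform_lin k c (e : nat -> test R) (gx gy : R * R -> R) : cnt gx -> cnt gy ->
  aform (tx (tlin k c e)) (ty (tlin k c e)) gx gy =
  \sum_(i < k) c i * aform (tx (e i)) (ty (e i)) gx gy.
Proof.
move=> cx cy.
have ci i : cnt (fun p => c i * (al p * (tx (e i) p * gx p) + be p * (ty (e i) p * gy p))).
  by cnt.
transitivity (\sum_(i < k) J (fun p => c i * (al p * (tx (e i) p * gx p) + be p * (ty (e i) p * gy p)))).
  rewrite -(J_sum k ci); apply: eq_J => x y _ _ /=.
  rewrite !mulr_suml !mulr_sumr -big_split /=; apply: eq_bigr => i _; ring.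
apply: eq_bigr => i _; rewrite JZ //.
by cnt.
Qed.

Lemma tform_lin k c (e : nat -> test R) r :
  tform (tlin k c e) r = \sum_(i < k) c i * tform (e i) r.
Proof. by apply: aform_lin; [exact: cnt_tx|exact: cnt_ty]. Qed.

Lemma tformC s r : tform s r = tform r s.
Proof. exact: aformC. Qed.

Definition ON k (e : nat -> test R) :=
  forall i j, (i < k)%N -> (j < k)%N -> tform (e i) (e j) = (i == j)%:R.

Lemma tform_lin_ON k c e j : ON k e -> (j < k)%N -> tform (tlin k c e) (e j) = c j.
Proof.
move=> on jk; rewrite tform_lin (bigD1 (Ordinal jk)) //= on // eqxx mulr1 big1 ?addr0 //.
move=> i /negP ij; rewrite on //.
have -> : (i == j :> nat) = false by apply/negP => /eqP h; apply: ij; apply/eqP/val_inj.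
by rewrite mulr0.
Qed.

Lemma tform_linlin k c d e : ON k e -> tform (tlin k c e) (tlin k d e) = \sum_(i < k) c i * d i.
Proof.
move=> on; rewrite tform_lin; apply: eq_bigr => i _.
by rewrite tformC tform_lin_ON.
Qed.

Lemma tform_res l s r h : tform (tres l s r) h = l * (tform s h - tform r h).
Proof.
rewrite /tform /aform -JB; [|cnt|cnt]; rewrite -JZ; last by cnt.
by apply: eq_J => x y _ _ /=; ring.
Qed.

Lemma tform_res2 l s r : tform (tres l s r) (tres l s r) =
  l ^+ 2 * (tform s s - 2 * tform r s + tform r r).
Proof.
rewrite tform_res [tform s _]tformC [tform r (tres _ _ _)]tformC !tform_res (tformC s r).
by move: (tform s s) (tform r s) (tform r r) => a b c; ring.
Qed.

(** A vector whose residual has norm zero is skipped, so [k] can be smaller than [n]. Membership in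
    the span is recorded only up to a residual of norm zero, which is all that [projection_error]
    needs. *)
Lemma gram_schmidt (s : nat -> test R) n : exists k e, ON k e /\
  forall j, (j < n)%N -> exists c, tform (tres 1 (s j) (tlin k c e)) (tres 1 (s j) (tlin k c e)) = 0.
Proof.
elim: n => [|n [k [e [on H]]]]; first by exists 0%N, s.
pose c i := tform (s n) (e i).
pose r l := tres l (s n) (tlin k c e).
have re l i : (i < k)%N -> tform (r l) (e i) = 0.
  by move=> ik; rewrite tform_res tform_lin_ON // subrr mulr0.
have [r0|rn0] := eqVneq (tform (r 1) (r 1)) 0.
  exists k, e; split=> // j; rewrite ltnS leq_eqVlt => /predU1P[->|]; last exact: H.
  by exists c.
have rp : 0 < tform (r 1) (r 1) by rewrite lt0r rn0 tform_ge0.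
pose rho := Num.sqrt (tform (r 1) (r 1)).
have rho0 : 0 < rho by rewrite sqrtr_gt0.
pose e' i := if (i < k)%N then e i else r rho^-1.
have on' : ON k.+1 e'.
  have rr : tform (r rho^-1) (r rho^-1) = 1.
    have := tform_res2 1 (s n) (tlin k c e); rewrite expr1n mul1r => h.
    rewrite tform_res2 -h exprVn sqr_sqrtr; last exact: ltW.
    by rewrite mulVf.
  move=> i j; rewrite !ltnS /e' => ik jk.
  case: (ltnP i k) => ik'; case: (ltnP j k) => jk'.
  - exact: on.
  - have -> : (i == j) = false by apply/negP => /eqP E; move: ik'; rewrite E ltnNge jk'.
    by rewrite tformC re.
  - have -> : (i == j) = false by apply/negP => /eqP E; move: jk'; rewrite -E ltnNge ik'.
    by rewrite re.
  - have -> : i = j by apply/eqP; rewrite eqn_leq (leq_trans ik jk') (leq_trans jk ik').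
    by rewrite eqxx.
exists k.+1, e'; split=> // j; rewrite ltnS leq_eqVlt => /predU1P[->|/H [d Hd]].
  (* The new vector is the residual divided by [rho], so [s n] has the coordinate [rho] along it. *)
  exists (fun i => if (i < k)%N then c i else rho).
  rewrite -[RHS](J_cst 0); apply: eq_J => x y _ _ /=.
  rewrite !big_ord_recr /= ltnn /e' ltnn /=.
  have rw (h : test R -> R * R -> R) : \sum_(i < k) (if (i < k)%N then c i else rho) *
      h (if (i < k)%N then e i else r rho^-1) (x, y) = \sum_(i < k) c i * h (e i) (x, y).
    by apply: eq_bigr => i _; rewrite ltn_ord.
  rewrite (rw (@tx R)) (rw (@ty R)) !mulrA divff ?lt0r_neq0 // !mul1r.
  have z (u v : R) : u - (v + (u - v)) = 0 by ring.
  by rewrite !z !mulr0 addr0.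
exists (fun i => if (i < k)%N then d i else 0).
rewrite -[RHS]Hd; apply: eq_J => x y _ _ /=.
rewrite !big_ord_recr /= ltnn /e' ltnn /=. rewrite !mul0r !addr0.
have rw (h : test R -> R * R -> R) : \sum_(i < k) (if (i < k)%N then d i else 0) *
    h (if (i < k)%N then e i else r rho^-1) (x, y) = \sum_(i < k) d i * h (e i) (x, y).
  by apply: eq_bigr => i _; rewrite ltn_ord.
by rewrite (rw (@tx R)) (rw (@ty R)).
Qed.

(** Poincare and ellipticity bound the L2 error by the energy error of the projection; the
    projection is at least as good as the combination with coefficients [c]; that combination
    coincides with [s] in energy. The factor 2 comes from (u - w)^2 <= 2 (u - v)^2 + 2 (v - w)^2. *)
Lemma projection_error k e m s c : ON k e ->
  tform (tres 1 s (tlin k c e)) (tres 1 s (tlin k c e)) = 0 ->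
  s0 * J (fun p => (tv m p - tv (tlin k (fun i => tform m (e i)) e) p) ^+ 2) <=
  2 * tform (tres 1 m s) (tres 1 m s).
Proof.
move=> on hc; set P := tlin _ (fun i => tform m (e i)) _.
have h1 : s0 * J (fun p => (tv m p - tv P p) ^+ 2) <= tform (tres 1 m P) (tres 1 m P).
  have cx := cnt_tx (tres 1 m P); have cy := cnt_ty (tres 1 m P).
  apply: le_trans (aform_ge cx cy); rewrite ler_pM2l //.
  apply: (@le_trans _ _ (J (fun p => tx (tres 1 m P) p ^+ 2))).
    rewrite (@eq_J _ _ (fun p => tv (tres 1 m P) p ^+ 2)) ?test_poincare //.
    by move=> x y _ _ /=; rewrite mul1r.
  by apply: J_le; [cnt|cnt|move=> x y _ _; rewrite lerDl sqr_ge0].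
apply: le_trans h1 _.
have h2 : tform (tres 1 m P) (tres 1 m P) <= tform (tres 1 m (tlin k c e)) (tres 1 m (tlin k c e)).
  pose d i := tform m (e i).
  have eq1 b : tform (tlin k b e) m = \sum_(i < k) b i * d i.
    by rewrite tform_lin; apply: eq_bigr => i _; rewrite tformC.
  have sq0 : 0 <= \sum_(i < k) (c i - d i) ^+ 2 by apply: sumr_ge0 => i _; exact: sqr_ge0.
  have sqE : \sum_(i < k) (c i - d i) ^+ 2 =
      \sum_(i < k) c i * c i - 2 * (\sum_(i < k) c i * d i) + \sum_(i < k) d i * d i.
    by rewrite mulr_sumr -sumrB -big_split; apply: eq_bigr => i _ /=; ring.
  have hP := tform_res2 1 m P; have hC := tform_res2 1 m (tlin k c e).
  rewrite (eq1 d) (tform_linlin d d on) in hP; rewrite (eq1 c) (tform_linlin c c on) in hC.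
  rewrite hP hC; apply: projection_algebra; rewrite -sqE; exact: sq0.
apply: le_trans h2 _.
rewrite -[leRHS]addr0 -[X in _ <= _ + X](mulr0 2) -hc -mulrDr.
rewrite /tform /aform -JD; [|cnt|cnt]; rewrite -JZ; last by cnt.
apply: J_le; [cnt|cnt|move=> x y hx hy].
have h3 := al_ge hx hy; have h4 := be_ge hx hy.
set a := al (x, y) in h3 *; set b := be (x, y) in h4 *.
have sq (u v w : R) : (1 * (u - w)) * (1 * (u - w)) <=
  2 * ((1 * (u - v)) * (1 * (u - v)) + (1 * (v - w)) * (1 * (v - w))).
  by have := sqr_ge0 (u - v - (v - w)); nra.
have a0 : 0 <= a by apply: le_trans h3; exact: ltW.
have b0 : 0 <= b by apply: le_trans h4; exact: ltW.
rewrite [leLHS]/=.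
apply: le_trans (lerD (ler_wpM2l a0 (sq _ (tx s (x, y)) _)) (ler_wpM2l b0 (sq _ (ty s (x, y)) _))) _.
rewrite /=; set u1 := tx m _; set u2 := tx s _; set u3 := \sum_(i < k) _.
set v1 := ty m _; set v2 := ty s _; set v3 := \sum_(i < k) _.
by rewrite le_eqVlt; apply/orP; left; apply/eqP; ring.
Qed.

End Galerkin.

(** * The Carleman estimate *)

Section Elementary.
Context {R : realType}.
Implicit Types a b s : R.
Lemma young s a b : 0 < s -> a * b <= s^-1 / 2 * a ^+ 2 + s / 2 * b ^+ 2.
Proof.
move=> s0; rewrite -subr_ge0.
have -> : s^-1 / 2 * a ^+ 2 + s / 2 * b ^+ 2 - a * b = s / 2 * (b - s^-1 * a) ^+ 2.
  by field; exact: lt0r_neq0.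
by rewrite mulr_ge0 ?sqr_ge0 // divr_ge0 // ltW.
Qed.
Lemma half_absorb s a b (S : R) : s * b <= S -> S <= s^-1 / 2 * a + s / 2 * b -> S <= s^-1 * a.
Proof.
have -> : s^-1 / 2 * a = s^-1 * a / 2 by rewrite mulrAC.
have -> : s / 2 * b = s * b / 2 by rewrite mulrAC.
by move: (s^-1 * a) (s * b) => x y; lra.
Qed.
End Elementary.

Section Bessel.
Context {R : realType}.
Variables (al be : R * R -> R) (s0 : R).
Hypotheses (cal : cnt al) (cbe : cnt be) (s0_gt0 : 0 < s0).
Hypothesis al_ge : forall x y : R, 0 <= x <= 1 -> 0 <= y <= 1 -> s0 <= al (x, y).
Hypothesis be_ge : forall x y : R, 0 <= x <= 1 -> 0 <= y <= 1 -> s0 <= be (x, y).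
Variables (k : nat) (e : nat -> test R).
Hypothesis on : ON al be k e.

Lemma J_tlin (g : R * R -> R) (c : nat -> R) : cnt g ->
  \sum_(i < k) c i * J (fun p => g p * tv (e i) p) = J (fun p => g p * tv (tlin k c e) p).
Proof.
move=> cg; transitivity (\sum_(i < k) J (fun p => c i * (g p * tv (e i) p))).
  by apply: eq_bigr => i _; rewrite JZ //; cnt.
rewrite -(@J_sum _ k (fun i p => c i * (g p * tv (e i) p))); last by move=> i; cnt.
by apply: eq_J => x y _ _ /=; rewrite mulr_sumr; apply: eq_bigr => i _; rewrite mulrCA.
Qed.

Lemma J_tlin_grad (F1 F2 : R * R -> R) (c : nat -> R) : cnt F1 -> cnt F2 ->
  \sum_(i < k) c i * J (fun p => F1 p * tx (e i) p + F2 p * ty (e i) p) =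
  J (fun p => F1 p * tx (tlin k c e) p + F2 p * ty (tlin k c e) p).
Proof.
move=> c1 c2; transitivity (\sum_(i < k) J (fun p => c i * (F1 p * tx (e i) p + F2 p * ty (e i) p))).
  by apply: eq_bigr => i _; rewrite JZ //; cnt.
rewrite -(@J_sum _ k (fun i p => c i * (F1 p * tx (e i) p + F2 p * ty (e i) p))); last by move=> i; cnt.
apply: eq_J => x y _ _ /=; rewrite !mulr_sumr -big_split /=; apply: eq_bigr => i _; ring.
Qed.

(** Let [z] be the combination of the [e i] whose coefficients are the numbers being squared. Then
    the sum equals both (F, grad z) and a(z, z), the latter being at least s0 |grad z|^2; Young's
    inequality absorbs half of the sum. The constant does not involve [k]. *)
Lemma bessel_grad (F1 F2 : R * R -> R) : cnt F1 -> cnt F2 ->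
  \sum_(i < k) J (fun p => F1 p * tx (e i) p + F2 p * ty (e i) p) ^+ 2 <=
  s0^-1 * J (fun p => F1 p ^+ 2 + F2 p ^+ 2).
Proof.
move=> c1 c2; pose c i := J (fun p => F1 p * tx (e i) p + F2 p * ty (e i) p).
have E : \sum_(i < k) c i ^+ 2 = J (fun p => F1 p * tx (tlin k c e) p + F2 p * ty (tlin k c e) p).
  by rewrite -J_tlin_grad //; apply: eq_bigr => i _; rewrite expr2.
have E2 : tform al be (tlin k c e) (tlin k c e) = \sum_(i < k) c i ^+ 2.
  by rewrite tform_linlin //; apply: eq_bigr => i _; rewrite expr2.
have h1 := aform_ge cal cbe al_ge be_ge (cnt_tx (tlin k c e)) (cnt_ty (tlin k c e)).
rewrite -/(tform al be _ _) E2 in h1.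
set z := tlin k c e in E E2 h1 *.
apply: (half_absorb h1).
rewrite E -!JZ; [|cnt|cnt]; rewrite -JD; [|cnt|cnt].
apply: J_le; [cnt|cnt|move=> x y _ _].
have y1 := young (F1 (x, y)) (tx z (x, y)) s0_gt0.
have y2 := young (F2 (x, y)) (ty z (x, y)) s0_gt0.
by apply: le_trans (lerD y1 y2) _; rewrite le_eqVlt; apply/orP; left; apply/eqP; ring.
Qed.

(** As for [bessel_grad], with Poincare in addition. It says that the H^{-1} norm is bounded by the
    L2 norm, and serves at the terminal time. *)
Lemma bessel_val (g : R * R -> R) : cnt g ->
  \sum_(i < k) J (fun p => g p * tv (e i) p) ^+ 2 <= s0^-1 * J (fun p => g p ^+ 2).
Proof.
move=> cg; pose c i := J (fun p => g p * tv (e i) p).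
have E : \sum_(i < k) c i ^+ 2 = J (fun p => g p * tv (tlin k c e) p).
  by rewrite -J_tlin //; apply: eq_bigr => i _; rewrite expr2.
have E2 : tform al be (tlin k c e) (tlin k c e) = \sum_(i < k) c i ^+ 2.
  by rewrite tform_linlin //; apply: eq_bigr => i _; rewrite expr2.
have h1 := aform_ge cal cbe al_ge be_ge (cnt_tx (tlin k c e)) (cnt_ty (tlin k c e)).
rewrite -/(tform al be _ _) E2 in h1.
set z := tlin k c e in E E2 h1 *.
have h3 := test_poincare z.
have h4 : J (fun p => tx z p ^+ 2) <= J (fun p => tx z p ^+ 2 + ty z p ^+ 2).
  by apply: J_le; [cnt|cnt|move=> x y _ _; rewrite lerDl sqr_ge0].
apply: (@half_absorb _ s0 _ (J (fun p => tv z p ^+ 2))).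
  by apply: le_trans h1; rewrite (ler_pM2l s0_gt0); exact: le_trans h4.
rewrite E -!JZ; [|cnt|cnt]; rewrite -JD; [|cnt|cnt].
apply: J_le; [cnt|cnt|move=> x y _ _]; exact: young.
Qed.
End Bessel.

(** One coefficient of the Carleman estimate, with ze = (m, e), mu = a(m, e), ka = (F, grad e) and
    ze' = - mu + ka. The terms without [K] are - 2 (mu - L ze)^2 + 2 ka (mu - L ze), at most ka^2 /
    2; the other half of ka^2 pays for K ka ze / 2, the rest being absorbed because [K / 4 <= L].
    What survives, - (K / 2) mu ze, is the gain: summed over the family it is nearly - (K / 2)
    |m|^2. *)
Lemma carleman_term (R : realType) (mu ka ze L K : R) : 0 <= K -> K / 4 <= L ->
  2 * (- mu + ka) * mu + 2 * L * mu * ze - 2 * L ^+ 2 * ze ^+ 2 - 2 * L * ze * (- mu + ka)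
  - L * K * ze ^+ 2 + K / 4 * (2 * L * ze ^+ 2 + 2 * ze * (- mu + ka))
  <= ka ^+ 2 - K / 2 * (mu * ze).
Proof.
move=> K0 KL.
have h1 : 0 <= (ka - 2 * (mu - L * ze)) ^+ 2 by exact: sqr_ge0.
have h2 : 0 <= (ka - K / 2 * ze) ^+ 2 by exact: sqr_ge0.
have h3 : 0 <= (L - K / 4) * K * ze ^+ 2 by rewrite mulr_ge0 ?sqr_ge0 // mulr_ge0 // subr_ge0.
nra.
Qed.

(** Young's inequality with weights fixed by later use: the coefficient s0 / (B (s0 + 2)) of f^2
    becomes s0 / (s0 + 2) after the bound [f_le], while of the gradient 2 s0 only s0 / 2 is spent on
    the derivatives of the coefficients. *)
Lemma u_pointwise (R : realType) (s0 B a ax b by' u ux uy f : R) :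
  0 < s0 -> 0 < B -> s0 <= a -> s0 <= b -> `|ax| <= B -> `|by'| <= B ->
  3 / 2 * s0 * (ux ^+ 2 + uy ^+ 2) - (4 * B ^+ 2 / s0 + B * (s0 + 2) / s0) * u ^+ 2
    - s0 / (B * (s0 + 2)) * f ^+ 2
  <= 2 * (u * f) + 2 * ((ax * u + a * ux) * ux) + 2 * ((by' * u + b * uy) * uy).
Proof.
move=> s00 B0 ha hb hax hby.
have s2 : 0 < s0 + 2 by rewrite addr_gt0.
have h1 : - (s0 / (B * (s0 + 2)) * f ^+ 2 + B * (s0 + 2) / s0 * u ^+ 2) <= 2 * (u * f).
  rewrite -subr_ge0.
  have -> : 2 * (u * f) - - (s0 / (B * (s0 + 2)) * f ^+ 2 + B * (s0 + 2) / s0 * u ^+ 2) =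
     s0 / (B * (s0 + 2)) * (f + B * (s0 + 2) / s0 * u) ^+ 2.
    by field; rewrite !lt0r_neq0.
  by rewrite mulr_ge0 ?sqr_ge0 // divr_ge0 ?ltW // mulr_gt0.
have h2 (c cx w : R) : s0 <= c -> `|cx| <= B ->
  3 / 2 * s0 * w ^+ 2 - 2 * B ^+ 2 / s0 * u ^+ 2 <= 2 * ((cx * u + c * w) * w).
  move=> hc hcx.
  have e1 : 0 <= (c - s0) * w ^+ 2 by rewrite mulr_ge0 ?sqr_ge0 // subr_ge0.
  have e2 : 0 <= s0 / 2 * (w + 2 / s0 * cx * u) ^+ 2 by rewrite mulr_ge0 ?sqr_ge0 // divr_ge0 // ltW.
  have e3 : s0 / 2 * (w + 2 / s0 * cx * u) ^+ 2 = s0 / 2 * w ^+ 2 + 2 * cx * u * w + 2 * cx ^+ 2 / s0 * u ^+ 2.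
    by field; rewrite lt0r_neq0.
  have e4 : cx ^+ 2 / s0 * u ^+ 2 <= B ^+ 2 / s0 * u ^+ 2.
    rewrite ler_wpM2r ?sqr_ge0 // ler_wpM2r ?invr_ge0 ?(ltW s00) //.
    by rewrite -(real_normK (num_real cx)) lerXn2r ?nnegrE ?normr_ge0 ?(ltW B0).
  rewrite e3 in e2; clear -e1 e2 e4.
  have -> : 2 * B ^+ 2 / s0 * u ^+ 2 = 2 * (B ^+ 2 / s0 * u ^+ 2) by ring.
  have : 2 * cx ^+ 2 / s0 * u ^+ 2 = 2 * (cx ^+ 2 / s0 * u ^+ 2) by ring.
  move: (B ^+ 2 / s0 * u ^+ 2) (cx ^+ 2 / s0 * u ^+ 2) (2 * cx ^+ 2 / s0 * u ^+ 2) e2 e4 => X Y Z; nra.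
have h3 := h2 a ax ux ha hax; have h4 := h2 b by' uy hb hby.
rewrite -[leRHS]addrA; apply: le_trans (lerD h1 (lerD h3 h4)).
by rewrite le_eqVlt; apply/orP; left; apply/eqP; ring.
Qed.

Lemma sqrB_le (R : realDomainType) (v w : R) : (v - w) ^+ 2 <= 2 * v ^+ 2 + 2 * w ^+ 2.
Proof. by have := sqr_ge0 (v + w); nra. Qed.

(** The arithmetic of [regularity], with the integrals replaced by real variables; the other
    [_combine] lemmas serve the same purpose. *)
Lemma regularity_combine (R : realFieldType) (A N I I' g K s C h B : R) :
  A <= B * g + C * I -> N <= K * I' -> I <= I' -> 0 <= 1 + s -> 0 <= h + 2 -> 0 <= C -> 0 <= K ->
  0 <= g -> 0 <= I -> 0 < B ->
  (1 + s) * A + (h + 2) * I + N <= ((1 + s) * (B + C) + h + 2 + K) * (I' + g).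
Proof.
move=> a1 a2 a3 s0 h0 C0 K0 g0 I0 B0.
have I'0 := le_trans I0 a3.
have b1 : (1 + s) * A <= (1 + s) * (B + C) * (I' + g).
  rewrite -mulrA ler_wpM2l //; apply: le_trans a1 _; rewrite mulrDl mulrDr.
  apply: lerD; first by rewrite lerDr mulr_ge0 // ltW.
  by rewrite ler_wpM2l // (le_trans a3) // lerDl.
have b2 : (h + 2) * I <= (h + 2) * (I' + g) by rewrite ler_wpM2l // (le_trans a3) // lerDl.
have b3 : N <= K * (I' + g) by apply: le_trans a2 _; rewrite ler_wpM2l // lerDl.
apply: le_trans (lerD (lerD b1 b2) b3) _.
by rewrite le_eqVlt; apply/orP; left; apply/eqP; ring.
Qed.

Lemma hess_combine (R : realDomainType) (a f u g h b : R) :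
  a <= 2 * f + 2 * u -> g <= h -> f <= b -> a + g <= 2 * u + (2 * b + h).
Proof. by move=> h1 h2 h3; lra. Qed.

Lemma Ch2_ge0 (R : realFieldType) (s B : R) : 0 < s -> 0 < B ->
  0 <= 2 / s ^+ 2 * (2 * B + 12 * B ^+ 4 / s ^+ 2) + 2.
Proof.
move=> s0 B0; rewrite addr_ge0 // mulr_ge0 ?divr_ge0 ?exprn_ge0 ?(ltW s0) //.
by rewrite addr_ge0 ?divr_ge0 ?mulr_ge0 ?exprn_ge0 ?(ltW s0) ?(ltW B0).
Qed.
Lemma Kgrad_ge0 (R : realFieldType) (s B T a b : R) : 0 < s -> 0 < B -> 0 < T -> a < b ->
  0 <= (s * (b - a))^-1 * (1 + T * (B / s)).
Proof.
move=> s0 B0 T0 ab; rewrite mulr_ge0 ?invr_ge0 ?mulr_ge0 ?subr_ge0 ?(ltW s0) ?(ltW ab) //.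
by rewrite addr_ge0 // mulr_ge0 ?divr_ge0 ?(ltW T0) ?(ltW B0) ?(ltW s0).
Qed.

Lemma carleman_combine (R : realFieldType) (x1 x2 x3 x4 x5 x6 x7 x8 x9 y1 y2 y3 y4 : R) :
  x1 <= x6 - x8 -> x6 <= y1 + y2 -> x3 <= x5 -> x2 <= x4 -> - x7 <= - (y2 + y4) + x9 ->
  x1 + x2 + x3 - (y1 + x9 + y3) + x8 - x7 <= - (y3 + y4) + (x4 + x5).
Proof. by move=> ? ? ? ? ?; lra. Qed.

Lemma endpoint_combine (R : realFieldType) (a hT h0 e x y : R) :
  hT - h0 <= - a + e -> h0 <= x -> - hT <= y -> a <= x + y + e.
Proof. by move=> ? ? ?; lra. Qed.

(** * The linear system for a difference of two solutions *)

Section Core.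
Context {R : realType}.
Variables (T s0 B : R).
Variables (al alx aly be bex bey : R * R -> R).
Variables (U Ux Uy Ut Uxx Uxy Uyx Uyy M Mx My Mt F1 F2 : R * R * R -> R).
Hypotheses (T0 : 0 < T) (s00 : 0 < s0) (B0 : 0 < B).
Hypotheses (cal : cnt al) (calx : cnt alx) (caly : cnt aly)
  (cbe : cnt be) (cbex : cnt bex) (cbey : cnt bey).
Hypotheses (cU : cnt U) (cUx : cnt Ux) (cUy : cnt Uy) (cUt : cnt Ut)
  (cUxx : cnt Uxx) (cUxy : cnt Uxy) (cUyx : cnt Uyx) (cUyy : cnt Uyy)
  (cM : cnt M) (cMx : cnt Mx) (cMy : cnt My) (cMt : cnt Mt) (cF1 : cnt F1) (cF2 : cnt F2).
Hypothesis al_ge : forall x y : R, 0 <= x <= 1 -> 0 <= y <= 1 -> s0 <= al (x, y).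
Hypothesis be_ge : forall x y : R, 0 <= x <= 1 -> 0 <= y <= 1 -> s0 <= be (x, y).
Hypothesis coef_le : forall x y : R, 0 <= x <= 1 -> 0 <= y <= 1 ->
  [/\ `|al (x, y)| <= B, `|alx (x, y)| <= B & `|aly (x, y)| <= B] /\
  [/\ `|be (x, y)| <= B, `|bex (x, y)| <= B & `|bey (x, y)| <= B].
Hypotheses (dal : dX al alx) (daly : dY al aly) (dbex : dX be bex) (dbe : dY be bey).
Hypotheses (dUx : forall t, dX (fun p => U (p, t)) (fun p => Ux (p, t)))
  (dUy : forall t, dY (fun p => U (p, t)) (fun p => Uy (p, t))) (dUt : dT T U Ut)
  (dUxx : forall t, dX (fun p => Ux (p, t)) (fun p => Uxx (p, t)))
  (dUxy : forall t, dY (fun p => Ux (p, t)) (fun p => Uxy (p, t)))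
  (dUyx : forall t, dX (fun p => Uy (p, t)) (fun p => Uyx (p, t)))
  (dUyy : forall t, dY (fun p => Uy (p, t)) (fun p => Uyy (p, t)))
  (dMx : forall t, dX (fun p => M (p, t)) (fun p => Mx (p, t)))
  (dMy : forall t, dY (fun p => M (p, t)) (fun p => My (p, t))) (dMt : dT T M Mt).
Hypotheses (U1 : forall y t, 0 <= y <= 1 -> U (1, y, t) = 0)
  (M1 : forall y t, 0 <= y <= 1 -> M (1, y, t) = 0)
  (Ux0 : forall y t, 0 <= y <= 1 -> Ux (0, y, t) = 0)
  (Uy0 : forall x t, 0 <= x <= 1 -> Uy (x, 0, t) = 0)
  (Uy1 : forall x t, 0 <= x <= 1 -> Uy (x, 1, t) = 0).

Let q t := J (fun p => M (p, t) ^+ 2).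
Let G t := J (fun p => Ux (p, t) ^+ 2 + Uy (p, t) ^+ 2).
Let pu t := J (fun p => U (p, t) ^+ 2).
Let f (z : R * R * R) := Ut z + al z.1 * Uxx z + be z.1 * Uyy z.

(** The bounds are integrated over the square at each time: a term made of line means of |M| has no
    bound by the value of |M| at the same point. *)
Hypothesis f_le : forall t, J (fun p => f (p, t) ^+ 2) <= B * (q t + G t).
Hypothesis F_le : forall t, J (fun p => F1 (p, t) ^+ 2 + F2 (p, t) ^+ 2) <= B * (q t + G t).
Hypothesis weak : forall (s : test R) t, 0 < t < T ->
  J (fun p => Mt (p, t) * tv s p) =
  - aform al be (fun p => Mx (p, t)) (fun p => My (p, t)) (tx s) (ty s)
  + J (fun p => F1 (p, t) * tx s p + F2 (p, t) * ty s p).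

Lemma cnt_q : cnt q.
Proof. by rewrite /q; cnt. Qed.
Lemma cnt_G : cnt G.
Proof. by rewrite /G; cnt. Qed.
Lemma cnt_pu : cnt pu.
Proof. by rewrite /pu; cnt. Qed.
Lemma q_ge0 t : 0 <= q t.
Proof. by apply: J_ge0 => x y _ _; exact: sqr_ge0. Qed.
Lemma G_ge0 t : 0 <= G t.
Proof. by apply: J_ge0 => x y _ _; rewrite addr_ge0 ?sqr_ge0. Qed.
Lemma pu_ge0 t : 0 <= pu t.
Proof. by apply: J_ge0 => x y _ _; exact: sqr_ge0. Qed.

Lemma cf : cnt f.
Proof. by rewrite /f; cnt. Qed.

Definition dpu t := J (fun p => 2 * (U (p, t) * Ut (p, t))).

Lemma dr_J2 (W Wt V Vt : R * R * R -> R) t : cnt W -> cnt Wt -> cnt V -> cnt Vt ->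
  dT T W Wt -> dT T V Vt -> 0 < t < T ->
  is_derive (t : R) (1 : R) (fun t => J (fun p => W (p, t) * V (p, t)))
   (J (fun p => Wt (p, t) * V (p, t) + W (p, t) * Vt (p, t))).
Proof.
move=> c1 c2 c3 c4 d1 d2 ht.
apply: (@dr_J R T (fun z => W z * V z) (fun z => Wt z * V z + W z * Vt z)) => //; [cnt|cnt|].
move=> x y s hx hy hs; apply: (drM (f := fun s => W (x, y, s)) (g := fun s => V (x, y, s))).
  exact: d1.
exact: d2.
Qed.

Lemma dr_pu t : 0 < t < T -> is_derive (t : R) (1 : R) pu (dpu t).
Proof.
move=> ht; have := dr_J2 cU cUt cU cUt dUt dUt ht.
rewrite (_ : (fun t => _) = pu); last first.
  by apply/funext => s; apply: eq_J => x y _ _; rewrite expr2.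
suff -> : dpu t = J (fun p => Ut (p, t) * U (p, t) + U (p, t) * Ut (p, t)) by [].
by apply: eq_J => x y _ _; ring.
Qed.

Definition Cpu : R := 4 * B ^+ 2 / s0 + B * (s0 + 2) / s0.

Lemma dpuE t : dpu t = J (fun p => 2 * (U (p, t) * f (p, t))
   + 2 * ((alx p * U (p, t) + al p * Ux (p, t)) * Ux (p, t))
   + 2 * ((bey p * U (p, t) + be p * Uy (p, t)) * Uy (p, t))).
Proof.
have cf := cf.
have hx : J (fun p => (alx p * U (p, t) + al p * Ux (p, t)) * Ux (p, t)) =
   - J (fun p => al p * U (p, t) * Uxx (p, t)).
  apply: (IBPx (f := fun p => al p * U (p, t)) (g := fun p => Ux (p, t))); try cnt.
  - exact: dXM.
  - exact: dUxx.
  - by move=> y hy; rewrite U1 // Ux0 // !mulr0 mul0r.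
have hy : J (fun p => (bey p * U (p, t) + be p * Uy (p, t)) * Uy (p, t)) =
   - J (fun p => be p * U (p, t) * Uyy (p, t)).
  apply: (IBPy (f := fun p => be p * U (p, t)) (g := fun p => Uy (p, t))); try cnt.
  - exact: dYM.
  - exact: dUyy.
  - by move=> x hx'; rewrite Uy1 // Uy0 // !mulr0.
rewrite JD; [|cnt|cnt]; rewrite JD; [|cnt|cnt].
rewrite (@JZ R 2 (fun p => (alx p * U (p, t) + al p * Ux (p, t)) * Ux (p, t))); last by cnt.
rewrite (@JZ R 2 (fun p => (bey p * U (p, t) + be p * Uy (p, t)) * Uy (p, t))); last by cnt.
rewrite hx hy !mulrN -!JZ; [|cnt|cnt]; rewrite -JB; [|cnt|cnt]; rewrite -JB; [|cnt|cnt].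
by apply: eq_J => x y _ _; rewrite /f /=; ring.
Qed.

Lemma dpu_ge t : s0 * G t - Cpu * pu t - q t <= dpu t.
Proof.
have cf := cf.
have s2 : 0 < s0 + 2 by rewrite addr_gt0.
have h : 3 / 2 * s0 * G t - Cpu * pu t - s0 / (B * (s0 + 2)) * J (fun p => f (p, t) ^+ 2) <= dpu t.
  rewrite dpuE -!JZ; [|cnt|cnt|cnt]; rewrite -JB; [|cnt|cnt]; rewrite -JB; [|cnt|cnt].
  apply: J_le; [cnt|cnt|move=> x y hx hy].
  have [[_ h1 _] [_ _ h2]] := coef_le hx hy.
  by apply: u_pointwise => //; [exact: al_ge|exact: be_ge].
apply: le_trans h.
(* The quotient s0 / (s0 + 2) is at most 1, for the coefficient of [q], and at most s0 / 2, for that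
   of [G]; this leaves exactly s0 of the gradient. *)
have h1 : s0 / (B * (s0 + 2)) * J (fun p => f (p, t) ^+ 2) <= s0 / (s0 + 2) * (q t + G t).
  have -> : s0 / (s0 + 2) * (q t + G t) = s0 / (B * (s0 + 2)) * (B * (q t + G t)).
    by field; rewrite !lt0r_neq0.
  by rewrite ler_wpM2l // divr_ge0 ?ltW // mulr_gt0.
have h2 : s0 / (s0 + 2) * q t <= q t.
  by rewrite ler_piMl ?q_ge0 // ler_pdivrMr // mul1r lerDl.
have h3 : s0 / (s0 + 2) * G t <= s0 / 2 * G t.
  rewrite ler_wpM2r ?G_ge0 // ler_wpM2l ?(ltW s00) // lef_pV2 ?posrE // lerDr; exact: ltW.
rewrite [X in _ <= X]mulrDr in h1; move: h1 h2 h3.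
have -> : 3 / 2 * s0 * G t = s0 * G t + s0 / 2 * G t by field.
move: (q t) (Cpu * pu t) (s0 * G t) (s0 / 2 * G t) (s0 / (s0 + 2) * G t) (s0 / (s0 + 2) * q t) (s0 / (B * (s0 + 2)) * _).
by move=> x1 x2 x3 x4 x5 x6 x7 e1 e2 e3; lra.
Qed.

Program Definition mtest (t : R) : test R :=
  @Test R (fun p => M (p, t)) (fun p => Mx (p, t)) (fun p => My (p, t)) _ _ _ (dMx t) (dMy t) _.
Next Obligation. by move=> t; cnt. Qed.
Next Obligation. by move=> t; cnt. Qed.
Next Obligation. by move=> t; cnt. Qed.
Next Obligation. by move=> t y hy; exact: M1. Qed.

(** The energy distance between M(t) and M(t') is continuous in t, so finitely many times t' serve
    all of [[0, T]] by compactness. Gram-Schmidt on these values of [M] yields the family. *)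
Lemma projection_family (r : R) : 0 < r -> exists k e, ON al be k e /\
  forall t, 0 <= t <= T -> J (fun p => (M (p, t) -
     tv (tlin k (fun i => tform al be (mtest t) (e i)) e) p) ^+ 2) <= r.
Proof.
move=> r0; pose A t t' := tform al be (tres 1 (mtest t) (mtest t')) (tres 1 (mtest t) (mtest t')).
have cA t' : cnt (fun t => A t t').
  apply: (cnt_J (F := fun z : R * (R * R) =>
    al z.2 * ((1 * (Mx (z.2, z.1) - Mx (z.2, t'))) * (1 * (Mx (z.2, z.1) - Mx (z.2, t'))))
    + be z.2 * ((1 * (My (z.2, z.1) - My (z.2, t'))) * (1 * (My (z.2, z.1) - My (z.2, t'))))));
  cnt.
have A0 t : A t t = 0.
  rewrite -[RHS](@J_cst R 0); apply: eq_J => x y _ _ /=.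
  by rewrite !subrr !mulr0 addr0.
(* Chosen to cancel the factors [s0] and 2 of [projection_error]. *)
pose eta := s0 * r / 2; have eta0 : 0 < eta by rewrite divr_gt0 // mulr_gt0.
have := @segment_compact R 0 T; rewrite compact_cover.
move=> /(_ R setT (fun t' => [set t | A t t' < eta])) [].
- move=> t' _; apply: (@open_comp _ _ (fun t => A t t') [set x | x < eta]).
    by move=> x _; exact: (cA t').
  exact: open_lt.
- by move=> t _; exists t => //=; rewrite A0.
move=> D _ cov.
pose s := fun i => mtest (nth 0 (finmap.enum_fset D) i).
have [k [e [on H]]] := @gram_schmidt R al be s0 cal cbe s00 al_ge be_ge s (size (finmap.enum_fset D)).
exists k, e; split=> // t ht.
have [t' /= t'D At] := cov t (ltac:(rewrite /= in_itv /=; exact: ht)).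
have ti : (index t' (finmap.enum_fset D) < size (finmap.enum_fset D))%N by rewrite index_mem.
have [c hc] := H _ ti.
have hs : s (index t' (finmap.enum_fset D)) = mtest t' by rewrite /s nth_index.
rewrite hs in hc.
have := projection_error cal cbe s00 al_ge be_ge (mtest t) on hc.
rewrite -/(A t t') => h.
have : s0 * J (fun p => (tv (mtest t) p - tv (tlin k (fun i => tform al be (mtest t) (e i)) e) p) ^+ 2) <= s0 * r.
  apply: le_trans h _; have := ltW At; rewrite /eta; move: (A t t') (s0 * r) => a b Aab; lra.
by rewrite ler_pM2l.
Qed.
(** [C1c] is the Bessel constant of the flux. [Nc] multiplies the energy of u so that Nc s0 = C1c +
    1 covers the gradient with 1 to spare. [Kc] is such that Kc / 2 = C1c + Nc + 1 covers all
    multiples of [q], again with 1 to spare. *)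
Definition C1c : R := B / s0.
Definition Nc : R := (C1c + 1) / s0.
Definition Kc : R := 2 * (C1c + Nc + 1).
Definition psi (t : R) : R := expR (Kc * t).
(** With L = lam Kc psi one has w' = 2 L w and L' = Kc L. The second exponential provides the growth
    of L, hence the negative term - L Kc ze^2 of [carleman_term]. *)
Definition wgt (lam t : R) : R := expR (2 * lam * psi t).

Lemma C1c_gt0 : 0 < C1c. Proof. by rewrite divr_gt0. Qed.
Lemma Nc_gt0 : 0 < Nc. Proof. by rewrite divr_gt0 // addr_gt0 // C1c_gt0. Qed.
Lemma Kc_ge1 : 1 <= Kc.
Proof. by have := C1c_gt0; have := Nc_gt0; rewrite /Kc; move: C1c Nc => a b; lra. Qed.
Lemma cnt_psi : cnt psi. Proof. by rewrite /psi; cnt. Qed.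
Lemma cnt_wgt lam : cnt (wgt lam).
Proof. by have cp := cnt_psi; rewrite /wgt; cnt. Qed.
Lemma psi_ge1 t : 0 <= t -> 1 <= psi t.
Proof.
move=> t0; rewrite -[leLHS]expR0 ler_expR mulr_ge0 //; exact: (le_trans ler01 Kc_ge1).
Qed.
Lemma psi_gt0 t : 0 < psi t. Proof. exact: expR_gt0. Qed.
Lemma psi_le s t : s <= t -> psi s <= psi t.
Proof. by move=> st; rewrite ler_expR ler_wpM2l //; exact: (le_trans ler01 Kc_ge1). Qed.
Lemma wgt_gt0 lam t : 0 < wgt lam t. Proof. exact: expR_gt0. Qed.
Lemma wgt_le lam s t : 0 <= lam -> s <= t -> wgt lam s <= wgt lam t.
Proof. by move=> l0 st; rewrite ler_expR ler_wpM2l ?psi_le // mulr_ge0. Qed.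

Lemma dr_psi t : is_derive (t : R) (1 : R) psi (Kc * psi t).
Proof.
have h := @dr_comp R expR (fun t => Kc * t) t _ _ (is_derive_expR (Kc * t)) (drZ Kc (dr_id t)).
by apply: (is_derive_eq h); rewrite mulr1 mulrC.
Qed.
Lemma dr_wgt lam t : is_derive (t : R) (1 : R) (wgt lam) (2 * (lam * Kc * psi t) * wgt lam t).
Proof.
have h := @dr_comp R expR (fun t => 2 * lam * psi t) t _ _ (is_derive_expR (2 * lam * psi t)) (drZ (2 * lam) (dr_psi t)).
by apply: (is_derive_eq h); rewrite /wgt; ring.
Qed.

Lemma dr_q t : 0 < t < T -> is_derive (t : R) (1 : R) q (J (fun p => 2 * (M (p, t) * Mt (p, t)))).
Proof.
move=> ht; have := dr_J2 cM cMt cM cMt dMt dMt ht.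
rewrite (_ : (fun t => _) = q); last first.
  by apply/funext => s; apply: eq_J => x y _ _; rewrite expr2.
suff -> : J (fun p => 2 * (M (p, t) * Mt (p, t))) =
  J (fun p => Mt (p, t) * M (p, t) + M (p, t) * Mt (p, t)) by [].
by apply: eq_J => x y _ _; ring.
Qed.

Section Step.
Variables (lam r Mb : R) (k : nat) (e : nat -> test R).
Hypotheses (lam1 : 1 <= lam) (lamC : Cpu <= lam) (r0 : 0 < r) (on : ON al be k e).
Hypothesis proj : forall t, 0 <= t <= T -> J (fun p => (M (p, t) -
     tv (tlin k (fun i => tform al be (mtest t) (e i)) e) p) ^+ 2) <= r ^+ 2.
Hypothesis Mb_ge : forall t, 0 <= t <= T -> q t <= Mb /\ J (fun p => Mt (p, t) ^+ 2) <= Mb.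

Let zeta t i := J (fun p => M (p, t) * tv (e i) p).
Let dzeta t i := J (fun p => Mt (p, t) * tv (e i) p).
Let mu t i := tform al be (mtest t) (e i).
Let kappa t i := J (fun p => F1 (p, t) * tx (e i) p + F2 (p, t) * ty (e i) p).
Let Z t := \sum_(i < k) zeta t i ^+ 2.
Let dZ t := \sum_(i < k) 2 * (zeta t i * dzeta t i).
Let L t := lam * Kc * psi t.
Let dq t := J (fun p => 2 * (M (p, t) * Mt (p, t))).

(* [Z] stands for the squared H^{-1} norm of [M], seen through the family [e].  The proof of the
   Carleman estimate is the integration of [dH_le]: the coefficients satisfy zeta' = - mu + kappa,
   and - L Z is the boundary term of the square completed in [carleman_term]. *)
Let H t := wgt lam t * (q t + (Kc / 4 - L t) * Z t) - Nc * (wgt lam t * pu t).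
Let dH t := 2 * L t * wgt lam t * (q t + (Kc / 4 - L t) * Z t)
  + wgt lam t * (dq t + (- (Kc * L t) * Z t + (Kc / 4 - L t) * dZ t))
  - Nc * (2 * L t * wgt lam t * pu t + wgt lam t * dpu t).

Lemma cnt_zeta i : cnt (fun t => zeta t i).
Proof. by rewrite /zeta; cnt. Qed.
Lemma cnt_dzeta i : cnt (fun t => dzeta t i).
Proof. by rewrite /dzeta; cnt. Qed.
Lemma cnt_Z : cnt Z.
Proof. by apply: (@cnt_sumn R _ k (fun i t => zeta t i ^+ 2)) => i; have c := cnt_zeta i; cnt. Qed.
Lemma cnt_dZ : cnt dZ.
Proof.
apply: (@cnt_sumn R _ k (fun i t => 2 * (zeta t i * dzeta t i))) => i.
by have c := cnt_zeta i; have c' := cnt_dzeta i; apply: cntM; [cnt|apply: cntM].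
Qed.
Lemma cnt_dq : cnt dq.
Proof. by rewrite /dq; cnt. Qed.
Lemma cnt_dpu : cnt dpu.
Proof. by rewrite /dpu; cnt. Qed.
Lemma cnt_L : cnt L.
Proof. by have c := cnt_psi; rewrite /L; cnt. Qed.
Lemma cnt_H : cnt H.
Proof.
have c1 := cnt_wgt lam; have c2 := cnt_q; have c3 := cnt_L; have c4 := cnt_Z; have c5 := cnt_pu.
by rewrite /H; cnt.
Qed.
Lemma cnt_dH : cnt dH.
Proof.
have c1 := cnt_wgt lam; have c2 := cnt_q; have c3 := cnt_L; have c4 := cnt_Z; have c5 := cnt_pu.
have c6 := cnt_dq; have c7 := cnt_dZ; have c8 := cnt_dpu.
by rewrite /dH; cnt.
Qed.

Lemma dr_zeta i t : 0 < t < T -> is_derive (t : R) (1 : R) (fun t => zeta t i) (dzeta t i).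
Proof.
move=> ht; apply: (@dr_J R T (fun z => M z * tv (e i) z.1) (fun z => Mt z * tv (e i) z.1)) => //; [cnt|cnt|].
move=> x y s hx hy hs; have h := drM (dMt hx hy hs) (dr_cst (tv (e i) (x, y)) s).
by apply: (is_derive_eq h); rewrite mulr0 addr0.
Qed.

Lemma dr_Z t : 0 < t < T -> is_derive (t : R) (1 : R) Z (dZ t).
Proof.
move=> ht; apply: (dr_sum (f := fun (i : 'I_k) t => zeta t i ^+ 2)) => i.
have h := drM (dr_zeta i ht) (dr_zeta i ht).
rewrite (_ : (fun t => zeta t i ^+ 2) = fun t => zeta t i * zeta t i); last first.
  by apply/funext => s; rewrite expr2.
by apply: (is_derive_eq h); move: (zeta t i) (dzeta t i) => a b; ring.
Qed.

Lemma dr_H t : 0 < t < T -> is_derive (t : R) (1 : R) H (dH t).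
Proof.
move=> ht.
have hL := drZ (lam * Kc) (dr_psi t).
have hLZ := drM (drB (dr_cst (Kc / 4) t) hL) (dr_Z ht).
have hq : is_derive (t : R) (1 : R) q (dq t) := dr_q ht.
have h := drB (drM (dr_wgt lam t) (drD hq hLZ)) (drZ Nc (drM (dr_wgt lam t) (dr_pu ht))).
apply: (is_derive_eq h); rewrite /dH /L.
move: (wgt lam t) (q t) (Z t) (dZ t) (dq t) (pu t) (dpu t) (psi t) Kc Nc => *; ring.
Qed.

Lemma projE t (g : R * R -> R) : cnt g ->
  J (fun p => g p * M (p, t)) - \sum_(i < k) mu t i * J (fun p => g p * tv (e i) p) =
  J (fun p => g p * (M (p, t) - tv (tlin k (mu t) e) p)).
Proof.
move=> cg; rewrite J_tlin // -JB; [|cnt|cnt].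
by apply: eq_J => x y _ _; rewrite mulrBr.
Qed.

(** Young with the weight [r] on [g] and its inverse on the projection error; the latter is bounded
    by r^2 in the mean square, so both parts are of order [r]. *)
Lemma proj_err t (g : R * R -> R) : cnt g -> 0 <= t <= T -> J (fun p => g p ^+ 2) <= Mb ->
  2 * (J (fun p => g p * M (p, t)) - \sum_(i < k) mu t i * J (fun p => g p * tv (e i) p)) <= r * (Mb + 1).
Proof.
move=> cg ht gM; rewrite projE //; have hp := proj ht.
set h := fun p => M (p, t) - tv (tlin k (mu t) e) p.
have ch : cnt h by rewrite /h; cnt.
apply: (@le_trans _ _ (r * J (fun p => g p ^+ 2) + r^-1 * J (fun p => h p ^+ 2))).
  rewrite -!JZ; [|cnt|cnt|cnt]; rewrite -JD; [|cnt|cnt].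
  apply: J_le; [cnt|cnt|move=> x y _ _].
  have := young (h (x, y)) (g (x, y)) r0; rewrite -/(h (x, y)).
  move: (h (x, y)) (g (x, y)) => a b.
  have -> : r^-1 / 2 * a ^+ 2 = r^-1 * a ^+ 2 / 2 by rewrite mulrAC.
  have -> : r / 2 * b ^+ 2 = r * b ^+ 2 / 2 by rewrite mulrAC.
  by move: (r^-1 * a ^+ 2) (r * b ^+ 2) => c d; nra.
rewrite mulrDr mulr1; apply: lerD; first by rewrite ler_pM2l.
apply: (@le_trans _ _ (r^-1 * r ^+ 2)); first by rewrite ler_pM2l // invr_gt0.
by rewrite expr2 mulrA mulVf ?mul1r // lt0r_neq0.
Qed.

Lemma dH_le t : 0 < t < T ->
  dH t <= wgt lam t * (- (q t + G t) + r * (Mb + 1) * (L t + 1 + Kc / 4)).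
Proof.
move=> ht; have /andP[/ltW t0 /ltW tT] := ht.
have htc : 0 <= t <= T by rewrite t0.
have K1 := Kc_ge1.
have LK : Kc <= L t.
  by rewrite /L -mulrA mulrCA ler_peMr ?(le_trans _ K1) // mulr_ege1 // psi_ge1.
have L0 : 0 <= L t by apply: le_trans LK; apply: le_trans K1.
have K0 : 0 <= Kc by apply: le_trans K1.
have LC : Cpu <= L t.
  apply: le_trans lamC _; rewrite /L -mulrA ler_peMr ?(le_trans _ lam1) //.
  by rewrite mulr_ege1 // psi_ge1.
(* The weak equation tested with [e i]: an ordinary differential equation for each coefficient. *)
have dzE i : dzeta t i = - mu t i + kappa t i by exact: weak.
have HS : \sum_(i < k) (2 * (- mu t i + kappa t i) * mu t i + 2 * L t * mu t i * zeta t i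
    - 2 * L t ^+ 2 * zeta t i ^+ 2 - 2 * L t * zeta t i * (- mu t i + kappa t i)
    - L t * Kc * zeta t i ^+ 2
    + Kc / 4 * (2 * L t * zeta t i ^+ 2 + 2 * zeta t i * (- mu t i + kappa t i)))
   <= \sum_(i < k) (kappa t i ^+ 2 - Kc / 2 * (mu t i * zeta t i)).
  by apply: ler_sum => i _; apply: carleman_term => //; apply: le_trans LK; move: K0; move: Kc => K K0'; lra.
pose S1 := \sum_(i < k) mu t i * dzeta t i.
pose S2 := \sum_(i < k) mu t i * zeta t i.
have HSE : \sum_(i < k) (2 * (- mu t i + kappa t i) * mu t i + 2 * L t * mu t i * zeta t i
    - 2 * L t ^+ 2 * zeta t i ^+ 2 - 2 * L t * zeta t i * (- mu t i + kappa t i)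
    - L t * Kc * zeta t i ^+ 2
    + Kc / 4 * (2 * L t * zeta t i ^+ 2 + 2 * zeta t i * (- mu t i + kappa t i)))
   = 2 * S1 + 2 * L t * S2 + (- 2 * L t ^+ 2 - L t * Kc + Kc / 2 * L t) * Z t + (Kc / 4 - L t) * dZ t.
  rewrite /S1 /S2 /Z /dZ !mulr_sumr -!big_split /=; apply: eq_bigr => i _.
  by rewrite dzE; move: (mu t i) (kappa t i) (zeta t i) => a b c; field.
rewrite HSE sumrB -mulr_sumr -/S2 in HS.
have Hk := bessel_grad cal cbe s00 al_ge be_ge on (F1 := fun p => F1 (p, t)) (F2 := fun p => F2 (p, t)) ltac:(cnt) ltac:(cnt).
rewrite -/(kappa t _) in Hk.
have Hk2 : \sum_(i < k) kappa t i ^+ 2 <= C1c * (q t + G t).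
  apply: le_trans Hk _; rewrite /C1c mulrC -mulrA [s0^-1 * _]mulrC mulrA.
  by rewrite ler_pM2r ?invr_gt0 //; exact: F_le.
have cMt1 : cnt (fun p => M (p, t)) by cnt.
have cMt2 : cnt (fun p => Mt (p, t)) by cnt.
have [qM MtM] := Mb_ge htc.
(* Since the expansion of M along the family has coefficients [mu], [S2] is [q] and [2 * S1] is its
   derivative up to the projection error. *)
have e1 : 2 * (q t - S2) <= r * (Mb + 1).
  have := proj_err cMt1 htc qM; rewrite -/(zeta t _).
  suff -> : J (fun p => M (p, t) * M (p, t)) = q t by [].
  by apply: eq_J => x y _ _; rewrite expr2.
have e2 : dq t - 2 * S1 <= r * (Mb + 1).
  have := proj_err cMt2 htc MtM; rewrite -/(dzeta t _) mulrBr -/S1 -JZ; last by cnt.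
  suff -> : J (fun p => 2 * (Mt (p, t) * M (p, t))) = dq t by [].
  by apply: eq_J => x y _ _; rewrite [Mt _ * _]mulrC.
have hp := dpu_ge t.
(* Here [Cpu <= L] is used: the derivative of the weight supplies 2 L [pu], which dominates the
   zero-order loss in [dpu_ge]. *)
have HN : - (Nc * (2 * L t * pu t + dpu t)) <= - ((C1c + 1) * G t) + Nc * q t.
  have -> : (C1c + 1) * G t = Nc * (s0 * G t).
    by rewrite mulrA /Nc divfK // lt0r_neq0.
  have h1 : Cpu * pu t <= 2 * L t * pu t.
    apply: ler_wpM2r; first exact: pu_ge0.
    by apply: le_trans LC _; rewrite -[leLHS]mul1r ler_wpM2r // ler1n.
  have h2 : - (2 * L t * pu t + dpu t) <= - (s0 * G t) + q t.
    move: hp h1; move: (2 * L t * pu t) (Cpu * pu t) (s0 * G t) (dpu t) (q t) => a b c d x h1 h2; lra.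
  by have := ler_wpM2l (ltW Nc_gt0) h2; rewrite mulrN (mulrDr Nc (- (s0 * G t))) mulrN.
have -> : dH t = wgt lam t * (2 * L t * q t + (2 * L t * (Kc / 4 - L t) - Kc * L t) * Z t
   + dq t + (Kc / 4 - L t) * dZ t - Nc * (2 * L t * pu t + dpu t)).
  rewrite /dH; move: (wgt lam t) (q t) (Z t) (dZ t) (dq t) (pu t) (dpu t) (L t) Kc Nc => *; ring.
rewrite ler_pM2l ?wgt_gt0 //.
have e3 : (2 * L t + Kc / 2) * (q t - S2) <= (L t + Kc / 4) * (r * (Mb + 1)).
  have -> : (2 * L t + Kc / 2) * (q t - S2) = (L t + Kc / 4) * (2 * (q t - S2)) by field.
  by rewrite ler_wpM2l // addr_ge0 // divr_ge0.
have KE : Kc / 2 * q t = (C1c + Nc + 1) * q t by rewrite /Kc; field.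
(* Trading [q] for [S2] and [dq] for [2 * S1] produces the sum bounded in [HS]; the leftover
   [Kc / 2 * S2] cancels the gain there and reappears as - Kc / 2 times [q]. *)
have e4 : 2 * L t * q t + (2 * L t * (Kc / 4 - L t) - Kc * L t) * Z t + dq t + (Kc / 4 - L t) * dZ t
   = (2 * S1 + 2 * L t * S2 + (- 2 * L t ^+ 2 - L t * Kc + Kc / 2 * L t) * Z t + (Kc / 4 - L t) * dZ t)
     + (2 * L t + Kc / 2) * (q t - S2) + (dq t - 2 * S1) - (C1c + Nc + 1) * q t + Kc / 2 * S2.
  by rewrite -KE; move: (q t) (Z t) (dZ t) (dq t) (L t) Kc => x1 x2 x3 x4 x5 x6; field.
rewrite e4.
have -> : r * (Mb + 1) * (L t + 1 + Kc / 4) = (L t + Kc / 4) * (r * (Mb + 1)) + r * (Mb + 1) by ring.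
have h5 : (C1c + Nc + 1) * q t = C1c * q t + Nc * q t + q t.
  by rewrite (mulrDl (C1c + Nc) 1) (mulrDl C1c Nc) (mul1r (q t)).
have h6 : (C1c + 1) * G t = C1c * G t + G t by rewrite (mulrDl C1c 1) (mul1r (G t)).
rewrite h5; rewrite h6 in HN; rewrite mulrDr in Hk2.
exact: carleman_combine HS Hk2 e2 e3 HN.
Qed.

Lemma carleman_step :
  itg 0 T (fun t => wgt lam t * (q t + G t)) <=
  wgt lam 0 * q 0 + wgt lam T * (lam * Kc * psi T / s0 * q T + Nc * pu T)
  + r * (T * (wgt lam T * ((Mb + 1) * (lam * Kc * psi T + 1 + Kc / 4)))).
Proof.
have K1 := Kc_ge1; have K0 : 0 <= Kc by apply: le_trans K1.
have l0 : 0 <= lam by apply: le_trans lam1.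
have c1 := cnt_wgt lam; have c2 := cnt_q; have c3 := cnt_G.
have FT : itg 0 T dH = H T - H 0 by apply: (FTC (ltW T0) cnt_H cnt_dH) => t ht; exact: dr_H.
pose E := wgt lam T * (r * (Mb + 1) * (L T + 1 + Kc / 4)).
have Mb0 : 0 <= Mb.
  by have [h _] := @Mb_ge 0 (introT andP (conj (lexx 0) (ltW T0))); apply: le_trans h; exact: q_ge0.
have LT0 t : 0 <= L t by apply: mulr_ge0; [exact: mulr_ge0|exact: ltW (psi_gt0 t)].
have hle : itg 0 T dH <= itg 0 T (fun t => - (wgt lam t * (q t + G t)) + E).
  apply: itg_le_oo; [exact: cnt_dH|cnt|move=> t ht].
  apply: le_trans (dH_le ht) _; rewrite mulrDr mulrN lerD2l /E.
  have /andP[_ /ltW tT] := ht.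
  have a0 : 0 <= r * (Mb + 1) by rewrite mulr_ge0 ?(ltW r0) // addr_ge0.
  have b0 s : 0 <= L s + 1 + Kc / 4 by rewrite addr_ge0 ?divr_ge0 // addr_ge0.
  apply: ler_pM; [exact: ltW (wgt_gt0 _ _)|by rewrite mulr_ge0|exact: wgt_le|].
  apply: ler_wpM2l => //; rewrite !lerD2r /L; apply: ler_wpM2l; [exact: mulr_ge0|exact: psi_le].
rewrite FT itgD in hle; [|cnt|cnt].
rewrite itgN in hle; last by cnt.
rewrite itg_cst ?(ltW T0) // subr0 in hle.
have Z0 t : 0 <= Z t by apply: sumr_ge0 => i _; exact: sqr_ge0.
(* At time 0 the factor of [Z] is Kc / 4 - lam Kc, which is negative, so only [q 0] remains. *)
have H0 : H 0 <= wgt lam 0 * q 0.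
  rewrite /H mulrDr -addrA gerDl.
  have h1 : 0 <= Nc * (wgt lam 0 * pu 0).
    by rewrite mulr_ge0 ?(ltW Nc_gt0) // mulr_ge0 ?pu_ge0 // ltW // wgt_gt0.
  have h2 : wgt lam 0 * ((Kc / 4 - L 0) * Z 0) <= 0.
    rewrite pmulr_rle0 ?wgt_gt0 // mulr_le0_ge0 // subr_le0 /L /psi mulr0 expR0 mulr1.
    apply: (@le_trans _ _ Kc); last by rewrite ler_peMl.
    by rewrite ler_pdivrMr // ler_peMr // ler1n.
  by rewrite subr_le0; apply: le_trans h2 h1.
have HT : - H T <= wgt lam T * (lam * Kc * psi T / s0 * q T + Nc * pu T).
  have hZ : Z T <= s0^-1 * q T.
    have cMT : cnt (fun p => M (p, T)) by cnt.
    exact: (bessel_val cal cbe s00 al_ge be_ge on cMT).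
  have -> : - H T = wgt lam T * (- q T - Kc / 4 * Z T + L T * Z T + Nc * pu T) by rewrite /H; ring.
  have hE : lam * Kc * psi T / s0 * q T = L T * (s0^-1 * q T) by rewrite /L !mulrA.
  rewrite ler_pM2l ?wgt_gt0 // lerD2r hE.
  have h1 : L T * Z T <= L T * (s0^-1 * q T) by apply: ler_wpM2l.
  have h2 : 0 <= Kc / 4 * Z T by rewrite mulr_ge0 // divr_ge0.
  apply: le_trans h1; rewrite gerDr -opprD oppr_le0; apply: addr_ge0 => //; exact: q_ge0.
have EE : r * (T * (wgt lam T * ((Mb + 1) * (lam * Kc * psi T + 1 + Kc / 4)))) = E * T.
  by rewrite /E /L; ring.
rewrite EE; exact: endpoint_combine hle H0 HT.
Qed.
End Step.

(** The family depends on [r], but the estimate involves it only through the error [r * E], with [E]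
    fixed by bounds of [M] and [Mt] on [[0, T]]; so [r] tends to 0. *)
Lemma carleman lam : 1 <= lam -> Cpu <= lam ->
  itg 0 T (fun t => wgt lam t * (q t + G t)) <=
  wgt lam 0 * q 0 + wgt lam T * (lam * Kc * psi T / s0 * q T + Nc * pu T).
Proof.
move=> lam1 lamC.
have cq := cnt_q; pose dM t := J (fun p => Mt (p, t) ^+ 2).
have cd : cnt dM by rewrite /dM; cnt.
have [t1 _ h1] := @EVT_max R q 0 T (ltW T0) (continuous_subspaceT cq).
have [t2 _ h2] := @EVT_max R dM 0 T (ltW T0) (continuous_subspaceT cd).
pose Mb := q t1 + dM t2.
have d0 t : 0 <= dM t by apply: J_ge0 => x y _ _; exact: sqr_ge0.
have hM t : 0 <= t <= T -> q t <= Mb /\ J (fun p => Mt (p, t) ^+ 2) <= Mb.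
  move=> ht; have hi : t \in `[0, T]%R by rewrite in_itv.
  split; first by apply: le_trans (h1 _ hi) _; rewrite lerDl.
  by apply: le_trans (h2 _ hi) _; rewrite lerDr q_ge0.
set X := itg _ _ _; set Y := _ + _.
pose E := T * (wgt lam T * ((Mb + 1) * (lam * Kc * psi T + 1 + Kc / 4))).
have h r : 0 < r -> X <= Y + r * E.
  move=> r0; have [k [e [on hp]]] := projection_family (exprn_gt0 2 r0).
  exact: carleman_step lam1 lamC r0 on hp hM.
apply/ler_addgt0Pr => ep ep0.
have E1 : 0 < `|E| + 1 by rewrite ltr_wpDl.
apply: le_trans (h _ (divr_gt0 ep0 E1)) _; rewrite lerD2l mulrAC ler_pdivrMr //.
rewrite ler_pM2l //; apply: le_trans (ler_norm _) _; by rewrite lerDl.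
Qed.

(** * Estimates of the derivatives *)

Let Gm t := J (fun p => Mx (p, t) ^+ 2 + My (p, t) ^+ 2).

Lemma cnt_Gm : cnt Gm.
Proof. by rewrite /Gm; cnt. Qed.
Lemma Gm_ge0 t : 0 <= Gm t.
Proof. by apply: J_ge0 => x y _ _; rewrite addr_ge0 ?sqr_ge0. Qed.

(** M(t) itself is an admissible test function; half of the ellipticity absorbs the flux. *)
Lemma dq_le t : 0 < t < T ->
  J (fun p => 2 * (M (p, t) * Mt (p, t))) <= - (s0 * Gm t) + B / s0 * (q t + G t).
Proof.
move=> ht.
have -> : J (fun p => 2 * (M (p, t) * Mt (p, t))) = 2 * J (fun p => Mt (p, t) * tv (mtest t) p).
  by rewrite -JZ; [apply: eq_J => x y _ _ /=; rewrite [M _ * _]mulrC|cnt].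
rewrite (weak (mtest t) ht) /=.
have hA := aform_ge cal cbe al_ge be_ge (fx := fun p => Mx (p, t)) (fy := fun p => My (p, t)) ltac:(cnt) ltac:(cnt).
rewrite -/(Gm t) in hA.
have hF : J (fun p => F1 (p, t) * Mx (p, t) + F2 (p, t) * My (p, t)) <=
   s0^-1 / 2 * J (fun p => F1 (p, t) ^+ 2 + F2 (p, t) ^+ 2) + s0 / 2 * Gm t.
  rewrite -!JZ; [|cnt|cnt]; rewrite -JD; [|cnt|cnt].
  apply: J_le; [cnt|cnt|move=> x y _ _].
  have y1 := young (F1 (x, y, t)) (Mx (x, y, t)) s00.
  have y2 := young (F2 (x, y, t)) (My (x, y, t)) s00.
  by apply: le_trans (lerD y1 y2) _; rewrite le_eqVlt; apply/orP; left; apply/eqP; ring.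
have hFF : s0^-1 / 2 * J (fun p => F1 (p, t) ^+ 2 + F2 (p, t) ^+ 2) <= B / s0 * (q t + G t) / 2.
  have -> : B / s0 * (q t + G t) / 2 = s0^-1 / 2 * (B * (q t + G t)) by ring.
  by apply: ler_wpM2l (F_le t); rewrite divr_ge0 // invr_ge0 ltW.
move: hF hFF; have -> : s0 / 2 * Gm t = s0 * Gm t / 2 by rewrite mulrAC.
move: hA; move: (aform _ _ _ _ _ _) (s0 * Gm t) (J _) (s0^-1 / 2 * J _) (B / s0 * _).
by move=> x1 x2 x3 x4 x5 h1 h2 h3; lra.
Qed.

(** The energy identity is multiplied by t - a, which kills the unknown value at [a] and is at least
    b - a on [[b, T]]. The terminal term has the favourable sign. *)
Lemma grad_m_le (a b : R) : 0 <= a -> a < b -> b < T ->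
  itg b T Gm <= (s0 * (b - a))^-1 * (1 + T * (B / s0)) * itg a T (fun t => q t + G t).
Proof.
move=> a0 ab bT.
have aT : a <= T by apply: ltW; exact: lt_trans bT.
have cq := cnt_q; have cG := cnt_G; have cGm := cnt_Gm.
pose dq t := J (fun p => 2 * (M (p, t) * Mt (p, t))).
have cdq : cnt dq by rewrite /dq; cnt.
have c1 : cnt (fun t => (t - a) * q t) by cnt.
have c2 : cnt (fun t => q t + (t - a) * dq t) by cnt.
have FT : itg a T (fun t => q t + (t - a) * dq t) = (T - a) * q T - (a - a) * q a.
  apply: (FTC aT c1 c2) => t /andP[at' tT].
  have ht : 0 < t < T by rewrite tT (le_lt_trans a0 at').
  have h := drM (drB (dr_id t) (dr_cst a t)) (dr_q ht).
  by apply: (is_derive_eq h); rewrite subr0 mul1r.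
have h1 : itg a T (fun t => q t + (t - a) * dq t) <=
   itg a T (fun t => - (s0 * ((t - a) * Gm t)) + (1 + T * (B / s0)) * (q t + G t)).
  apply: itg_le_oo; [cnt|cnt|move=> t /andP[at' tT]].
  have ht : 0 < t < T by rewrite tT (le_lt_trans a0 at').
  have ta : 0 < t - a by rewrite subr_gt0.
  have hd : (t - a) * dq t <= (t - a) * (- (s0 * Gm t) + B / s0 * (q t + G t)).
    by rewrite ler_pM2l //; exact: dq_le.
  have hT : (t - a) * (B / s0 * (q t + G t)) <= T * (B / s0 * (q t + G t)).
    apply: ler_wpM2r; last by rewrite lerBlDr ler_wpDr // ltW.
    by apply: mulr_ge0; [rewrite divr_ge0 ?ltW|apply: addr_ge0; [exact: q_ge0|exact: G_ge0]].
  have := G_ge0 t; move: hd hT; rewrite mulrDr mulrN.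
  have -> : s0 * ((t - a) * Gm t) = (t - a) * (s0 * Gm t) by rewrite mulrCA.
  have -> : (1 + T * (B / s0)) * (q t + G t) = q t + G t + T * (B / s0 * (q t + G t)) by rewrite mulrDl mul1r -[T * _ * _]mulrA.
  move: (q t) (G t) ((t - a) * dq t) ((t - a) * (s0 * Gm t)) ((t - a) * (B / s0 * (q t + G t)))
    (T * (B / s0 * (q t + G t))).
  by move=> x1 x2 x3 x4 x5 x6 g1 g2 g3; lra.
rewrite FT itgD in h1; [|cnt|cnt].
rewrite itgN in h1; last by cnt.
rewrite !itgZ in h1; [|cnt|cnt].
have h2 : itg a T (fun t => (t - a) * Gm t) >= (b - a) * itg b T Gm.
  rewrite (itg_split (a := a) (b := b) (c := T)); [|cnt|exact: ltW|exact: ltW].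
  rewrite -itgZ //; apply: ler_wpDl.
    apply: itg_ge0 => t /andP[at' _]; apply: mulr_ge0; last exact: Gm_ge0.
    by rewrite subr_ge0.
  apply: itg_le; [cnt|cnt|move=> t /andP[bt _]].
  by apply: ler_wpM2r; [exact: Gm_ge0|rewrite lerD2r].
have h3 : 0 <= (T - a) * q T by rewrite mulr_ge0 ?q_ge0 // subr_ge0.
have ba : 0 < s0 * (b - a) by rewrite mulr_gt0 // subr_gt0.
rewrite subrr mul0r subr0 in h1.
rewrite -mulrA ler_pdivlMl //.
have h4 : s0 * ((b - a) * itg b T Gm) <= s0 * itg a T (fun t => (t - a) * Gm t) by rewrite ler_pM2l.
rewrite -mulrA; apply: le_trans h4 _; rewrite -subr_ge0; apply: le_trans h3 _.
by apply: le_trans h1 _; rewrite addrC.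
Qed.

Let E t := aform al be (fun p => Ux (p, t)) (fun p => Uy (p, t)) (fun p => Ux (p, t)) (fun p => Uy (p, t)).
(** The operator in divergence form; the one in [f] is not, and the two differ by alx Ux + bey
    Uy. *)
Let Lu (z : R * R * R) := alx z.1 * Ux z + al z.1 * Uxx z + (bey z.1 * Uy z + be z.1 * Uyy z).

Lemma cnt_E : cnt E.
Proof.
by rewrite /E /aform; cnt.
Qed.

Lemma dr_E t : 0 < t < T -> is_derive (t : R) (1 : R) E (- 2 * J (fun p => Ut (p, t) * Lu (p, t))).
Proof.
move=> ht.
have cLu : cnt Lu by rewrite /Lu; cnt.
pose k z (p : R * R) := itg 0 1 (fun th : R => Ut (p, t + th * (z - t))).
have ck : cnt (fun z : R * (R * R) => k z.1 z.2).
  by apply: (cnt_itg (F := fun z : R * (R * R) * R => Ut (z.1.2, t + z.2 * (z.1.1 - t)))) => //; cnt.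
have ckz z : cnt (k z).
  by apply: (cnt_itg (F := fun q : R * R * R => Ut (q.1, t + q.2 * (z - t)))) => //; cnt.
pose g z := - J (fun p => k z p * (Lu (p, z) + Lu (p, t))).
have cg : cnt g.
  apply: cntN; apply: (cnt_J (F := fun z : R * (R * R) => k z.1 z.2 * (Lu (z.2, z.1) + Lu (z.2, t)))).
  by apply: cntM; cnt.
have -> : - 2 * J (fun p => Ut (p, t) * Lu (p, t)) = g t.
  rewrite /g mulNr -JZ; last by cnt.
  congr (- _); apply: eq_J => x y _ _.
  rewrite /k subrr (eq_itg (g := fun=> Ut (x, y, t))) ?itg_cst ?subr0 ?mulr1 //; first by ring.
  by move=> th _; rewrite mulr0 addr0.
apply: (dr_carath ht _ cg) => z hz.
have hcc (v : R) : 0 < v < T -> 0 <= v <= T by move=> /andP[/ltW -> /ltW ->].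
have hx : J (fun p => (Ux (p, z) - Ux (p, t)) * (al p * (Ux (p, z) + Ux (p, t)))) =
  - J (fun p => (U (p, z) - U (p, t)) * (alx p * (Ux (p, z) + Ux (p, t)) + al p * (Uxx (p, z) + Uxx (p, t)))).
  apply: (IBPx (f := fun p => U (p, z) - U (p, t)) (g := fun p => al p * (Ux (p, z) + Ux (p, t)))); try cnt.
  - exact: (dXB (dUx z) (dUx t)).
  - exact: (dXM dal (dXD (dUxx z) (dUxx t))).
  - by move=> y hy; rewrite !U1 // !Ux0 // subrr addr0 !mulr0 mul0r.
have hy : J (fun p => (Uy (p, z) - Uy (p, t)) * (be p * (Uy (p, z) + Uy (p, t)))) =
  - J (fun p => (U (p, z) - U (p, t)) * (bey p * (Uy (p, z) + Uy (p, t)) + be p * (Uyy (p, z) + Uyy (p, t)))).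
  apply: (IBPy (f := fun p => U (p, z) - U (p, t)) (g := fun p => be p * (Uy (p, z) + Uy (p, t)))); try cnt.
  - exact: (dYB (dUy z) (dUy t)).
  - exact: (dYM dbe (dYD (dUyy z) (dUyy t))).
  - by move=> x hx'; rewrite !Uy1 // !Uy0 // addr0 !mulr0.
have EE : E z - E t = J (fun p => (Ux (p, z) - Ux (p, t)) * (al p * (Ux (p, z) + Ux (p, t))))
   + J (fun p => (Uy (p, z) - Uy (p, t)) * (be p * (Uy (p, z) + Uy (p, t)))).
  rewrite /E /aform -JB; [|cnt|cnt]; rewrite -JD; [|cnt|cnt].
  by apply: eq_J => x y _ _; ring.
have -> : E z = E t + (E z - E t) by rewrite addrC subrK.
congr (_ + _); rewrite EE hx hy /g mulNr -opprD -JD; [|cnt|cnt].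
rewrite mulrC -JZ; last by cnt.
congr (- _); apply: eq_J => x y hx' hy'.
rewrite (slopeT cU cUt dUt hx' hy' (hcc _ ht) (hcc _ hz)) /k /Lu /=.
by move: (itg _ _ _) => X; ring.
Qed.

Definition Ce : R := 2 * B + 4 * B ^+ 2.

(** With Lu = f - Ut + r, r being of first order, the claim before integration is (Ut - f - r)^2 >=
    0, followed by (f + r)^2 <= 2 f^2 + 2 r^2. *)
Lemma Ut_le_dE t : J (fun p => Ut (p, t) ^+ 2) <=
  - 2 * J (fun p => Ut (p, t) * Lu (p, t)) + Ce * (q t + G t).
Proof.
have cLu : cnt Lu by rewrite /Lu; cnt.
have cf := cf.
have h : J (fun p => Ut (p, t) ^+ 2) <=
  J (fun p => - 2 * (Ut (p, t) * Lu (p, t)) + (2 * f (p, t) ^+ 2 + 4 * B ^+ 2 * (Ux (p, t) ^+ 2 + Uy (p, t) ^+ 2))).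
  apply: J_le; [cnt|cnt|move=> x y hx hy].
  have [[_ h1 _] [_ _ h2]] := coef_le hx hy.
  pose r := alx (x, y) * Ux (x, y, t) + bey (x, y) * Uy (x, y, t).
  have -> : Lu (x, y, t) = f (x, y, t) - Ut (x, y, t) + r by rewrite /Lu /f /r /=; ring.
  have sq (c v : R) : `|c| <= B -> (c * v) ^+ 2 <= B ^+ 2 * v ^+ 2.
    move=> hc; rewrite exprMn ler_wpM2r ?sqr_ge0 //.
    by rewrite -(real_normK (num_real c)) lerXn2r ?nnegrE ?normr_ge0 ?(ltW B0).
  have hr : r ^+ 2 <= 2 * B ^+ 2 * (Ux (x, y, t) ^+ 2 + Uy (x, y, t) ^+ 2).
    have s1 := sq _ (Ux (x, y, t)) h1; have s2 := sq _ (Uy (x, y, t)) h2; rewrite /r.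
    move: (alx _ * _) (bey _ * _) s1 s2 => v w.
    rewrite -mulrA [B ^+ 2 * (_ + _)]mulrDr.
    move: (B ^+ 2 * _) (B ^+ 2 * _) => X Y s1 s2; have := sqr_ge0 (v - w); nra.
  have := sqr_ge0 (Ut (x, y, t) - f (x, y, t) - r); have := sqr_ge0 (f (x, y, t) - r).
  have -> : 4 * B ^+ 2 * (Ux (x, y, t) ^+ 2 + Uy (x, y, t) ^+ 2) = 2 * (2 * B ^+ 2 * (Ux (x, y, t) ^+ 2 + Uy (x, y, t) ^+ 2)) by ring.
  move: hr; move: (2 * B ^+ 2 * _) (Ut _) (f _) r => X u v w g1 g2 g3; nra.
apply: le_trans h _.
rewrite JD; [|cnt|cnt]; rewrite JZ; last by cnt.
rewrite lerD2l JD; [|cnt|cnt]; rewrite !JZ; [|cnt|cnt].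
have hf := f_le t; have hq := q_ge0 t; rewrite -/(G t) /Ce.
have h1 : 0 <= 4 * B ^+ 2 * q t by rewrite mulr_ge0 // mulr_ge0 // sqr_ge0.
move: hf h1; rewrite -/(f _).
have -> : (2 * B + 4 * B ^+ 2) * (q t + G t) = 2 * (B * (q t + G t)) + 4 * B ^+ 2 * q t + 4 * B ^+ 2 * G t by ring.
move: (J _) (B * _) (4 * B ^+ 2 * q t) (4 * B ^+ 2 * G t) => X Y Z W g1 g2; lra.
Qed.

(** The energy at [b] enters with the good sign and is dropped. The energy at [T] is controlled by
    the H^1 norm of the terminal data. *)
Lemma Ut_int_le (b : R) : 0 <= b -> b < T ->
  itg b T (fun t => J (fun p => Ut (p, t) ^+ 2)) <= B * G T + Ce * itg b T (fun t => q t + G t).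
Proof.
move=> b0 bT.
have cLu : cnt Lu by rewrite /Lu; cnt.
have cq := cnt_q; have cG := cnt_G; have cE := cnt_E.
pose dE t := - 2 * J (fun p => Ut (p, t) * Lu (p, t)).
have cdE : cnt dE.
  apply: cntM; first exact: cnt_cst.
  by cnt.
have cUt2 : cnt (fun t => J (fun p => Ut (p, t) ^+ 2)).
  by cnt.
have FT : itg b T dE = E T - E b.
  apply: (FTC (ltW bT) cE cdE) => t /andP[bt tT]; apply: dr_E.
  by rewrite tT (le_lt_trans b0 bt).
have h : itg b T (fun t => J (fun p => Ut (p, t) ^+ 2)) <= itg b T (fun t => dE t + Ce * (q t + G t)).
  by apply: itg_le; [cnt|cnt|move=> t _; exact: Ut_le_dE].
apply: le_trans h _.
have -> : itg b T (fun t => dE t + Ce * (q t + G t)) = itg b T dE + itg b T (fun t => Ce * (q t + G t)).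
  by apply: itgD; cnt.
rewrite FT itgZ; last by cnt.
rewrite lerD2r; apply: (@le_trans _ _ (E T)).
  by rewrite gerBl; apply: aform_ge0 cal cbe s00 al_ge be_ge _ _ _ _; cnt.
rewrite -JZ; last by cnt.
apply: J_le; [cnt|cnt|move=> x y hx hy].
have [[h1 _ _] [h2 _ _]] := coef_le hx hy.
have a1 : al (x, y) <= B by apply: le_trans h1; exact: ler_norm.
have a2 : be (x, y) <= B by apply: le_trans h2; exact: ler_norm.
rewrite mulrDr; apply: lerD; rewrite -expr2; apply: ler_wpM2r => //; exact: sqr_ge0.
Qed.

(** The cross terms are split by Young with parameters 1 and 2, so that at least half of s0^2 is
    left for each second derivative; their costs 4 and 8 add up to the constant 12. *)
Lemma hess_pointwise (a b wx wy ux uxx uxy uyy : R) : s0 <= a -> s0 <= b ->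
  `|wx| <= 2 * B ^+ 2 -> `|wy| <= 2 * B ^+ 2 ->
  s0 ^+ 2 / 2 * (uxx ^+ 2 + uxy ^+ 2 + uyy ^+ 2) <=
  a ^+ 2 * uxx ^+ 2 + b ^+ 2 * uyy ^+ 2 + 2 * (a * b * uxy ^+ 2 + wy * ux * uxy - wx * ux * uyy)
  + 12 * B ^+ 4 / s0 ^+ 2 * ux ^+ 2.
Proof.
move=> ha hb hwx hwy; pose S := s0 ^+ 2; have S0 : 0 < S by rewrite exprn_gt0.
have a2 : S <= a ^+ 2 by rewrite lerXn2r ?nnegrE ?(le_trans _ ha) ?(ltW s00).
have b2 : S <= b ^+ 2 by rewrite lerXn2r ?nnegrE ?(le_trans _ hb) ?(ltW s00).
have ab : S <= a * b by rewrite /S expr2; apply: ler_pM => //; exact: ltW.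
have cross (w z m : R) : 0 < m -> `|w| <= 2 * B ^+ 2 ->
    - (2 * (w * ux * z)) <= S / m * z ^+ 2 + m * 4 * B ^+ 4 / S * ux ^+ 2.
  move=> m0 hw; have h1 : 0 <= S / m * (z + m / S * w * ux) ^+ 2 by rewrite mulr_ge0 ?sqr_ge0 // divr_ge0 // ltW.
  have h2 : S / m * (z + m / S * w * ux) ^+ 2 = S / m * z ^+ 2 + 2 * (w * ux * z) + m / S * (w ^+ 2 * ux ^+ 2).
    by field; rewrite !lt0r_neq0.
  have h3 : m / S * (w ^+ 2 * ux ^+ 2) <= m / S * ((2 * B ^+ 2) ^+ 2 * ux ^+ 2).
    apply: ler_wpM2l; first by rewrite divr_ge0 // ltW.
    apply: ler_wpM2r; first exact: sqr_ge0.
    rewrite -(real_normK (num_real w)); apply: lerXn2r => //; rewrite nnegrE //.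
    by rewrite mulr_ge0 // sqr_ge0.
  have -> : m * 4 * B ^+ 4 / S * ux ^+ 2 = m / S * ((2 * B ^+ 2) ^+ 2 * ux ^+ 2) by field; rewrite lt0r_neq0.
  move: h1; rewrite h2; move: h3; move: (m / S * _) (m / S * (_ * _)) (S / m * _) (w * _ * _) => X Y Z W; lra.
have c1 := cross wy uxy 1 ltr01 hwy.
have c2 := cross (- wx) uyy 2 ltac:(by []) ltac:(by rewrite normrN).
have e1 : 0 <= (a ^+ 2 - S) * uxx ^+ 2 by rewrite mulr_ge0 ?sqr_ge0 // subr_ge0.
have e2 : 0 <= (b ^+ 2 - S) * uyy ^+ 2 by rewrite mulr_ge0 ?sqr_ge0 // subr_ge0.
have e3 : 0 <= (a * b - S) * uxy ^+ 2 by rewrite mulr_ge0 ?sqr_ge0 // subr_ge0.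
have E12 : 12 * B ^+ 4 / S * ux ^+ 2 = 1 * 4 * B ^+ 4 / S * ux ^+ 2 + 2 * 4 * B ^+ 4 / S * ux ^+ 2.
  by field; rewrite lt0r_neq0.
rewrite -/S E12; rewrite divr1 in c1.
have f1 : 0 <= S * uxx ^+ 2 by rewrite mulr_ge0 ?sqr_ge0 // ltW.
have f2 : 0 <= S * uxy ^+ 2 by rewrite mulr_ge0 ?sqr_ge0 // ltW.
have g1 : - wx * ux * uyy = - (wx * ux * uyy) by ring.
have g2 : S / 2 * uyy ^+ 2 = (S * uyy ^+ 2) / 2 by rewrite mulrAC.
rewrite g1 g2 in c2.
have g3 : S / 2 * (uxx ^+ 2 + uxy ^+ 2 + uyy ^+ 2) = S * uxx ^+ 2 / 2 + S * uxy ^+ 2 / 2 + S * uyy ^+ 2 / 2.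
  by field.
have g4 : 2 * (a * b * uxy ^+ 2 + wy * ux * uxy - wx * ux * uyy) =
  2 * (a * b * uxy ^+ 2) + 2 * (wy * ux * uxy) - 2 * (wx * ux * uyy) by ring.
rewrite g3 g4; rewrite !mulrBl in e1 e2 e3.
move: c1 c2 e1 e2 e3 f1 f2.
move: (S * uxx ^+ 2) (S * uxy ^+ 2) (S * uyy ^+ 2) (a ^+ 2 * _) (b ^+ 2 * _) (a * b * _)
  (1 * 4 * _ / _ * _) (2 * 4 * _ / _ * _) (wx * ux * uyy) (wy * ux * uxy).
move=> x1 x2 x3 x4 x5 x6 x7 x8 x9 x10 k1 k2 k3 k4 k5 k6 k7; lra.
Qed.

(** Used for tangential derivatives along an edge; the limit [zero_limit] covers the two corners. *)
Lemma zero_derive (k dk : R -> R) : cnt dk ->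
  (forall z : R, 0 < z < 1 -> is_derive z (1 : R) k (dk z)) ->
  (forall z, 0 <= z <= 1 -> k z = 0) -> forall z, 0 <= z <= 1 -> dk z = 0.
Proof.
move=> cdk hd k0; have h z : 0 < z < 1 -> dk z = 0.
  move=> hz; have [_ <-] := hd z hz.
  have k0oo y : 0 < y < 1 -> 0 = k y by move=> /andP[y0 y1]; rewrite k0 // (ltW y0) ltW.
  by have [_ ->] := dr_near hz k0oo (dr_cst 0 z).
move=> z /andP[]; rewrite le_eqVlt => /predU1P[<- _|z0].
  have c : cnt (fun s : R => dk (s * 2^-1)) by cnt.
  have := zero_limit c; rewrite mul0r; apply=> s /andP[sgt0 sle1]; apply: h; apply/andP; split; lra.
rewrite le_eqVlt => /predU1P[->|z1]; last by apply: h; rewrite z0.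
have c : cnt (fun s : R => dk (1 - s * 2^-1)) by cnt.
have := zero_limit c; rewrite mul0r subr0; apply=> s /andP[sgt0 sle1]; apply: h; apply/andP; split; lra.
Qed.

Definition Ch : R := 2 / s0 ^+ 2 * (2 * B + 12 * B ^+ 4 / s0 ^+ 2).

(** Squaring al Uxx + be Uyy = f - Ut leaves the product w Uxx Uyy with w = al be. The null
    Lagrangian for w Ux and Uy turns its integral into that of w Uxy^2 plus first-order factors, and
    the left side becomes coercive in all second derivatives. *)
Lemma hess_le t : J (fun p => Uxx (p, t) ^+ 2 + Uxy (p, t) ^+ 2 + Uyy (p, t) ^+ 2) <=
  4 / s0 ^+ 2 * J (fun p => Ut (p, t) ^+ 2) + Ch * (q t + G t).
Proof.
have cf := cf.
pose w p := al p * be p; pose wx p := alx p * be p + al p * bex p; pose wy p := aly p * be p + al p * bey p.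
have cw : cnt w by rewrite /w; cnt.
have cwx : cnt wx by rewrite /wx; cnt.
have cwy : cnt wy by rewrite /wy; cnt.
have dwx : dX w wx by exact: dXM.
have dwy : dY w wy by exact: dYM.
have nl : J (fun p => (wx p * Ux (p, t) + w p * Uxx (p, t)) * Uyy (p, t)) =
  J (fun p => (wy p * Ux (p, t) + w p * Uxy (p, t)) * Uyx (p, t)).
  apply: (null_lagrangian (f := fun p => w p * Ux (p, t)) (g := fun p => Uy (p, t))); try cnt.
  - exact: (dXM dwx (dUxx t)).
  - exact: (dYM dwy (dUxy t)).
  - exact: dUyx.
  - exact: dUyy.
  - by move=> y hy; rewrite Ux0 // mulr0.
  - move=> y hy; apply: (@zero_derive (fun y => U (1, y, t)) (fun y => Uy (1, y, t))) => //; [cnt| |].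
      by move=> z hz; apply: dUy => //; rewrite ler01 lexx.
    by move=> z hz; exact: U1.
  - move=> x hx; apply: (@zero_derive (fun x => Uy (x, 0, t)) (fun x => Uyx (x, 0, t))) => //; [cnt| |].
      by move=> z hz; apply: dUyx => //; rewrite lexx ler01.
    by move=> z hz; exact: Uy0.
  - move=> x hx; apply: (@zero_derive (fun x => Uy (x, 1, t)) (fun x => Uyx (x, 1, t))) => //; [cnt| |].
      by move=> z hz; apply: dUyx => //; rewrite ler01 lexx.
    by move=> z hz; exact: Uy1.
have sym : J (fun p => (wy p * Ux (p, t) + w p * Uxy (p, t)) * Uyx (p, t)) =
   J (fun p => (wy p * Ux (p, t) + w p * Uxy (p, t)) * Uxy (p, t)).
  apply: eq_J_oo; [cnt|cnt|move=> x y hx hy].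
  have cU' : cnt (fun p => U (p, t)) by cnt.
  have cUx' : cnt (fun p => Ux (p, t)) by cnt.
  have cUy' : cnt (fun p => Uy (p, t)) by cnt.
  have cUxy' : cnt (fun p => Uxy (p, t)) by cnt.
  have cUyx' : cnt (fun p => Uyx (p, t)) by cnt.
  by rewrite (mixed_partials cU' cUx' cUy' cUxy' cUyx' (dUx t) (dUy t) (dUxy t) (dUyx t) hx hy).
have key : J (fun p => w p * Uxx (p, t) * Uyy (p, t)) =
  J (fun p => w p * Uxy (p, t) ^+ 2 + wy p * Ux (p, t) * Uxy (p, t) - wx p * Ux (p, t) * Uyy (p, t)).
  transitivity (J (fun p => (wx p * Ux (p, t) + w p * Uxx (p, t)) * Uyy (p, t)) - J (fun p => wx p * Ux (p, t) * Uyy (p, t))).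
    by rewrite -JB; [|cnt|cnt]; apply: eq_J => x y _ _; ring.
  rewrite nl sym -JB; [|cnt|cnt]; apply: eq_J => x y _ _; ring.
have h : s0 ^+ 2 / 2 * J (fun p => Uxx (p, t) ^+ 2 + Uxy (p, t) ^+ 2 + Uyy (p, t) ^+ 2) <=
   J (fun p => (al p * Uxx (p, t) + be p * Uyy (p, t)) ^+ 2) + 12 * B ^+ 4 / s0 ^+ 2 * G t.
  have -> : J (fun p => (al p * Uxx (p, t) + be p * Uyy (p, t)) ^+ 2) =
     J (fun p => al p ^+ 2 * Uxx (p, t) ^+ 2 + be p ^+ 2 * Uyy (p, t) ^+ 2) + 2 * J (fun p => w p * Uxx (p, t) * Uyy (p, t)).
    rewrite -JZ; last by cnt.
    by rewrite -JD; [|cnt|cnt]; apply: eq_J => x y _ _; rewrite /w; ring.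
  rewrite key -!JZ; [|cnt|cnt|cnt]; rewrite -JD; [|cnt|cnt]; rewrite -JD; [|cnt|cnt].
  apply: J_le; [cnt|cnt|move=> x y hx hy].
  have [[h1 h2 h3] [h4 h5 h6]] := coef_le hx hy.
  have hw (c1 c2 c3 c4 : R) : `|c1| <= B -> `|c2| <= B -> `|c3| <= B -> `|c4| <= B ->
     `|c1 * c2 + c3 * c4| <= 2 * B ^+ 2.
    move=> k1 k2 k3 k4; apply: le_trans (ler_normD _ _) _; rewrite !normrM.
    have -> : 2 * B ^+ 2 = B * B + B * B by ring.
    by apply: lerD; apply: ler_pM.
  have := @hess_pointwise (al (x, y)) (be (x, y)) (wx (x, y)) (wy (x, y)) (Ux (x, y, t)) (Uxx (x, y, t))
    (Uxy (x, y, t)) (Uyy (x, y, t)) (al_ge hx hy) (be_ge hx hy) (hw _ _ _ _ h2 h4 h1 h5) (hw _ _ _ _ h3 h4 h1 h6).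
  move=> hp; apply: le_trans hp _; rewrite lerD2l.
  have -> : Ux (x, y, t) ^+ 2 + Uy (x, y, t) ^+ 2 = Uy (x, y, t) ^+ 2 + Ux (x, y, t) ^+ 2 by rewrite addrC.
  apply: ler_wpM2l; last by rewrite lerDr sqr_ge0.
  by rewrite divr_ge0 ?mulr_ge0 ?exprn_ge0 ?(ltW B0) ?(ltW s00).
have h2 : J (fun p => (al p * Uxx (p, t) + be p * Uyy (p, t)) ^+ 2) <=
   2 * J (fun p => f (p, t) ^+ 2) + 2 * J (fun p => Ut (p, t) ^+ 2).
  rewrite -!JZ; [|cnt|cnt]; rewrite -JD; [|cnt|cnt].
  apply: J_le; [cnt|cnt|move=> x y hx hy].
  have -> : al (x, y) * Uxx (x, y, t) + be (x, y) * Uyy (x, y, t) = f (x, y, t) - Ut (x, y, t) by rewrite /f /=; ring.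
  exact: sqrB_le.
have S0 : 0 < s0 ^+ 2 / 2 by apply: divr_gt0; [exact: exprn_gt0|].
rewrite -(ler_pM2l S0); apply: le_trans h _.
have -> : s0 ^+ 2 / 2 * (4 / s0 ^+ 2 * J (fun p => Ut (p, t) ^+ 2) + Ch * (q t + G t)) =
  2 * J (fun p => Ut (p, t) ^+ 2) + (2 * (B * (q t + G t)) + 12 * B ^+ 4 / s0 ^+ 2 * (q t + G t)).
  by rewrite /Ch; field; rewrite lt0r_neq0.
have h3 : 12 * B ^+ 4 / s0 ^+ 2 * G t <= 12 * B ^+ 4 / s0 ^+ 2 * (q t + G t).
  apply: ler_wpM2l; last by rewrite lerDr q_ge0.
  by rewrite divr_ge0 ?mulr_ge0 ?exprn_ge0 ?(ltW B0) ?(ltW s00).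
exact: hess_combine h2 h3 (f_le t).
Qed.

Lemma pu_le t : pu t <= G t.
Proof.
have c1 : cnt (fun p => U (p, t)) by cnt.
have c2 : cnt (fun p => Ux (p, t)) by cnt.
have c3 : cnt (fun p => Uy (p, t)) by cnt.
have h1 y : 0 <= y <= 1 -> U (1, y, t) = 0 by move=> hy; exact: U1.
apply: le_trans (test_poincare (@Test R _ _ _ c1 c2 c3 (dUx t) (dUy t) h1)) _ => /=.
by apply: J_le; [cnt|cnt|move=> x y _ _; rewrite lerDl sqr_ge0].
Qed.

Definition Creg (a b : R) : R :=
  (1 + 4 / s0 ^+ 2) * (B + Ce) + Ch + 2 + (s0 * (b - a))^-1 * (1 + T * (B / s0)).

Lemma regularity (a b : R) : 0 <= a -> a < b -> b < T ->
  itg b T (fun t => J (fun p => Ut (p, t) ^+ 2 + (Uxx (p, t) ^+ 2 + Uxy (p, t) ^+ 2 + Uyy (p, t) ^+ 2)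
     + (Ux (p, t) ^+ 2 + Uy (p, t) ^+ 2) + U (p, t) ^+ 2 + (Mx (p, t) ^+ 2 + My (p, t) ^+ 2) + M (p, t) ^+ 2))
  <= Creg a b * (itg a T (fun t => q t + G t) + G T).
Proof.
move=> a0 ab bT.
have b0 : 0 <= b := le_trans a0 (ltW ab).
have cq := cnt_q; have cG := cnt_G; have cpu := cnt_pu.
pose A t := J (fun p => Ut (p, t) ^+ 2).
pose N t := J (fun p => Mx (p, t) ^+ 2 + My (p, t) ^+ 2).
have cA : cnt A by rewrite /A; cnt.
have cN : cnt N by rewrite /N; cnt.
have h1 : itg b T (fun t => J (fun p => Ut (p, t) ^+ 2 + (Uxx (p, t) ^+ 2 + Uxy (p, t) ^+ 2 + Uyy (p, t) ^+ 2)
     + (Ux (p, t) ^+ 2 + Uy (p, t) ^+ 2) + U (p, t) ^+ 2 + (Mx (p, t) ^+ 2 + My (p, t) ^+ 2) + M (p, t) ^+ 2))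
  <= itg b T (fun t => (1 + 4 / s0 ^+ 2) * A t + (Ch + 2) * (q t + G t) + N t).
  apply: itg_le; [|cnt|move=> t _].
    cnt.
  rewrite JD; [|cnt|cnt]; rewrite JD; [|cnt|cnt]; rewrite JD; [|cnt|cnt]; rewrite JD; [|cnt|cnt]; rewrite JD; [|cnt|cnt].
  have e1 := hess_le t; have e2 := pu_le t; have e3 := q_ge0 t.
  have -> : (1 + 4 / s0 ^+ 2) * A t + (Ch + 2) * (q t + G t) + N t =
    A t + (4 / s0 ^+ 2 * A t + Ch * (q t + G t)) + G t + (q t + G t) + N t + q t by ring.
  rewrite -/(A t) -/(G t) -/(N t) -/(q t) lerD2r lerD2r.
  apply: lerD; last by apply: le_trans e2 _; rewrite lerDr.
  by rewrite lerD2r lerD2l.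
apply: le_trans h1 _.
have -> : itg b T (fun t => (1 + 4 / s0 ^+ 2) * A t + (Ch + 2) * (q t + G t) + N t) =
  (1 + 4 / s0 ^+ 2) * itg b T A + (Ch + 2) * itg b T (fun t => q t + G t) + itg b T N.
  have D1 := @itgD R b T (fun t => (1 + 4 / s0 ^+ 2) * A t + (Ch + 2) * (q t + G t)) N.
  have D2 := @itgD R b T (fun t => (1 + 4 / s0 ^+ 2) * A t) (fun t => (Ch + 2) * (q t + G t)).
  have Z1 := @itgZ R b T A (1 + 4 / s0 ^+ 2).
  have Z2 := @itgZ R b T (fun t => q t + G t) (Ch + 2).
  by rewrite D1 ?D2 ?Z1 ?Z2; cnt.
have e1 := Ut_int_le b0 bT; have e2 := grad_m_le a0 ab bT.
rewrite -/(A _) -/(N _) in e1 e2.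
have e3 : itg b T (fun t => q t + G t) <= itg a T (fun t => q t + G t).
  have cqG : cnt (fun t => q t + G t) by cnt.
  rewrite (itg_split cqG (ltW ab) (ltW bT)) lerDr.
  by apply: itg_ge0 => t _; exact: addr_ge0 (q_ge0 t) (G_ge0 t).
have c0 : 0 <= 1 + 4 / s0 ^+ 2 by rewrite addr_ge0 // divr_ge0 // exprn_ge0 // ltW.
have c1 : 0 <= Ch + 2 by exact: Ch2_ge0 s00 B0.
have c2 : 0 <= Ce by exact: addr_ge0 (mulr_ge0 (ler0n _ 2) (ltW B0)) (mulr_ge0 (ler0n _ 4) (sqr_ge0 B)).
have c3 := Kgrad_ge0 s00 B0 T0 ab.
have g0 := G_ge0 T.
have i0 : 0 <= itg b T (fun t => q t + G t).
  by apply: itg_ge0 => t _; exact: addr_ge0 (q_ge0 t) (G_ge0 t).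
exact: (regularity_combine e1 e2 e3 c0 c1 c2 c3 g0 i0 B0).
Qed.

(** The interface to the nonlinear problem: the fluxes, the coefficients and the time derivative of
    [M] no longer occur. *)
Definition estimates : Prop :=
  [/\ forall lam, 1 <= lam -> Cpu <= lam ->
        itg 0 T (fun t => wgt lam t * (q t + G t)) <=
        wgt lam 0 * q 0 + wgt lam T * (lam * Kc * psi T / s0 * q T + Nc * pu T),
      forall a b : R, 0 <= a -> a < b -> b < T ->
        itg b T (fun t => J (fun p => Ut (p, t) ^+ 2 + (Uxx (p, t) ^+ 2 + Uxy (p, t) ^+ 2 + Uyy (p, t) ^+ 2)
          + (Ux (p, t) ^+ 2 + Uy (p, t) ^+ 2) + U (p, t) ^+ 2 + (Mx (p, t) ^+ 2 + My (p, t) ^+ 2) + M (p, t) ^+ 2))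
        <= Creg a b * (itg a T (fun t => q t + G t) + G T) &
      forall t, pu t <= G t].

Lemma core_estimates : estimates.
Proof. by split; [exact: carleman|exact: regularity|exact: pu_le]. Qed.

End Core.

(** * Extension from the open cylinder *)

Section Limits.
Context {R : realType}.

Lemma le_limit (E : R -> R) : cnt E -> (forall s, 0 < s <= 1 -> E s <= 0) -> E 0 <= 0.
Proof.
move=> cE E0; have h : E s @[s --> 0^'+] --> E 0 by apply: cvg_at_right_filter; exact: cE.
apply: (cvgr_to_le h); near=> s; apply: E0; apply/andP; split => //.
by near: s; apply: nbhs_right_le.
Unshelve. all: by end_near. Qed.

Lemma dir_derive (V : normedModType R) (A : set V) (c v : V) (W F : V -> R) (q : V) (a b x : R) :
  cnt W -> cnt F -> (forall p, A p -> is_derive p v W (F p)) -> a < x < b ->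
  (forall z s th, a < z < b -> 0 < s <= 1 -> 0 <= th <= 1 ->
     A ((1 - s) *: (q + (th * (z - x)) *: v) + s *: c)) ->
  is_derive (x : R) (1 : R) (fun z => W (q + (z - x) *: v)) (F q).
Proof.
move=> cW cF dW hx hA.
pose g z := itg 0 1 (fun th : R => F (q + (th * (z - x)) *: v)).
have cg : cnt g.
  by apply: (cnt_itg (F := fun p : R * R => F (q + (p.2 * (p.1 - x)) *: v))) => //; cnt.
have -> : F q = g x.
  rewrite /g (eq_itg (g := fun=> F q)) ?itg_cst ?subr0 ?mulr1 // => th _.
  by rewrite subrr mulr0 scale0r addr0.
apply: (dr_carath hx _ cg) => z hz; rewrite subrr scale0r addr0.
have := slope_closure cW cF dW (q := q) (h := z - x) (c := c).
move=> /(_ (fun s th hs hth => hA z s th hz hs hth)) => h.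
have -> : g z * (z - x) = W (q + (z - x) *: v) - W q by rewrite mulrC h.
by rewrite [RHS]addrC subrK.
Qed.

Lemma closure_path (V : normedModType R) (A : set V) (c p : V) :
  (forall s : R, 0 < s <= 1 -> A ((1 - s) *: p + s *: c)) -> closure A p.
Proof.
move=> hA B nB.
have ck : cnt (fun s : R => (1 - s) *: p + s *: c) by cnt.
have h : (1 - s) *: p + s *: c @[s --> 0^'+] --> p.
  have -> : nbhs p = nbhs ((1 - 0) *: p + (0 : R) *: c) by rewrite subr0 scale1r scale0r addr0.
  by apply: cvg_at_right_filter; exact: (ck (0 : R)).
have [s [h1 h2 h3]] : exists s : R, [/\ 0 < s, s <= 1 & B ((1 - s) *: p + s *: c)].
  near (0:R)^'+ => s; exists s; split => //.
    by near: s; apply: nbhs_right_le.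
  by near: s; exact: (h _ nB).
by exists ((1 - s) *: p + s *: c); split => //; apply: hA; rewrite h1.
Unshelve. all: by end_near. Qed.

End Limits.

(** * The closed cylinder and the projection onto it *)

Section Clamp.
Context {R : realType}.

(* The projection onto [0, T], in a form whose continuity is syntactic. *)
Definition cl (T x : R) : R := (`|x| - `|x - T| + T) / 2.

Lemma cnt_cl T : cnt (cl T).
Proof. by rewrite /cl; cnt. Qed.
Lemma cl_in T x : 0 <= T -> 0 <= cl T x <= T.
Proof.
move=> T0; rewrite /cl; case: (ger0P x) => hx; case: (ger0P (x - T)) => hT;
  apply/andP; split; lra.
Qed.
Lemma clE T x : 0 <= x <= T -> cl T x = x.
Proof.
by move=> /andP[x0 xT]; rewrite /cl ger0_norm // ler0_norm ?subr_le0 //; field.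
Qed.
Lemma cl_id T x : 0 <= T -> cl T (cl T x) = cl T x.
Proof. by move=> T0; rewrite clE // cl_in. Qed.

Lemma mid_path (T x s : R) : 0 < T -> 0 <= x <= T -> 0 < s <= 1 ->
  0 < (1 - s) * x + s * (T / 2) < T.
Proof.
move=> T0 /andP[x0 xT] /andP[s0 s1].
have h1 : 0 <= (1 - s) * x by rewrite mulr_ge0 // subr_ge0.
have h2 : 0 < s * (T / 2) by rewrite mulr_gt0 // divr_gt0.
have h3 : (1 - s) * x <= (1 - s) * T by rewrite ler_wpM2l // subr_ge0.
have h4 : s * (T / 2) < s * T by rewrite ltr_pM2l // ltr_pdivrMr // mulr_natr mulr2n ltrDr.
apply/andP; split; first by rewrite ltr_wpDl.
by apply: lt_le_trans (ler_ltD h3 h4) _; rewrite -mulrDl subrK mul1r.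
Qed.

Definition box (T : R) : set (R * R * R) :=
  [set q | [/\ 0 <= q.1.1 <= 1, 0 <= q.1.2 <= 1 & 0 <= q.2 <= T]].
Definition sq : set (R * R) := [set p | 0 <= p.1 <= 1 /\ 0 <= p.2 <= 1].
Definition mid3 (T : R) : R * R * R := (1 / 2, 1 / 2, T / 2).
Definition mid2 : R * R := (1 / 2, 1 / 2).

Lemma path3 T q s : 0 < T -> box T q -> 0 < s <= 1 -> Q 0 T ((1 - s) *: q + s *: mid3 T).
Proof.
move: q => [[x y] t] T0 [/= hx hy ht] hs.
by split; [split|]; apply: mid_path.
Qed.
Lemma path2 p s : sq p -> 0 < s <= 1 -> @Omega R ((1 - s) *: p + s *: mid2).
Proof. by move: p => [x y] [/= hx hy] hs; split; apply: mid_path. Qed.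

Lemma open_Q T : open (@Q R 0 T).
Proof.
have o (k : R * R * R -> R) a b : cnt k -> open [set q | a < k q < b].
  move=> ck; have -> : [set q | a < k q < b] = k @^-1` `]a, b[%classic.
    by apply/seteqP; split => q /=; rewrite in_itv.
  by apply: open_comp => [x _|]; [exact: ck|exact: interval_open].
have -> : @Q R 0 T = [set q | 0 < q.1.1 < 1] `&` [set q | 0 < q.1.2 < 1] `&` [set q | 0 < q.2 < T].
  by apply/seteqP; split => q /=; [move=> [[? ?] ?]|move=> [[? ?] ?]].
by apply: openI; [apply: openI; [apply: (o (fun q => q.1.1))|apply: (o (fun q => q.1.2))]|apply: (o (fun q => q.2))]; cnt.
Qed.
Lemma open_Omega : open (@Omega R).
Proof.
have o (k : R * R -> R) a b : cnt k -> open [set q | a < k q < b].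
  move=> ck; have -> : [set q | a < k q < b] = k @^-1` `]a, b[%classic.
    by apply/seteqP; split => q /=; rewrite in_itv.
  by apply: open_comp => [x _|]; [exact: ck|exact: interval_open].
have -> : @Omega R = [set q | 0 < q.1 < 1] `&` [set q | 0 < q.2 < 1].
  by apply/seteqP; split => q /=; [move=> [? ?]|move=> [? ?]].
by apply: openI; [apply: (o (fun q => q.1))|apply: (o (fun q => q.2))]; cnt.
Qed.

Lemma closureQ T : 0 < T -> closure (@Q R 0 T) = box T.
Proof.
move=> T0; apply/seteqP; split; last by move=> q hq; apply: (@closure_path R _ _ (mid3 T)) => s; exact: path3.
have cb : closed (box T).
  have o (k : R * R * R -> R) a b : cnt k -> closed [set q | a <= k q <= b].
    move=> ck; have -> : [set q | a <= k q <= b] = k @^-1` `[a, b]%classic.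
      by apply/seteqP; split => q /=; rewrite in_itv.
    by apply: closed_comp => [x _|]; [exact: ck|exact: interval_closed].
  have -> : box T = [set q | 0 <= q.1.1 <= 1] `&` [set q | 0 <= q.1.2 <= 1] `&` [set q | 0 <= q.2 <= T].
    by apply/seteqP; split => q /=; [move=> [? ? ?]|move=> [[? ?] ?]].
  by apply: closedI; [apply: closedI; [apply: (o (fun q => q.1.1))|apply: (o (fun q => q.1.2))]|apply: (o (fun q => q.2))]; cnt.
rewrite [X in _ `<=` X]((closure_id _).1 cb); apply: closure_subset.
move=> [[x y] t] [[/= /andP[/ltW a b] /andP[/ltW c d]] /andP[/ltW e f]].
by split => /=; rewrite ?a ?c ?e ltW.
Qed.

Lemma closureOmega : closure (@Omega R) = sq.
Proof.
apply/seteqP; split; last by move=> q hq; apply: (@closure_path R _ _ mid2) => s; exact: path2.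
have cb : closed sq.
  have o (k : R * R -> R) a b : cnt k -> closed [set q | a <= k q <= b].
    move=> ck; have -> : [set q | a <= k q <= b] = k @^-1` `[a, b]%classic.
      by apply/seteqP; split => q /=; rewrite in_itv.
    by apply: closed_comp => [x _|]; [exact: ck|exact: interval_closed].
  have -> : sq = [set q | 0 <= q.1 <= 1] `&` [set q | 0 <= q.2 <= 1].
    by apply/seteqP; split => q /=; [move=> [? ?]|move=> [? ?]].
  by apply: closedI; [apply: (o (fun q => q.1))|apply: (o (fun q => q.2))]; cnt.
rewrite [X in _ `<=` X]((closure_id _).1 cb); apply: closure_subset.
move=> [x y] [/= /andP[/ltW a b] /andP[/ltW c d]].
by split => /=; rewrite ?a ?c ltW.
Qed.

Definition ext3 (T : R) (w : R * R * R -> R) (q : R * R * R) : R :=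
  w (cl 1 q.1.1, cl 1 q.1.2, cl T q.2).
Definition ext2 (w : R * R -> R) (q : R * R) : R := w (cl 1 q.1, cl 1 q.2).

(** Composition with a continuous map into [A] turns continuity relative to [A] into continuity on
    the whole space. *)
Lemma cnt_within (V W : topologicalType) (A : set V) (w : V -> R) (k : W -> V) :
  {within A, continuous w} -> cnt k -> (forall q, A (k q)) -> cnt (fun q => w (k q)).
Proof.
move=> /subspace_continuousP cw ck kA; split=> q.
apply: (cvg_comp k w _ (cw (k q) (kA q))).
move=> B hB; have h : nbhs q (k @^-1` [set z | A z -> B z]) := ck q _ hB.
change (nbhs q (k @^-1` B)); apply: filterS h => z /= h; exact: h (kA z).
Qed.

Lemma cnt_ext3 T w : 0 < T -> {within closure (Q 0 T), continuous w} -> cnt (ext3 T w).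
Proof.
move=> T0 cw; rewrite /ext3.
apply: (cnt_within (A := closure (Q 0 T)) (k := fun q => (cl 1 q.1.1, cl 1 q.1.2, cl T q.2))) => //.
  have c1 := cnt_cl 1; have c2 := cnt_cl T; cnt.
by move=> q; rewrite closureQ //; split; apply: cl_in => //; exact: ltW.
Qed.
Lemma cnt_ext2 w : {within closure (@Omega R), continuous w} -> cnt (ext2 w).
Proof.
move=> cw; rewrite /ext2.
apply: (cnt_within (A := closure (@Omega R)) (k := fun q => (cl 1 q.1, cl 1 q.2))) => //.
  have c1 := cnt_cl 1; cnt.
by move=> q; rewrite closureOmega //; split; apply: cl_in.
Qed.
Lemma ext3E T w q : box T q -> ext3 T w q = w q.
Proof. by case: q => [[x y] t] [/= hx hy ht]; rewrite /ext3 /= !clE. Qed.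
Lemma ext2E w q : sq q -> ext2 w q = w q.
Proof. by case: q => [x y] [/= hx hy]; rewrite /ext2 /= !clE. Qed.
Lemma Q_box T q : Q 0 T q -> box T q.
Proof.
case: q => [[x y] t] [[/= /andP[/ltW a b] /andP[/ltW c d]] /andP[/ltW e f]].
by split => /=; rewrite ?a ?c ?e ltW.
Qed.
Lemma Omega_sq q : Omega q -> sq q.
Proof.
case: q => [x y] [/= /andP[/ltW a b] /andP[/ltW c d]].
by split => /=; rewrite ?a ?c ltW.
Qed.

Lemma box_le T (g : R * R * R -> R) : 0 < T -> cnt g -> (forall q, Q 0 T q -> g q <= 0) ->
  forall q, box T q -> g q <= 0.
Proof.
move=> T0 cg h q hq.
have c : cnt (fun s : R => g ((1 - s) *: q + s *: mid3 T)) by cnt.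
have := le_limit c; rewrite subr0 scale1r scale0r addr0; apply => s hs.
by apply: h; exact: path3.
Qed.
Lemma sq_le (g : R * R -> R) : cnt g -> (forall q, Omega q -> g q <= 0) ->
  forall q, sq q -> g q <= 0.
Proof.
move=> cg h q hq.
have c : cnt (fun s : R => g ((1 - s) *: q + s *: mid2)) by cnt.
have := le_limit c; rewrite subr0 scale1r scale0r addr0; apply => s hs.
by apply: h; exact: path2.
Qed.

End Clamp.

Section Extension.
Context {R : realType}.
Variable T : R.
Hypothesis T0 : 0 < T.
Let T0' : 0 <= T := ltW T0.

(* All functions are replaced by extensions that are continuous on the whole space and invariant
   under the projection onto the closed box, so that only global continuity is ever needed. *)
Definition Ext (f F : R * R * R -> R) : Prop :=
  [/\ cnt F, forall q, F q = F (cl 1 q.1.1, cl 1 q.1.2, cl T q.2) & forall q, Q 0 T q -> F q = f q].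
Definition Ext2 (f F : R * R -> R) : Prop :=
  [/\ cnt F, forall q, F q = F (cl 1 q.1, cl 1 q.2) & forall q, Omega q -> F q = f q].

Lemma ext3_Ext f F : {within closure (Q 0 T), continuous F} ->
  (forall q, Q 0 T q -> F q = f q) -> Ext f (ext3 T F).
Proof.
move=> cF Ff; split; first exact: cnt_ext3.
- by move=> q; rewrite /ext3 /= !cl_id.
- by move=> q hq; rewrite ext3E ?Ff //; exact: Q_box.
Qed.

Lemma ext2_Ext f F : {within closure (@Omega R), continuous F} ->
  (forall q, Omega q -> F q = f q) -> Ext2 f (ext2 F).
Proof.
move=> cF Ff; split; first exact: cnt_ext2.
- by move=> q; rewrite /ext2 /= !cl_id.
- by move=> q hq; rewrite ext2E ?Ff //; exact: Omega_sq.
Qed.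

Lemma derive_Ext f F v : Ext f F -> has_derivative_up_to_boundary (Q 0 T) v f ->
  exists Fv, Ext ('D_v f) Fv /\ forall q, Q 0 T q -> is_derive q v F (Fv q).
Proof.
move=> [cF Fi Ff] [df [G [cG GE]]]; exists (ext3 T G).
have e : Ext ('D_v f) (ext3 T G) by exact: ext3_Ext.
split=> // q hq; have [_ _ ->] := e; rewrite //.
apply: (@near_eq_is_derive _ _ _ f).
  by apply: filterS (open_nbhs_nbhs (conj (@open_Q R T) hq)) => z hz; rewrite Ff.
by apply: DeriveDef => //; exact: df.
Qed.

Lemma derive_Ext2 f F v : Ext2 f F -> has_derivative_up_to_boundary (@Omega R) v f ->
  exists Fv, Ext2 ('D_v f) Fv /\ forall q, Omega q -> is_derive q v F (Fv q).
Proof.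
move=> [cF Fi Ff] [df [G [cG GE]]]; exists (ext2 G).
have e : Ext2 ('D_v f) (ext2 G) by exact: ext2_Ext.
split=> // q hq; have [_ _ ->] := e; rewrite //.
apply: (@near_eq_is_derive _ _ _ f).
  by apply: filterS (open_nbhs_nbhs (conj (@open_Omega R) hq)) => z hz; rewrite Ff.
by apply: DeriveDef => //; exact: df.
Qed.

Lemma Ext_cl f F : Ext f F -> forall p t, F (p, t) = F (p, cl T t).
Proof.
by move=> [_ h _] [x y] t; rewrite h [RHS]h /= cl_id.
Qed.

Lemma conv_eq3 (x y t z s th a b c : R) :
  (1 - s) *: ((x, y, t) + (th * z) *: (a, b, c)) + s *: mid3 T =
  ((1 - s) * (x + th * z * a) + s * (1 / 2), (1 - s) * (y + th * z * b) + s * (1 / 2),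
   (1 - s) * (t + th * z * c) + s * (T / 2)).
Proof. by []. Qed.

Lemma oo_cc (a b x : R) : a < x < b -> a <= x <= b.
Proof. by move=> /andP[/ltW -> /ltW ->]. Qed.

(** Holds for every real [t]: both functions depend on [t] only through its clamped value, and
    points of the closed box are reached by contraction towards the centre. *)
Lemma Q_dX f F g G : Ext f F -> Ext g G ->
  (forall q, Q 0 T q -> is_derive q (1, 0, 0) F (G q)) ->
  forall t, dX (fun p => F (p, t)) (fun p => G (p, t)).
Proof.
move=> eF eG dF t x y hx hy; rewrite (Ext_cl eG).
have -> : (fun z => F (z, y, t)) = fun z => F ((x, y, cl T t) + (z - x) *: (1, 0, 0)).
  apply/funext => z; rewrite (Ext_cl eF); congr F.
  apply/pair_equal_spec; split; [apply/pair_equal_spec; split|] => /=;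
    rewrite ?[_ *: 1]mulr1 ?[_ *: 0]mulr0 ?addr0 //.
  by rewrite addrC subrK.
have [cF _ _] := eF; have [cG _ _] := eG.
apply: (dir_derive (A := Q 0 T) (c := mid3 T) (a := 0) (b := 1)) => //.
move=> z s th hz hs hth; rewrite conv_eq3; split; [split|] => /=;
  apply: mid_path => //; rewrite ?mulr1 ?mulr0 ?addr0 //; last exact: cl_in.
by apply: convex_in => //; exact: oo_cc.
Qed.

Lemma Q_dY f F g G : Ext f F -> Ext g G ->
  (forall q, Q 0 T q -> is_derive q (0, 1, 0) F (G q)) ->
  forall t, dY (fun p => F (p, t)) (fun p => G (p, t)).
Proof.
move=> eF eG dF t x y hx hy; rewrite (Ext_cl eG).
have -> : (fun z => F (x, z, t)) = fun z => F ((x, y, cl T t) + (z - y) *: (0, 1, 0)).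
  apply/funext => z; rewrite (Ext_cl eF); congr F.
  apply/pair_equal_spec; split; [apply/pair_equal_spec; split|] => /=;
    rewrite ?[_ *: 1]mulr1 ?[_ *: 0]mulr0 ?addr0 //.
  by rewrite addrC subrK.
have [cF _ _] := eF; have [cG _ _] := eG.
apply: (dir_derive (A := Q 0 T) (c := mid3 T) (a := 0) (b := 1)) => //.
move=> z s th hz hs hth; rewrite conv_eq3; split; [split|] => /=;
  apply: mid_path => //; rewrite ?mulr1 ?mulr0 ?addr0 //; last exact: cl_in.
by apply: convex_in => //; exact: oo_cc.
Qed.

Lemma Q_dT f F g G : Ext f F -> Ext g G ->
  (forall q, Q 0 T q -> is_derive q (0, 0, 1) F (G q)) -> dT T F G.
Proof.
move=> eF eG dF x y t hx hy ht.
have -> : (fun z => F (x, y, z)) = fun z => F ((x, y, t) + (z - t) *: (0, 0, 1)).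
  apply/funext => z; congr F.
  apply/pair_equal_spec; split; [apply/pair_equal_spec; split|] => /=;
    rewrite ?[_ *: 1]mulr1 ?[_ *: 0]mulr0 ?addr0 //.
  by rewrite addrC subrK.
have [cF _ _] := eF; have [cG _ _] := eG.
apply: (dir_derive (A := Q 0 T) (c := mid3 T) (a := 0) (b := T)) => //.
move=> z s th hz hs hth; rewrite conv_eq3; split; [split|] => /=;
  apply: mid_path => //; rewrite ?mulr1 ?mulr0 ?addr0 //.
by apply: convex_in => //; exact: oo_cc.
Qed.

Lemma Omega_dX (F G : R * R -> R) : cnt F -> cnt G ->
  (forall q, Omega q -> is_derive q (1, 0) F (G q)) -> dX F G.
Proof.
move=> cF cG dF x y hx hy.
have -> : (fun z => F (z, y)) = fun z => F ((x, y) + (z - x) *: (1, 0)).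
  apply/funext => z; congr F; apply/pair_equal_spec; split => /=;
    rewrite ?[_ *: 1]mulr1 ?[_ *: 0]mulr0 ?addr0 //.
  by rewrite addrC subrK.
apply: (dir_derive (A := @Omega R) (c := mid2) (a := 0) (b := 1)) => //.
move=> z s th hz hs hth; split => /=; apply: mid_path => //.
  by rewrite [_ *: 1]mulr1; apply: convex_in => //; exact: oo_cc.
by rewrite [_ *: 0]mulr0 addr0.
Qed.

Lemma Omega_dY (F G : R * R -> R) : cnt F -> cnt G ->
  (forall q, Omega q -> is_derive q (0, 1) F (G q)) -> dY F G.
Proof.
move=> cF cG dF x y hx hy.
have -> : (fun z => F (x, z)) = fun z => F ((x, y) + (z - y) *: (0, 1)).
  apply/funext => z; congr F; apply/pair_equal_spec; split => /=;
    rewrite ?[_ *: 1]mulr1 ?[_ *: 0]mulr0 ?addr0 //.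
  by rewrite addrC subrK.
apply: (dir_derive (A := @Omega R) (c := mid2) (a := 0) (b := 1)) => //.
move=> z s th hz hs hth; split => /=; apply: mid_path => //.
  by rewrite [_ *: 0]mulr0 addr0.
by rewrite [_ *: 1]mulr1; apply: convex_in => //; exact: oo_cc.
Qed.

(** Capital letters are global extensions. The derivatives are tied to those of [w] in the open
    cylinder only, where the latter exist, whereas the rules [dX], [dY], [dT] hold up to the
    boundary. *)
Record reg21 (w W Wx Wy Wt Wxx Wxy Wyx Wyy : R * R * R -> R) : Prop := Reg21 {
  reg_box : forall q, box T q -> W q = w q;
  reg_0 : Ext w W; reg_x : Ext (pdx w) Wx; reg_y : Ext (pdy w) Wy; reg_t : Ext (pdt w) Wt;
  reg_xx : Ext (pdx (pdx w)) Wxx; reg_xy : Ext (pdy (pdx w)) Wxy;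
  reg_yx : Ext (pdx (pdy w)) Wyx; reg_yy : Ext (pdy (pdy w)) Wyy;
  reg_dx : forall t, dX (fun p => W (p, t)) (fun p => Wx (p, t));
  reg_dy : forall t, dY (fun p => W (p, t)) (fun p => Wy (p, t));
  reg_dt : dT T W Wt;
  reg_dxx : forall t, dX (fun p => Wx (p, t)) (fun p => Wxx (p, t));
  reg_dxy : forall t, dY (fun p => Wx (p, t)) (fun p => Wxy (p, t));
  reg_dyx : forall t, dX (fun p => Wy (p, t)) (fun p => Wyx (p, t));
  reg_dyy : forall t, dY (fun p => Wy (p, t)) (fun p => Wyy (p, t));
  reg_derx : forall q, Q 0 T q -> derivable w q (1, 0, 0);
  reg_dery : forall q, Q 0 T q -> derivable w q (0, 1, 0);
  reg_dert : forall q, Q 0 T q -> derivable w q (0, 0, 1);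
  reg_derxx : forall q, Q 0 T q -> derivable (pdx w) q (1, 0, 0);
  reg_derxy : forall q, Q 0 T q -> derivable (pdx w) q (0, 1, 0);
  reg_deryx : forall q, Q 0 T q -> derivable (pdy w) q (1, 0, 0);
  reg_deryy : forall q, Q 0 T q -> derivable (pdy w) q (0, 1, 0)
}.

Lemma C21_reg w : C21 (Q 0 T) w ->
  exists W Wx Wy Wt Wxx Wxy Wyx Wyy, reg21 w W Wx Wy Wt Wxx Wxy Wyx Wyy.
Proof.
move=> [cw [[hx hy ht] [hxx hxy hyx hyy]]].
have e0 : Ext w (ext3 T w) by exact: ext3_Ext.
have [Wx [ex dx]] := derive_Ext e0 hx.
have [Wy [ey dy]] := derive_Ext e0 hy.
have [Wt [et dt]] := derive_Ext e0 ht.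
have [Wxx [exx dxx]] := derive_Ext ex hxx.
have [Wxy [exy dxy]] := derive_Ext ex hxy.
have [Wyx [eyx dyx]] := derive_Ext ey hyx.
have [Wyy [eyy dyy]] := derive_Ext ey hyy.
exists (ext3 T w), Wx, Wy, Wt, Wxx, Wxy, Wyx, Wyy; apply: Reg21;
  [by move=> q hq; exact: ext3E|exact: e0|exact: ex|exact: ey|exact: et|exact: exx|exact: exy
  |exact: eyx|exact: eyy|exact: Q_dX e0 ex dx|exact: Q_dY e0 ey dy|exact: Q_dT e0 et dt
  |exact: Q_dX ex exx dxx|exact: Q_dY ex exy dxy|exact: Q_dX ey eyx dyx|exact: Q_dY ey eyy dyy
  |exact: hx.1|exact: hy.1|exact: ht.1|exact: hxx.1|exact: hxy.1|exact: hyx.1|exact: hyy.1].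
Qed.

Record reg1 (v V Vx Vy : R * R -> R) : Prop := Reg1 {
  reg1_sq : forall p, sq p -> V p = v p;
  reg1_0 : Ext2 v V; reg1_x : Ext2 (dx v) Vx; reg1_y : Ext2 (dy v) Vy;
  reg1_dx : dX V Vx; reg1_dy : dY V Vy;
  reg1_derx : forall p, Omega p -> derivable v p (1, 0);
  reg1_dery : forall p, Omega p -> derivable v p (0, 1)
}.

Lemma C1_reg v : C1 (@Omega R) v -> exists V Vx Vy, reg1 v V Vx Vy.
Proof.
move=> [cv hx hy].
have e0 : Ext2 v (ext2 v) by exact: ext2_Ext.
have [Wx [ex dx]] := derive_Ext2 e0 hx.
have [Wy [ey dy]] := derive_Ext2 e0 hy.
have [c0 _ _] := e0; have [cx _ _] := ex; have [cy _ _] := ey.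
exists (ext2 v), Wx, Wy; apply: Reg1;
  [by move=> q hq; exact: ext2E|exact: e0|exact: ex|exact: ey|exact: Omega_dX c0 cx dx
  |exact: Omega_dY c0 cy dy|exact: hx.1|exact: hy.1].
Qed.

(** The one-sided quotient is minus an average of [df] over [[0, h]], so it also tends to [- df 0];
    limits are unique. *)
Lemma neumann0 (f df k : R -> R) : cnt f -> cnt df ->
  (forall z : R, 0 < z < 1 -> is_derive z (1 : R) f (df z)) ->
  (forall h, 0 < h <= 1 -> k h = (f 0 - f h) / h) -> k @ 0^'+ --> 0 -> df 0 = 0.
Proof.
move=> cf cdf hd kE k0.
pose g h := - itg 0 1 (fun th : R => df (th * h)).
have cg : cnt g.
  by apply: cntN; apply: (cnt_itg (F := fun z : R * R => df (z.2 * z.1))) => //; cnt.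
have h1 : k @ 0^'+ --> g 0.
  have h2 : g @ 0^'+ --> g 0 by apply: cvg_at_right_filter; exact: cg.
  apply: cvg_trans h2; apply: near_eq_cvg; near=> h.
  have h0 : 0 < h by [].
  have hh1 : h <= 1 by near: h; apply: nbhs_right_le.
  rewrite kE ?h0 // (@slope1 R 0 1 f df cf cdf hd 0 h) ?lexx ?ler01 ?(ltW h0) //.
  set I := itg _ _ _; have -> : (f 0 - (f 0 + (h - 0) * I)) / h = - I by field; exact: lt0r_neq0.
  by congr (- _); apply: eq_itg => th _; rewrite add0r subr0.
have : g 0 = 0 by exact: cvg_unique h1 k0.
rewrite /g (eq_itg (g := fun=> df 0)) ?itg_cst ?subr0 ?mulr1 //; last by move=> th _; rewrite mulr0.
by move/eqP; rewrite oppr_eq0 => /eqP.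
Unshelve. all: by end_near. Qed.

Lemma neumann1 (f df k : R -> R) : cnt f -> cnt df ->
  (forall z : R, 0 < z < 1 -> is_derive z (1 : R) f (df z)) ->
  (forall h, 0 < h <= 1 -> k h = (f 1 - f (1 - h)) / h) -> k @ 0^'+ --> 0 -> df 1 = 0.
Proof.
move=> cf cdf hd kE k0.
pose g h := itg 0 1 (fun th : R => df (1 - th * h)).
have cg : cnt g.
  by apply: (cnt_itg (F := fun z : R * R => df (1 - z.2 * z.1))) => //; cnt.
have h1 : k @ 0^'+ --> g 0.
  have h2 : g @ 0^'+ --> g 0 by apply: cvg_at_right_filter; exact: cg.
  apply: cvg_trans h2; apply: near_eq_cvg; near=> h.
  have h0 : 0 < h by [].
  have hh1 : h <= 1 by near: h; apply: nbhs_right_le.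
  rewrite kE ?h0 // (@slope1 R 0 1 f df cf cdf hd 1 (1 - h)) ?lexx ?ler01 ?subr_ge0 ?hh1 ?gerBl ?(ltW h0) //.
  have E : 1 - h - 1 = - h by ring.
  rewrite E; set I := itg _ _ _; have -> : (f 1 - (f 1 + - h * I)) / h = I by field; exact: lt0r_neq0.
  by apply: eq_itg => th _; rewrite mulrN.
have : g 0 = 0 by exact: cvg_unique h1 k0.
by rewrite /g (eq_itg (g := fun=> df 1)) ?itg_cst ?subr0 ?mulr1 // => th _; rewrite mulr0 subr0.
Unshelve. all: by end_near. Qed.

(** The boundary conditions hold at interior times, and the normal derivative is not prescribed at
    corners; continuity supplies the rest of the face. *)
Lemma face_zero (g : R * R -> R) : cnt g ->
  (forall y t, 0 < y < 1 -> 0 < t < T -> g (y, t) = 0) ->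
  forall y t, 0 <= y <= 1 -> 0 <= t <= T -> g (y, t) = 0.
Proof.
move=> cg g0 y t hy ht.
have c : cnt (fun s : R => g ((1 - s) * y + s * (1 / 2), (1 - s) * t + s * (T / 2))) by cnt.
have -> : g (y, t) = g ((1 - 0) * y + 0 * (1 / 2), (1 - 0) * t + 0 * (T / 2)).
  by rewrite subr0 !mul0r !mul1r !addr0.
by apply: (zero_limit c) => s hs; apply: g0; apply: mid_path.
Qed.

End Extension.

Lemma Ext_cnt (R : realType) (T : R) f F : Ext T f F -> cnt F. Proof. by case. Qed.
Lemma Ext2_cnt (R : realType) (f F : R * R -> R) : Ext2 f F -> cnt F. Proof. by case. Qed.

Ltac cnt_reg := match goal with
  | H : reg21 _ _ ?W ?Wx ?Wy ?Wt ?Wxx ?Wxy ?Wyx ?Wyy |- cnt ?F => first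
    [ constr_eq F W; exact (Ext_cnt (reg_0 H)) | constr_eq F Wx; exact (Ext_cnt (reg_x H))
    | constr_eq F Wy; exact (Ext_cnt (reg_y H)) | constr_eq F Wt; exact (Ext_cnt (reg_t H))
    | constr_eq F Wxx; exact (Ext_cnt (reg_xx H)) | constr_eq F Wxy; exact (Ext_cnt (reg_xy H))
    | constr_eq F Wyx; exact (Ext_cnt (reg_yx H)) | constr_eq F Wyy; exact (Ext_cnt (reg_yy H)) ]
  | H : reg1 _ ?V ?Vx ?Vy |- cnt ?F => first
    [ constr_eq F V; exact (Ext2_cnt (reg1_0 H)) | constr_eq F Vx; exact (Ext2_cnt (reg1_x H))
    | constr_eq F Vy; exact (Ext2_cnt (reg1_y H)) ]
  end.

Section Lifting.
Context {R : realType}.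

Lemma slice_is_derive (k : R * R * R -> R) (p : R * R) (t a b : R) :
  derivable k (p, t) (a, b, 0) ->
  is_derive p (a, b) (fun p' => k (p', t)) ('D_(a, b, 0) k (p, t)).
Proof.
move=> dk.
have E : (fun h : R => h^-1 *: ((fun p' => k (p', t)) (h *: (a, b) + p) - k (p, t))) =
   (fun h : R => h^-1 *: (k (h *: (a, b, 0) + (p, t)) - k (p, t))).
  apply/funext => h; congr (_ *: (k _ - _)); rewrite /=.
  by congr pair; rewrite /= [_ *: 0]mulr0 add0r.
apply: DeriveDef; first by rewrite /derivable E.
by rewrite /derive E.
Qed.

Lemma bOmegaE (p : R * R) : bOmega p <-> sq p /\ ~ Omega p.
Proof.
rewrite /bOmega closureOmega (_ : (@Omega R)° = @Omega R); first by split.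
exact: (interior_id _).1 (@open_Omega R).
Qed.

(** If [V p] were nonzero, [V] would be nonzero at interior points near [p], where [v] is
    constant. *)
Lemma near_boundary_derive (v V : R * R -> R) (w : R * R) (p : R * R) :
  constant_near_boundary v -> Ext2 ('D_w v) V -> bOmega p -> V p = 0.
Proof.
move=> [kappa [k0 [U [oU bU cst]]]] [cV _ VE] bp.
apply/eqP/negP => /negP V0.
have nV : nbhs p [set z | V z != 0].
  have : open [set z | V z != 0].
    apply: (open_comp (f := V) (D := [set x | x != 0])) => [x _|]; first exact: cV.
    exact: open_neq.
  by move=> o; apply: open_nbhs_nbhs; split.
have nU : nbhs p U by apply: open_nbhs_nbhs; split => //; exact: bU.
have [z [Oz [Vz Uz]]] := bp.1 _ (filterI nV nU).
move: Vz => /=; rewrite VE //.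
rewrite (@near_eq_derive _ _ _ v (fun=> kappa)) ?derive_cst ?eqxx //.
have oI : open (U `&` @Omega R) by apply: openI => //; exact: open_Omega.
apply: filterS (open_nbhs_nbhs (conj oI (conj Uz Oz))) => y [Uy Oy].
by apply: cst => //; rewrite closureOmega; exact: Omega_sq.
Qed.

Lemma near_slice_Q T (A : set (R * R)) (p : R * R) t : open A -> A p -> Q 0 T (p, t) ->
  \forall q \near (p, t), A q.1 /\ Q 0 T q.
Proof.
move=> oA Ap Qp.
have o1 : open [set q : R * R * R | A q.1].
  by apply: (open_comp (f := fst) (D := A)) => // x _; exact: cvg_fst.
have oI := openI o1 (@open_Q R T).
have h : nbhs (p, t) ([set q : R * R * R | A q.1] `&` Q 0 T) by apply: open_nbhs_nbhs.
by apply: filterS h => y [].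
Qed.
End Lifting.

Section SecondDerivative.
Context {R : realType}.
Variables (T : R).
Hypothesis T0 : 0 < T.
Variables (sg S Sx Sy : R * R -> R) (m M Mx My Mt Mxx Mxy Myx Myy : R * R * R -> R).
Hypotheses (rS : reg1 sg S Sx Sy) (rM : reg21 T m M Mx My Mt Mxx Mxy Myx Myy)
  (Scst : constant_near_boundary sg).

(* Up to the boundary, where [sg] is constant and [sg m] inherits the regularity of [m]. *)
Lemma second_derivative_ext (a b t : R) (m1 m2 M2 : R * R * R -> R) : 0 < t < T ->
  (forall q, Q 0 T q -> derivable m q (a, b, 0)) ->
  m1 = 'D_(a, b, 0) m ->
  m2 = 'D_(a, b, 0) m1 -> Ext T m2 M2 ->
  has_continuous_second_derivative (Q 0 T) (a, b, 0) (fun q => sg q.1 * m q) ->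
  exists G : R * R -> R, cnt G /\
    forall p, Omega p -> G p = 'D_(a, b, 0) ('D_(a, b, 0) (fun q => sg q.1 * m q)) (p, t).
Proof.
move=> ht dm m1E m2E [cM2 _ M2E] hd.
set D2 := 'D_(a, b, 0) ('D_(a, b, 0) (fun q => sg q.1 * m q)) in hd *.
have Qt p : Omega p -> Q 0 T (p, t) by move=> hp; split.
(* On the boundary the expected value is used: near it [sg] is constant, so the second derivative of
   the product is [sg] times that of [m]. *)
pose h p := if p \in @Omega R then D2 (p, t) else S p * M2 (p, t).
suff ch : {within closure (@Omega R), continuous h}.
  exists (ext2 h); split; first exact: cnt_ext2.
  move=> p hp; rewrite ext2E; last exact: Omega_sq.
  by rewrite /h (mem_set hp).
apply/subspace_continuousP => p; rewrite closureOmega => hp.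
change (h @ within sq (nbhs p) --> h p).
have [Op|nOp] := pselect (Omega p).
  apply: cvg_within_filter; have -> : h p = D2 (p, t) by rewrite /h (mem_set Op).
  have [_ _ cD] := hd (p, t) (Qt p Op).
  have c1 : (fun p' => D2 (p', t)) @ p --> D2 (p, t).
    have c : cnt (fun p' : R * R => (p', t)) by cnt.
    exact: (@continuous_comp _ _ _ (fun p0 : R * R => (p0, t)) D2 p (@cnt_continuous _ _ _ c p) cD).
  apply: cvg_trans c1; apply: near_eq_cvg.
  by apply: filterS (open_nbhs_nbhs (conj (@open_Omega R) Op)) => z Oz /=; rewrite /h (mem_set Oz).
have bp : bOmega p by apply/bOmegaE.
have [kappa [k0 [U [oU bU cst]]]] := Scst.
have cM2t : cnt (fun p => kappa * M2 (p, t)) by cnt.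
have hE z : U z -> sq z -> h z = kappa * M2 (z, t).
  move=> Uz sz; rewrite /h; case: ifPn => [/set_mem Oz|].
    rewrite (M2E _ (Qt _ Oz)) /D2 m2E m1E.
    have oI : open (U `&` @Omega R) by apply: openI => //; exact: open_Omega.
    have nI := near_slice_Q oI (conj Uz Oz) (Qt _ Oz).
    have h1 : \forall q \near (z, t), 'D_(a, b, 0) (fun q => sg q.1 * m q) q = kappa * 'D_(a, b, 0) m q.
      apply: filterS nI => q [[Uq Oq] Qq].
      rewrite (@near_eq_derive _ _ _ _ (fun q => kappa *: m q)); first by rewrite deriveZ //; exact: dm.
      move: q Uq Oq Qq => [q1 q2] Uq Oq Qq.
      apply: filterS (near_slice_Q oI (conj Uq Oq) Qq) => y [[Uy Oy] _].
      by rewrite cst // closureOmega; exact: Omega_sq.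
    rewrite (near_eq_derive _ h1).
    have [k1|k1] := eqVneq kappa 0; first by rewrite k1 ltxx in k0.
    have [ddm|nddm] := pselect (derivable ('D_(a, b, 0) m) (z, t) (a, b, 0)).
      by rewrite [LHS](@deriveZ _ _ _ ('D_(a, b, 0) m) kappa).
    (* Differentiability of the first derivative of [m] is recovered from that of [sg] times [m] on
       dividing by the positive constant [kappa]. *)
    have [_ dd2 _] := hd (z, t) (Qt _ Oz); exfalso; apply: nddm.
    have h2 : derivable (fun q => kappa *: 'D_(a, b, 0) m q) (z, t) (a, b, 0).
      exact: (near_eq_derivable h1 dd2).
    have := @derivableZ _ _ _ _ kappa^-1 _ _ h2.
    rewrite (_ : kappa^-1 \*: _ = 'D_(a, b, 0) m) //.
    by apply/funext => q /=; rewrite scalerA mulVf ?scale1r.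
  move=> _; congr (_ * _); rewrite (reg1_sq rS) //; apply: cst => //.
  by rewrite closureOmega.
rewrite hE //; last exact: bU.
have c1 : (fun p => kappa * M2 (p, t)) @ within sq (nbhs p) --> kappa * M2 (p, t).
  by apply: cvg_within_filter; exact: (@cnt_continuous _ _ _ cM2t p).
apply: cvg_trans c1; apply: near_eq_cvg; rewrite near_withinE.
by apply: filterS (open_nbhs_nbhs (conj oU (bU _ bp))) => z Uz sz /=; rewrite hE.
Qed.
End SecondDerivative.

(** * The weak form of the Fokker-Planck equation *)

Section Products.
Context {R : realType}.
Variable T : R.
Hypothesis T0 : 0 < T.

(** The sum is the first derivative of the product [sg m], so it is differentiable although [Sd]
    alone is merely continuous. *)
Lemma diffusion_flux (sg S Sd G : R * R -> R) (m M Md : R * R * R -> R) (a b t : R) : 0 < t < T ->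
  (forall p, Omega p -> derivable sg p (a, b)) -> Ext2 sg S -> Ext2 ('D_(a, b) sg) Sd ->
  (forall q, Q 0 T q -> derivable m q (a, b, 0)) -> Ext T m M -> Ext T ('D_(a, b, 0) m) Md ->
  has_continuous_second_derivative (Q 0 T) (a, b, 0) (fun q => sg q.1 * m q) ->
  (forall p, Omega p -> G p = 'D_(a, b, 0) ('D_(a, b, 0) (fun q => sg q.1 * m q)) (p, t)) ->
  forall p, Omega p -> is_derive p (a, b) (fun p => Sd p * M (p, t) + S p * Md (p, t)) (G p).
Proof.
move=> ht dsg [_ _ SE] [_ _ SdE] dm [_ _ ME] [_ _ MdE] hd GE p Op.
have Qt p' : Omega p' -> Q 0 T (p', t) by move=> hp; split.
have [_ d2 _] := hd _ (Qt _ Op); have h := slice_is_derive d2.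
rewrite GE //; apply: near_eq_is_derive h.
apply: filterS (open_nbhs_nbhs (conj (@open_Omega R) Op)) => z Oz.
have Qz := Qt _ Oz; rewrite SE // SdE // ME // MdE //.
have e : 'D_(a, b, 0) (fun q => sg q.1 * m q) (z, t) =
    sg z *: 'D_(a, b, 0) m (z, t) + m (z, t) *: 'D_(a, b) sg z.
  exact: (@deriveM _ _ (fun q : R * R * R => sg q.1) m (z, t) (a, b, 0) (dsg _ Oz) (dm _ Qz)).
by rewrite e addrC; congr (_ + _); rewrite [_ *: _]mulrC.
Qed.

Lemma advection_flux (ph P Pd : R * R -> R) (m M Md ud Ud Udd : R * R * R -> R) (a b t : R) : 0 < t < T ->
  (forall p, Omega p -> derivable ph p (a, b)) -> Ext2 ph P -> Ext2 ('D_(a, b) ph) Pd ->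
  (forall q, Q 0 T q -> derivable m q (a, b, 0)) -> Ext T m M -> Ext T ('D_(a, b, 0) m) Md ->
  (forall q, Q 0 T q -> derivable ud q (a, b, 0)) -> Ext T ud Ud -> Ext T ('D_(a, b, 0) ud) Udd ->
  forall p, Omega p -> 'D_(a, b, 0) (fun q => ph q.1 * m q * ud q) (p, t) =
    (Pd p * M (p, t) + P p * Md (p, t)) * Ud (p, t) + P p * M (p, t) * Udd (p, t).
Proof.
move=> ht dph [_ _ PE] [_ _ PdE] dm [_ _ ME] [_ _ MdE] du [_ _ UdE] [_ _ UddE] p Op.
have Qp : Q 0 T (p, t) by split.
rewrite PE // PdE // ME // MdE // UdE // UddE //.
have dpm : derivable (fun q : R * R * R => ph q.1 * m q) (p, t) (a, b, 0).
  by apply: (derivableM (f := fun q : R * R * R => ph q.1) (g := m)); [exact: dph|exact: dm].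
have e2 : 'D_(a, b, 0) (fun q => ph q.1 * m q) (p, t) =
    ph p *: 'D_(a, b, 0) m (p, t) + m (p, t) *: 'D_(a, b) ph p.
  exact: (@deriveM _ _ (fun q : R * R * R => ph q.1) m (p, t) (a, b, 0) (dph _ Op) (dm _ Qp)).
have e1 : 'D_(a, b, 0) (fun q => ph q.1 * m q * ud q) (p, t) =
    (ph p * m (p, t)) *: 'D_(a, b, 0) ud (p, t) + ud (p, t) *: 'D_(a, b, 0) (fun q => ph q.1 * m q) (p, t).
  exact: (@deriveM _ _ (fun q : R * R * R => ph q.1 * m q) ud (p, t) (a, b, 0) dpm (du _ Qp)).
rewrite e1 e2.
move: (ph p) (m (p, t)) (ud (p, t)) ('D_(a, b, 0) ud (p, t)) ('D_(a, b) ph p) ('D_(a, b, 0) m (p, t)).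
by move=> x1 x2 x3 x4 x5 x6; rewrite /GRing.scale /=; ring.
Qed.

Lemma fp_balance (k1 k2 k3 k4 k5 : R) : k1 - 2^-1 * k2 - 2^-1 * k3 + k4 + k5 = 0 ->
  k1 = 2^-1 * k2 - k4 + (2^-1 * k3 - k5).
Proof. by move=> h; lra. Qed.

End Products.

Ltac cnt_hook ::= first [simple apply cnt_tv | simple apply cnt_tx | simple apply cnt_ty | cnt_reg
  | lazymatch goal with |- cnt (fun t => J (fun p => @?F t p)) => apply: (cnt_Jt (F := F)) end].

Section WeakForm.
Context {R : realType}.
Variables (T : R) (d : mfg_data R) (u m : R * R * R -> R).
Variables (S1 S1x S1y S2 S2x S2y P1 P1x P1y P2 P2x P2y : R * R -> R).
Variables (U Ux Uy Ut Uxx Uxy Uyx Uyy M Mx My Mt Mxx Mxy Myx Myy : R * R * R -> R).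
Hypothesis T0 : 0 < T.
Hypotheses (rS1 : reg1 (sigma1sq d) S1 S1x S1y) (rS2 : reg1 (sigma2sq d) S2 S2x S2y)
  (rP1 : reg1 (phi1sq_a0 d) P1 P1x P1y) (rP2 : reg1 (phi2sq_b0 d) P2 P2x P2y)
  (ru : reg21 T u U Ux Uy Ut Uxx Uxy Uyx Uyy) (rm : reg21 T m M Mx My Mt Mxx Mxy Myx Myy)
  (cst1 : constant_near_boundary (sigma1sq d)) (cst2 : constant_near_boundary (sigma2sq d)).
Hypotheses (Ux0 : forall y t, 0 <= y <= 1 -> Ux (0, y, t) = 0)
  (Uy0 : forall x t, 0 <= x <= 1 -> Uy (x, 0, t) = 0)
  (Uy1 : forall x t, 0 <= x <= 1 -> Uy (x, 1, t) = 0)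
  (Mx0 : forall y t, 0 <= y <= 1 -> Mx (0, y, t) = 0)
  (My0 : forall x t, 0 <= x <= 1 -> My (x, 0, t) = 0)
  (My1 : forall x t, 0 <= x <= 1 -> My (x, 1, t) = 0).
Hypothesis fp : fp_equation T d u m.

Lemma bO_x0 (y : R) : 0 <= y <= 1 -> bOmega ((0, y) : R * R).
Proof. by move=> hy; apply/bOmegaE; split; [split => //=; rewrite lexx ler01|move=> [/=]; rewrite ltxx]. Qed.
Lemma bO_y0 (x : R) : 0 <= x <= 1 -> bOmega ((x, 0) : R * R).
Proof. by move=> hy; apply/bOmegaE; split; [split => //=; rewrite lexx ler01|move=> [/= _]; rewrite ltxx]. Qed.
Lemma bO_y1 (x : R) : 0 <= x <= 1 -> bOmega ((x, 1) : R * R).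
Proof. by move=> hy; apply/bOmegaE; split; [split => //=; rewrite lexx ler01|move=> [/= _]; rewrite ltxx andbF]. Qed.
Lemma bO_x1 (y : R) : 0 <= y <= 1 -> bOmega ((1, y) : R * R).
Proof. by move=> hy; apply/bOmegaE; split; [split => //=; rewrite lexx ler01|move=> [/=]; rewrite ltxx andbF]. Qed.

(** The equation is a divergence of fluxes up to the boundary, and integration by parts meets no
    boundary term. The part of the diffusion flux that carries a derivative of sigma^2 is moved to
    the right side, so that the form [aform] is symmetric. *)
Lemma weak_form (s : test R) t : 0 < t < T ->
  J (fun p => Mt (p, t) * tv s p) =
  - J (fun p => 2^-1 * S1 p * (Mx (p, t) * tx s p) + 2^-1 * S2 p * (My (p, t) * ty s p))
  + J (fun p => (P1 p * M (p, t) * Ux (p, t) - 2^-1 * S1x p * M (p, t)) * tx s p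
              + (P2 p * M (p, t) * Uy (p, t) - 2^-1 * S2y p * M (p, t)) * ty s p).
Proof.
move=> ht; have [hd1 hd2 eq] := fp.
have [G1 [cG1 G1E]] := second_derivative_ext rS1 cst1 ht (reg_derx rm) erefl erefl (reg_xx rm) hd1.
have [G2 [cG2 G2E]] := second_derivative_ext rS2 cst2 ht (reg_dery rm) erefl erefl (reg_yy rm) hd2.
have [_ _ MtE] := reg_t rm.
have cv := cnt_tv s; have cx := cnt_tx s; have cy := cnt_ty s.
pose K1 p := S1x p * M (p, t) + S1 p * Mx (p, t).
pose K2 p := S2y p * M (p, t) + S2 p * My (p, t).
have cK1 : cnt K1 by rewrite /K1; cnt.
have cK2 : cnt K2 by rewrite /K2; cnt.
have dK1 : dX K1 G1.
  apply: Omega_dX => // p Op.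
  exact: (diffusion_flux ht (reg1_derx rS1) (reg1_0 rS1) (reg1_x rS1) (reg_derx rm) (reg_0 rm) (reg_x rm) hd1 G1E Op).
have dK2 : dY K2 G2.
  apply: Omega_dY => // p Op.
  exact: (diffusion_flux ht (reg1_dery rS2) (reg1_0 rS2) (reg1_y rS2) (reg_dery rm) (reg_0 rm) (reg_y rm) hd2 G2E Op).
pose A1 p := P1 p * M (p, t) * Ux (p, t).
pose A1x p := (P1x p * M (p, t) + P1 p * Mx (p, t)) * Ux (p, t) + P1 p * M (p, t) * Uxx (p, t).
pose A2 p := P2 p * M (p, t) * Uy (p, t).
pose A2y p := (P2y p * M (p, t) + P2 p * My (p, t)) * Uy (p, t) + P2 p * M (p, t) * Uyy (p, t).
have cA1 : cnt A1 by rewrite /A1; cnt.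
have cA2 : cnt A2 by rewrite /A2; cnt.
have cA1x : cnt A1x by rewrite /A1x; cnt.
have cA2y : cnt A2y by rewrite /A2y; cnt.
have dA1 : dX A1 A1x by exact: (dXM (dXM (reg1_dx rP1) (reg_dx rm t)) (reg_dxx ru t)).
have dA2 : dY A2 A2y by exact: (dYM (dYM (reg1_dy rP2) (reg_dy rm t)) (reg_dyy ru t)).
pose f1 p := 2^-1 * K1 p - A1 p; pose f1x p := 2^-1 * G1 p - A1x p.
pose f2 p := 2^-1 * K2 p - A2 p; pose f2y p := 2^-1 * G2 p - A2y p.
have cf1 : cnt f1 by rewrite /f1; cnt.
have cf2 : cnt f2 by rewrite /f2; cnt.
have cf1x : cnt f1x by rewrite /f1x; cnt.
have cf2y : cnt f2y by rewrite /f2y; cnt.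
have df1 : dX f1 f1x by exact: (dXB (dXZ 2^-1 dK1) dA1).
have df2 : dY f2 f2y by exact: (dYB (dYZ 2^-1 dK2) dA2).
have E1 : J (fun p => Mt (p, t) * tv s p) = J (fun p => f1x p * tv s p) + J (fun p => f2y p * tv s p).
  rewrite -JD; [|cnt|cnt]; apply: eq_J_oo; [cnt|cnt|move=> x y hx hy].
  have Op : Omega (x, y) by split.
  have Qp : Q 0 T (x, y, t) by split.
  have := eq _ Qp; rewrite -/(sigma1sq d) -mulrDl; move=> e.
  congr (_ * _); rewrite MtE // /f1x /f2y G1E // G2E //.
  have a1 := advection_flux ht (reg1_derx rP1) (reg1_0 rP1) (reg1_x rP1) (reg_derx rm) (reg_0 rm) (reg_x rm) (reg_derxx ru) (reg_x ru) (reg_xx ru) Op.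
  have a2 := advection_flux ht (reg1_dery rP2) (reg1_0 rP2) (reg1_y rP2) (reg_dery rm) (reg_0 rm) (reg_y rm) (reg_deryy ru) (reg_y ru) (reg_yy ru) Op.
  rewrite -/(A1x (x, y)) in a1; rewrite -/(A2y (x, y)) in a2.
  rewrite -a1 -a2.
  exact: (fp_balance e).
have E2 : J (fun p => f1x p * tv s p) = - J (fun p => f1 p * tx s p).
  apply: IBPx => //; [exact: dX_t|move=> y hy].
  rewrite tv1 // mulr0 /f1 /K1 /A1 Mx0 // Ux0 //.
  (* At x = 1 the test function vanishes; at x = 0 the flux does, by the Neumann conditions and
     because sigma^2 is constant there. *)
  by rewrite (near_boundary_derive cst1 (reg1_x rS1) (bO_x0 hy)) !mul0r !mulr0 addr0 subr0 mulr0 mul0r.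
have E3 : J (fun p => f2y p * tv s p) = - J (fun p => f2 p * ty s p).
  apply: IBPy => //; [exact: dY_t|move=> x hx].
  rewrite /f2 /K2 /A2 My0 // My1 // Uy0 // Uy1 //.
  rewrite (near_boundary_derive cst2 (reg1_y rS2) (bO_y0 hx)) (near_boundary_derive cst2 (reg1_y rS2) (bO_y1 hx)).
  by rewrite !mul0r !mulr0 addr0 subr0 mulr0 !mul0r.
rewrite E1 E2 E3 -!JN; [|cnt|cnt|cnt]; rewrite -JD; [|cnt|cnt]; rewrite -JD; [|cnt|cnt].
apply: eq_J => x y _ _; rewrite /f1 /f2 /K1 /K2 /A1 /A2; ring.
Qed.

End WeakForm.

(** * Boundary conditions and bounds *)

Section Boundary.
Context {R : realType}.
Variables (T : R) (w W Wx Wy Wt Wxx Wxy Wyx Wyy : R * R * R -> R).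
Hypothesis T0 : 0 < T.
Hypothesis rw : reg21 T w W Wx Wy Wt Wxx Wxy Wyx Wyy.

Lemma cl_bounds (t : R) : 0 <= cl T t <= T.
Proof. by apply: cl_in; exact: ltW. Qed.

Lemma face_zero_cl (f F : R * R * R -> R) (k : R -> R * R) : Ext T f F -> cnt k ->
  (forall y t, 0 < y < 1 -> 0 < t < T -> F (k y, t) = 0) ->
  forall y t, 0 <= y <= 1 -> F (k y, t) = 0.
Proof.
move=> eF ck h y t hy; have [cF _ _] := eF; rewrite (Ext_cl T0 eF).
apply: (@face_zero R T T0 (fun z => F (k z.1, z.2))) => //; first by cnt.
exact: cl_bounds.
Qed.

Lemma pair_subZ (a b c d h : R) : (a, b) - h *: (c, d) = (a - h * c, b - h * d).
Proof. by []. Qed.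

Section Neumann.
Hypothesis N : forall p nu t, Gamma1 p -> outward_normal p nu -> 0 < t < T ->
  normal_derivative_is (slice w t) p nu 0.

Lemma Wbox (x y t : R) : 0 <= x <= 1 -> 0 <= y <= 1 -> 0 < t < T -> W (x, y, t) = w (x, y, t).
Proof. by move=> hx hy ht; apply: (reg_box rw); split => //; exact: oo_cc. Qed.

Lemma hin (h : R) : 0 < h <= 1 -> 0 <= h <= 1 /\ 0 <= 1 - h <= 1.
Proof. by move=> /andP[h0 h1]; rewrite (ltW h0) h1 subr_ge0 h1 gerBl (ltW h0). Qed.

Let i0 : 0 <= (0 : R) <= 1. Proof. by rewrite lexx ler01. Qed.
Let i1 : 0 <= (1 : R) <= 1. Proof. by rewrite lexx ler01. Qed.

Lemma neumann_x0 y t : 0 <= y <= 1 -> Wx (0, y, t) = 0.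
Proof.
move: y t; apply: (face_zero_cl (k := fun y => (0, y)) (reg_x rw)); first by cnt.
move=> y t hy ht; have hy' := oo_cc hy.
have [cW _ _] := reg_0 rw; have [cWx _ _] := reg_x rw.
have nG : Gamma1 ((0, y) : R * R).
  by split; [exact: bO_x0|move=> [_ /= /esym/eqP]; rewrite oner_eq0].
have on : outward_normal ((0, y) : R * R) (-1, 0) by apply: Or41.
apply: (neumann0 (f := fun x => W (x, y, t)) (df := fun x => Wx (x, y, t)) _ _ _ _ (N nG on ht)); [cnt|cnt| |].
- by move=> z hz; exact: (reg_dx rw t hz hy').
- move=> h hh; have [h1 _] := hin hh; rewrite !Wbox // /slice; congr (_ / _); congr (_ - _); congr w.
  by rewrite pair_subZ; congr (_, _, _); ring.
Qed.

Lemma neumann_y0 x t : 0 <= x <= 1 -> Wy (x, 0, t) = 0.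
Proof.
move: x t; apply: (face_zero_cl (k := fun x => (x, 0)) (reg_y rw)); first by cnt.
move=> x t hx ht; have hx' := oo_cc hx.
have [cW _ _] := reg_0 rw; have [cWx _ _] := reg_y rw.
have nG : Gamma1 ((x, 0) : R * R).
  by split; [exact: bO_y0|move=> [_ /= x1]; rewrite x1 ltxx andbF in hx].
have on : outward_normal ((x, 0) : R * R) (0, -1) by apply: Or43.
apply: (neumann0 (f := fun y => W (x, y, t)) (df := fun y => Wy (x, y, t)) _ _ _ _ (N nG on ht)); [cnt|cnt| |].
- by move=> z hz; exact: (reg_dy rw t hx' hz).
- move=> h hh; have [h1 _] := hin hh; rewrite !Wbox // /slice; congr (_ / _); congr (_ - _); congr w.
  by rewrite pair_subZ; congr (_, _, _); ring.
Qed.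

Lemma neumann_y1 x t : 0 <= x <= 1 -> Wy (x, 1, t) = 0.
Proof.
move: x t; apply: (face_zero_cl (k := fun x => (x, 1)) (reg_y rw)); first by cnt.
move=> x t hx ht; have hx' := oo_cc hx.
have [cW _ _] := reg_0 rw; have [cWx _ _] := reg_y rw.
have nG : Gamma1 ((x, 1) : R * R).
  by split; [exact: bO_y1|move=> [_ /= x1]; rewrite x1 ltxx andbF in hx].
have on : outward_normal ((x, 1) : R * R) (0, 1) by apply: Or44.
apply: (neumann1 (f := fun y => W (x, y, t)) (df := fun y => Wy (x, y, t)) _ _ _ _ (N nG on ht)); [cnt|cnt| |].
- by move=> z hz; exact: (reg_dy rw t hx' hz).
- move=> h hh; have [_ h1] := hin hh; rewrite !Wbox // /slice; congr (_ / _); congr (_ - _); congr w.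
  by rewrite pair_subZ; congr (_, _, _); ring.
Qed.

End Neumann.

Lemma Gamma0_x1 (y : R) : 0 <= y <= 1 -> Gamma0 ((1, y) : R * R).
Proof. by move=> hy; split => //; exact: bO_x1. Qed.

End Boundary.

Lemma dirichlet_x1 (R : realType) (T : R) w W Wx Wy Wt Wxx Wxy Wyx Wyy v V Vx Vy Vt Vxx Vxy Vyx Vyy :
  0 < T -> reg21 T w W Wx Wy Wt Wxx Wxy Wyx Wyy -> reg21 T v V Vx Vy Vt Vxx Vxy Vyx Vyy ->
  (forall p t, Gamma0 p -> 0 < t < T -> w (p, t) = v (p, t)) ->
  forall y t, 0 <= y <= 1 -> W (1, y, t) - V (1, y, t) = 0.
Proof.
move=> T0 rw rv h y t hy; rewrite (Ext_cl T0 (reg_0 rw)) (Ext_cl T0 (reg_0 rv)).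
have [cW _ _] := reg_0 rw; have [cV _ _] := reg_0 rv.
apply: (@face_zero R T T0 (fun z => W (1, z.1, z.2) - V (1, z.1, z.2))) => //; first by cnt.
  move=> y' t' hy' ht'; have i1 : 0 <= (1 : R) <= 1 by rewrite lexx ler01.
  rewrite /= (Wbox rw i1 (oo_cc hy') ht') (Wbox rv i1 (oo_cc hy') ht') h ?subrr //.
  by apply: Gamma0_x1; exact: oo_cc.
exact: cl_bounds.
Qed.

Section Bounds.
Context {R : realType}.

Lemma sup_norm_le (U : Type) (A : set U) (f : U -> R) (M : R) p :
  (sup_norm A f <= M%:E)%E -> A p -> `|f p| <= M.
Proof.
by move=> h Ap; rewrite -lee_fin; apply: le_trans h; apply: ereal_sup_ubound; exists p.
Qed.
Lemma sup_norm_ge0 (U : Type) (A : set U) (f : U -> R) p : A p -> (0 <= sup_norm A f)%E.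
Proof.
move=> Ap; apply: (@le_trans _ _ `|f p|%:E); first by rewrite lee_fin.
by apply: ereal_sup_ubound; exists p.
Qed.

Lemma C1_norm_le (A : set (R * R)) (v : R * R -> R) (M : R) p : A p ->
  (C1_norm A v <= M%:E)%E -> [/\ `|v p| <= M, `|dx v p| <= M & `|dy v p| <= M].
Proof.
move=> Ap h; have g f := @sup_norm_ge0 _ A f p Ap.
split; apply: (sup_norm_le _ Ap); apply: le_trans h; rewrite /C1_norm.
- by rewrite -addeA leeDl // adde_ge0.
- by rewrite addeAC leeDr // adde_ge0.
- by rewrite leeDr // adde_ge0.
Qed.
Lemma C2_norm_le (A : set (R * R)) (v : R * R -> R) (M : R) p : A p ->
  (C2_norm A v <= M%:E)%E -> (C1_norm A v <= M%:E)%E.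
Proof.
move=> Ap h; have g f := @sup_norm_ge0 _ A f p Ap.
apply: le_trans h; rewrite /C2_norm -[leRHS]addeA -[leRHS]addeA leeDl //.
by rewrite !adde_ge0.
Qed.

Lemma Ext_bound (T : R) (f F : R * R * R -> R) (M : R) : 0 < T -> Ext T f F ->
  (forall q, Q 0 T q -> `|f q| <= M) -> forall q, `|F q| <= M.
Proof.
move=> T0 [cF Fcl FE] h q; rewrite Fcl -subr_le0.
have c : cnt (fun q => `|F q| - M) by cnt.
apply: (box_le T0 c).
  by move=> z Qz; rewrite FE // subr_le0; exact: h.
by split; apply: cl_in => //; exact: ltW.
Qed.
Lemma Ext2_bound (f F : R * R -> R) (M : R) : Ext2 f F ->
  (forall q, Omega q -> `|f q| <= M) -> forall q, `|F q| <= M.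
Proof.
move=> [cF Fcl FE] h q; rewrite Fcl -subr_le0.
have c : cnt (fun q => `|F q| - M) by cnt.
apply: (sq_le c).
  by move=> z Qz; rewrite FE // subr_le0; exact: h.
by split; apply: cl_in.
Qed.

Lemma slice_dx (w : R * R * R -> R) p t : derivable w (p, t) (1, 0, 0) ->
  dx (slice w t) p = pdx w (p, t).
Proof. by move=> /slice_is_derive[_ h]; exact: h. Qed.
Lemma slice_dy (w : R * R * R -> R) p t : derivable w (p, t) (0, 1, 0) ->
  dy (slice w t) p = pdy w (p, t).
Proof. by move=> /slice_is_derive[_ h]; exact: h. Qed.

Lemma reg21_bound (T M : R) w W Wx Wy Wt Wxx Wxy Wyx Wyy : 0 < T ->
  reg21 T w W Wx Wy Wt Wxx Wxy Wyx Wyy ->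
  (forall t, 0 <= t <= T -> (C1_norm (@Omega R) (slice w t) <= M%:E)%E) ->
  forall q, [/\ `|W q| <= M, `|Wx q| <= M & `|Wy q| <= M].
Proof.
move=> T0 rw h q.
have H z : Q 0 T z -> [/\ `|w z| <= M, `|pdx w z| <= M & `|pdy w z| <= M].
  case: z => [p t] Qz; have [Op ht] := Qz.
  have := C1_norm_le Op (h t (oo_cc ht)).
  by rewrite (slice_dx (reg_derx rw Qz)) (slice_dy (reg_dery rw Qz)).
split; [apply: (Ext_bound T0 (reg_0 rw))|apply: (Ext_bound T0 (reg_x rw))|apply: (Ext_bound T0 (reg_y rw))];
  by move=> z /H[].
Qed.

Lemma reg1_bound (M : R) v V Vx Vy : reg1 v V Vx Vy -> (C1_norm (@Omega R) v <= M%:E)%E ->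
  forall p, [/\ `|V p| <= M, `|Vx p| <= M & `|Vy p| <= M].
Proof.
move=> rv h p; have H z : Omega z -> [/\ `|v z| <= M, `|dx v z| <= M & `|dy v z| <= M].
  by move=> Oz; exact: C1_norm_le Oz h.
split; [apply: (Ext2_bound (reg1_0 rv))|apply: (Ext2_bound (reg1_x rv))|apply: (Ext2_bound (reg1_y rv))];
  by move=> z /H[].
Qed.

Lemma reg1_ge (s : R) v V Vx Vy : reg1 v V Vx Vy ->
  (forall p, closure (@Omega R) p -> s <= v p) -> forall p, s <= V p.
Proof.
move=> rv h p; have [_ Vcl _] := reg1_0 rv; rewrite Vcl (reg1_sq rv).
  by apply: h; rewrite closureOmega; split; apply: cl_in.
by split; apply: cl_in.
Qed.

Lemma Zbound (T M1 : R) u m : in_Z T M1 u m -> forall t, 0 <= t <= T ->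
  (C1_norm (@Omega R) (slice u t) <= M1%:E)%E /\ (C1_norm (@Omega R) (slice m t) <= M1%:E)%E.
Proof.
move=> [_ [h1 h2 _]] t ht.
have it : [set` `[0, T]%R] t by rewrite /= in_itv.
have O2 : @Omega R mid2 by have := @path2 R mid2 1; rewrite subrr scale0r add0r scale1r; apply; [split|]; rewrite /=; lra.
split.
  apply: (C2_norm_le O2); apply: le_trans h1; apply: ereal_sup_ubound; by exists t.
by apply: le_trans h2; apply: ereal_sup_ubound; exists t.
Qed.

End Bounds.

(** * The difference of two solutions *)

Section Marginals.
Context {R : realType}.

Lemma J_marginal_x (f : R * R -> R) : cnt f ->
  J (fun p => itg 0 1 (fun x => f (x, p.2))) = J f.
Proof.
move=> cf; rewrite (J_swap cf) -(@J_marginal_y R (fun p => f (p.2, p.1))); last by cnt.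
have c : cnt (fun y => itg 0 1 (fun x => f (x, y))).
  by apply: (cnt_itg (F := fun z : R * R => f (z.2, z.1))) => //; cnt.
have c2 : cnt (fun p : R * R => p.2) by cnt.
by rewrite (J_swap (cnt_comp c c2)).
Qed.

(** Nonnegativity of the variance of |h| on an interval of length 1. *)
Lemma itg_abs_sqr (h : R -> R) : cnt h ->
  itg 0 1 (fun y => `|h y|) ^+ 2 <= itg 0 1 (fun y => h y ^+ 2).
Proof.
move=> ch; set c := itg _ _ _.
have : 0 <= itg 0 1 (fun y => (`|h y| - c) ^+ 2) by apply: itg_ge0 => y _; exact: sqr_ge0.
rewrite (eq_itg (g := fun y => h y ^+ 2 + ((- 2 * c) * `|h y| + c ^+ 2))); last first.
  by move=> y _; rewrite sqrrB real_normK ?num_real //; ring.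
rewrite itgD; [|cnt|cnt]; rewrite itgD; [|cnt|cnt]; rewrite itgZ; last by cnt.
rewrite -/c itg_cst // subr0 mulr1; move: (itg _ _ _) => X; nra.
Qed.

(** Written over the common factor 1 / (eps + A), the difference has the numerator (b - b') minus
    the second barycenter times (A - A'). That barycenter lies in [0, 1], so the bound is
    independent of the masses, and [eps] bounds the denominator from below. *)
Lemma barycenter_diff (eps : R) (f g : R -> R) : 0 < eps -> cnt f -> cnt g ->
  (forall y, 0 <= y <= 1 -> 0 <= f y) -> (forall y, 0 <= y <= 1 -> 0 <= g y) ->
  `|(eps + itg 0 1 f)^-1 * itg 0 1 (fun y => y * f y) - (eps + itg 0 1 g)^-1 * itg 0 1 (fun y => y * g y)|
  <= 2 / eps * itg 0 1 (fun y => `|f y - g y|).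
Proof.
move=> e0 cf cg f0 g0.
set A := itg 0 1 f; set A' := itg 0 1 g; set b := itg 0 1 (fun y => y * f y); set b' := itg 0 1 (fun y => y * g y).
set N := itg 0 1 _.
have hA : 0 <= A by exact: itg_ge0.
have hA' : 0 <= A' by exact: itg_ge0.
have hb' : 0 <= b' by apply: itg_ge0 => y hy; rewrite mulr_ge0 ?g0 //; case/andP: hy.
have hb'A : b' <= A'.
  by apply: itg_le; [cnt|cnt|move=> y hy; rewrite ler_piMl ?g0 //; case/andP: hy].
have dA : `|A - A'| <= N.
  by rewrite /A /A' -itgB //; apply: itg_abs; cnt.
have db : `|b - b'| <= N.
  rewrite /b /b' -itgB; [|cnt|cnt].
  apply: le_trans (itg_abs _ _ _) _; first by cnt.
  apply: itg_le; [cnt|cnt|move=> y /andP[y0 y1]].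
  by rewrite -mulrBr normrM ger0_norm // ler_piMl.
have eA : 0 < eps + A by rewrite ltr_pwDl.
have eA' : 0 < eps + A' by rewrite ltr_pwDl.
have -> : (eps + A)^-1 * b - (eps + A')^-1 * b' =
   (eps + A)^-1 * ((b - b') - (b' / (eps + A')) * (A - A')).
  by field; rewrite !lt0r_neq0.
have r1 : 0 <= b' / (eps + A') <= 1.
  by rewrite divr_ge0 ?(ltW eA') //= ler_pdivrMr // mul1r (le_trans hb'A) // lerDr ltW.
have h : `|(b - b') - (b' / (eps + A')) * (A - A')| <= 2 * N.
  apply: le_trans (ler_normB _ _) _; rewrite mulr2n mulrDl mul1r; apply: lerD => //.
  rewrite normrM; case/andP: r1 => r0 r1; rewrite (ger0_norm r0).
  by apply: le_trans dA; rewrite ler_piMl.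
rewrite normrM normfV (gtr0_norm eA) [2 / eps]mulrC -[leRHS]mulrA.
apply: ler_pM h; rewrite ?invr_ge0 ?(ltW eA) ?normr_ge0 //.
by rewrite lef_pV2 ?posrE // lerDl.
Qed.

Lemma line_lipschitz (k dk : R -> R) (D : R) : (forall x, is_derive (x : R) (1 : R) k (dk x)) ->
  (forall x, `|dk x| <= D) -> forall a b, `|k a - k b| <= D * `|a - b|.
Proof.
move=> hd hD; have ord a b : a <= b -> `|k b - k a| <= D * `|b - a|.
  move=> ab; have ck : {within `[a, b], continuous k}.
    by apply: derivable_within_continuous => x _; have [h _] := hd x.
  by have [c _ ->] := @MVT_segment R k dk a b ab (fun x _ => hd x) ck; rewrite normrM ler_wpM2r.
move=> a b; have [ab|/ltW ab] := leP b a; first exact: ord.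
by rewrite distrC [`|a - b|]distrC; exact: ord.
Qed.

Lemma C1_lipschitz (g : R * R -> R) (D : R) : C1 setT g -> (C1_norm setT g <= D%:E)%E ->
  forall a b a' b', `|g (a, b) - g (a', b')| <= D * `|a - a'| + D * `|b - b'|.
Proof.
move=> [_ [d1 _] [d2 _]] hD a b a' b'.
have nD p : [/\ `|g p| <= D, `|dx g p| <= D & `|dy g p| <= D] by exact: C1_norm_le I hD.
have e1 y x : is_derive (x : R) (1 : R) (fun z => g (z, y)) (dx g (x, y)).
  have E : (fun h : R => h^-1 *: ((fun z => g (z, y)) (h *: 1 + x) - g (x, y))) =
     (fun h : R => h^-1 *: (g (h *: (1, 0) + (x, y)) - g (x, y))).
    apply/funext => h; congr (_ *: (g _ - _)).
    by apply/pair_equal_spec; split => //=; rewrite [_ *: _]mulr0 add0r.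
  by apply: DeriveDef; [rewrite /derivable E; exact: d1|rewrite /derive E].
have e2 x y : is_derive (y : R) (1 : R) (fun z => g (x, z)) (dy g (x, y)).
  have E : (fun h : R => h^-1 *: ((fun z => g (x, z)) (h *: 1 + y) - g (x, y))) =
     (fun h : R => h^-1 *: (g (h *: (0, 1) + (x, y)) - g (x, y))).
    apply/funext => h; congr (_ *: (g _ - _)).
    by apply/pair_equal_spec; split => //=; rewrite [_ *: _]mulr0 add0r.
  by apply: DeriveDef; [rewrite /derivable E; exact: d2|rewrite /derive E].
have -> : g (a, b) - g (a', b') = (g (a, b) - g (a', b)) + (g (a', b) - g (a', b')) by rewrite addrA subrK.
apply: le_trans (ler_normD _ _) _; apply: lerD.
  by apply: (line_lipschitz (e1 b)) => x; have [] := nD (x, b).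
by apply: (line_lipschitz (e2 a')) => x; have [] := nD (a', x).
Qed.

End Marginals.

(** The quadratic terms are linearised by u_x^2 - v_x^2 = (u_x + v_x)(u_x - v_x). *)
Lemma hjb_balance (R : realFieldType) (a0 b0 f1 f2 s1 s2 ut uxx uyy ux uy vt vxx vyy vx vy c gu gv : R) :
  a0 != 0 -> b0 != 0 ->
  ut + s1 / 2 * uxx + s2 / 2 * uyy - (f1 / (2 * a0) * ux ^+ 2 + f2 / (2 * b0) * uy ^+ 2) - c + gu = 0 ->
  vt + s1 / 2 * vxx + s2 / 2 * vyy - (f1 / (2 * a0) * vx ^+ 2 + f2 / (2 * b0) * vy ^+ 2) - c + gv = 0 ->
  (ut - vt) + 2^-1 * s1 * (uxx - vxx) + 2^-1 * s2 * (uyy - vyy) =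
  f1 / a0 * (2^-1 * (ux + vx)) * (ux - vx) + f2 / b0 * (2^-1 * (uy + vy)) * (uy - vy) - (gu - gv).
Proof.
move=> a00 b00 e1 e2; apply/eqP; rewrite -subr_eq0; apply/eqP.
rewrite -[RHS]subr0 -[X in _ = X - _]e1 -[X in _ = _ - X]e2.
by field; rewrite a00 b00.
Qed.

Lemma sqr4_le (R : realFieldType) (z a b c d : R) : `|z| <= a + b + (c + d) ->
  z ^+ 2 <= 4 * (a ^+ 2 + b ^+ 2) + 4 * (c ^+ 2 + d ^+ 2).
Proof.
move=> h; have h0 := le_trans (normr_ge0 z) h.
have h1 : z ^+ 2 <= (a + b + (c + d)) ^+ 2.
  by rewrite -(real_normK (num_real z)); apply: lerXn2r => //; rewrite nnegrE.
apply: le_trans h1 _.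
have := sqr_ge0 (a - b); have := sqr_ge0 (c - d); have := sqr_ge0 (a + b - (c + d)); nra.
Qed.

Lemma flux_sqr_le (R : realFieldType) (D K P S m wx h vx : R) : 0 <= D -> 0 <= K ->
  `|P| <= D -> `|S| <= D -> `|m| <= K -> `|vx| <= K ->
  (P * (m * wx + h * vx) - 2^-1 * S * h) ^+ 2 <= 4 * D ^+ 2 * K ^+ 2 * wx ^+ 2 + (4 * D ^+ 2 * K ^+ 2 + 4 * D ^+ 2) * h ^+ 2.
Proof.
move=> D0 K0 hP hS hm hv.
have h1 : `|P * (m * wx + h * vx) - 2^-1 * S * h| <= D * K * `|wx| + D * K * `|h| + (D * `|h| + 0).
  rewrite addr0 mulrDr; apply: le_trans (ler_normB _ _) _; apply: lerD.
    apply: le_trans (ler_normD _ _) _; apply: lerD.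
      rewrite !normrM -mulrA; by rewrite !ler_pM ?mulr_ge0.
    rewrite !normrM [`|h| * _]mulrC -mulrA; by rewrite !ler_pM ?mulr_ge0.
  rewrite !normrM; apply: ler_pM; rewrite ?mulr_ge0 //.
  have : `|2^-1 : R| * `|S| <= 1 * D.
    by apply: ler_pM => //; rewrite ger0_norm ?invr_ge0 // invf_le1 // ler1n.
  by rewrite mul1r.
apply: le_trans (sqr4_le h1) _.
rewrite !exprMn !real_normK ?num_real //; rewrite expr0n /= addr0.
by rewrite le_eqVlt; apply/orP; left; apply/eqP; ring.
Qed.

(** One constant for three purposes: [D] bounds the coefficients, and the remaining terms dominate
    the constants of [source_combine] and [flux_combine]. *)
Definition source_bound (R : realType) (D K eps : R) : R :=
  D + 8 * D ^+ 2 * K ^+ 2 + 8 * D ^+ 2 + 32 * D ^+ 2 / eps ^+ 2.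

Lemma source_combine (R : realType) (D K eps q G : R) : 0 <= q -> 0 <= G -> 0 < D ->
  4 * (D * K) ^+ 2 * G + 4 * (D * (2 / eps)) ^+ 2 * (q + q) <= source_bound D K eps * (q + G).
Proof.
move=> q0 G0 D0; rewrite -subr_ge0.
have -> : source_bound D K eps * (q + G) - (4 * (D * K) ^+ 2 * G + 4 * (D * (2 / eps)) ^+ 2 * (q + q)) =
  (D + 8 * D ^+ 2) * (q + G) + 8 * (D * K) ^+ 2 * q + 4 * (D * K) ^+ 2 * G + 32 * (D * eps^-1) ^+ 2 * G.
  by rewrite /source_bound -exprVn; ring.
have h := sqr_ge0 (D * K); have h2 := sqr_ge0 (D * eps^-1); have h3 := sqr_ge0 D.
have h4 : 0 <= D + 8 * D ^+ 2 by rewrite addr_ge0 ?mulr_ge0 // ltW.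
have h5 := mulr_ge0 h4 (addr_ge0 q0 G0); have h6 := mulr_ge0 h q0; have h7 := mulr_ge0 h G0; have h8 := mulr_ge0 h2 G0.
clear -h5 h6 h7 h8; nra.
Qed.

Lemma flux_combine (R : realType) (D K eps q G : R) : 0 <= q -> 0 <= G -> 0 < D ->
  4 * D ^+ 2 * K ^+ 2 * G + 2 * (4 * D ^+ 2 * K ^+ 2 + 4 * D ^+ 2) * q <= source_bound D K eps * (q + G).
Proof.
move=> q0 G0 D0; rewrite -subr_ge0.
have -> : source_bound D K eps * (q + G) - (4 * D ^+ 2 * K ^+ 2 * G + 2 * (4 * D ^+ 2 * K ^+ 2 + 4 * D ^+ 2) * q) =
  D * (q + G) + 8 * D ^+ 2 * G + 4 * (D * K) ^+ 2 * G + 32 * (D * eps^-1) ^+ 2 * (q + G).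
  by rewrite /source_bound -exprVn; ring.
have h := sqr_ge0 (D * K); have h2 := sqr_ge0 (D * eps^-1); have h3 := sqr_ge0 D.
have h4 : 0 <= q + G by rewrite addr_ge0.
have h5 := mulr_ge0 (ltW D0) h4; have h6 := mulr_ge0 h3 G0; have h7 := mulr_ge0 h G0; have h8 := mulr_ge0 h2 h4.
clear -h5 h6 h7 h8; nra.
Qed.

Lemma source_bound_ge (R : realType) (K eps D : R) : D <= source_bound D K eps.
Proof.
have h1 := sqr_ge0 (D * K); have h2 := sqr_ge0 (D * eps^-1); have h3 := sqr_ge0 D.
have -> : source_bound D K eps = D + (8 * (D * K) ^+ 2 + 8 * D ^+ 2 + 32 * (D * eps^-1) ^+ 2).
  by rewrite /source_bound -exprVn; ring.
by rewrite lerDl !addr_ge0 // mulr_ge0.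
Qed.

Section Difference.
Context {R : realType}.
Variables (T K s0 D eps : R) (d : mfg_data R) (Psi u m v n : R * R * R -> R).
Variables (S1 S1x S1y S2 S2x S2y P1 P1x P1y P2 P2x P2y : R * R -> R).
Variables (U Ux Uy Ut Uxx Uxy Uyx Uyy M Mx My Mt Mxx Mxy Myx Myy : R * R * R -> R).
Variables (V Vx Vy Vt Vxx Vxy Vyx Vyy N Nx Ny Nt Nxx Nxy Nyx Nyy : R * R * R -> R).
Hypotheses (T0 : 0 < T) (K0 : 0 < K) (s00 : 0 < s0) (D0 : 0 < D) (eps0 : 0 < eps).
Hypothesis adm : admissible_data T s0 D d.
Hypotheses (Zu : in_Z T K u m) (Zv : in_Z T K v n).
Hypotheses (su : mfg_solution T eps d Psi u m) (sv : mfg_solution T eps d Psi v n).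
Hypotheses (rS1 : reg1 (sigma1sq d) S1 S1x S1y) (rS2 : reg1 (sigma2sq d) S2 S2x S2y)
  (rP1 : reg1 (phi1sq_a0 d) P1 P1x P1y) (rP2 : reg1 (phi2sq_b0 d) P2 P2x P2y)
  (ru : reg21 T u U Ux Uy Ut Uxx Uxy Uyx Uyy) (rm : reg21 T m M Mx My Mt Mxx Mxy Myx Myy)
  (rv : reg21 T v V Vx Vy Vt Vxx Vxy Vyx Vyy) (rn : reg21 T n N Nx Ny Nt Nxx Nxy Nyx Nyy).

Let B := source_bound D K eps.

Lemma bounds_u q : [/\ `|U q| <= K, `|Ux q| <= K & `|Uy q| <= K].
Proof. by apply: (reg21_bound T0 ru) => t ht; have [] := Zbound Zu ht. Qed.
Lemma bounds_m q : [/\ `|M q| <= K, `|Mx q| <= K & `|My q| <= K].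
Proof. by apply: (reg21_bound T0 rm) => t ht; have [] := Zbound Zu ht. Qed.
Lemma bounds_v q : [/\ `|V q| <= K, `|Vx q| <= K & `|Vy q| <= K].
Proof. by apply: (reg21_bound T0 rv) => t ht; have [] := Zbound Zv ht. Qed.
Lemma bounds_n q : [/\ `|N q| <= K, `|Nx q| <= K & `|Ny q| <= K].
Proof. by apply: (reg21_bound T0 rn) => t ht; have [] := Zbound Zv ht. Qed.

Lemma bounds_S1 p : [/\ `|S1 p| <= D, `|S1x p| <= D & `|S1y p| <= D].
Proof. by have [_ [_ [_ [_ [_ [_ [_ [[h _ _] _]]]]]]]] := adm; exact: (reg1_bound rS1 h). Qed.
Lemma bounds_S2 p : [/\ `|S2 p| <= D, `|S2x p| <= D & `|S2y p| <= D].
Proof. by have [_ [_ [_ [_ [_ [_ [_ [[_ h _] _]]]]]]]] := adm; exact: (reg1_bound rS2 h). Qed.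
Lemma bounds_P1 p : [/\ `|P1 p| <= D, `|P1x p| <= D & `|P1y p| <= D].
Proof. by have [_ [_ [_ [_ [_ [_ [_ [_ [_ h _]]]]]]]]] := adm; exact: (reg1_bound rP1 h). Qed.
Lemma bounds_P2 p : [/\ `|P2 p| <= D, `|P2x p| <= D & `|P2y p| <= D].
Proof. by have [_ [_ [_ [_ [_ [_ [_ [_ [_ _ h]]]]]]]]] := adm; exact: (reg1_bound rP2 h). Qed.

Let f (q : R * R * R) := Ut q - Vt q + 2^-1 * S1 q.1 * (Uxx q - Vxx q) + 2^-1 * S2 q.1 * (Uyy q - Vyy q).
Let h (q : R * R * R) := M q - N q.
Let I1 x t := itg 0 1 (fun y => `|M (x, y, t) - N (x, y, t)|).
Let I2 y t := itg 0 1 (fun x => `|M (x, y, t) - N (x, y, t)|).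

(** [k] parametrises a line of the cylinder, so both kinds of means are treated at once. Values on
    the closed line agree with the extensions, which inherit nonnegativity by continuity. *)
Lemma mean_difference (k : R -> R * R * R) : cnt k -> (forall y, 0 <= y <= 1 -> box T (k y)) ->
  `|(eps + itg 0 1 (fun y => m (k y)))^-1 * itg 0 1 (fun y => y * m (k y))
    - (eps + itg 0 1 (fun y => n (k y)))^-1 * itg 0 1 (fun y => y * n (k y))|
  <= 2 / eps * itg 0 1 (fun y => `|M (k y) - N (k y)|).
Proof.
move=> ck bk.
have Mpos w W Wx Wy Wt Wxx Wxy Wyx Wyy y : reg21 T w W Wx Wy Wt Wxx Wxy Wyx Wyy ->
    (forall q, Q 0 T q -> 0 <= w q) -> 0 <= y <= 1 -> 0 <= W (k y).
  move=> r w0 hy; have [_ _ WE] := reg_0 r.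
  have c : cnt (fun q => - W q) by cnt.
  rewrite -oppr_le0; apply: (box_le T0 c); last exact: bk.
  by move=> q Qq; rewrite oppr_le0 WE //; exact: w0.
have e w W Wx Wy Wt Wxx Wxy Wyx Wyy : reg21 T w W Wx Wy Wt Wxx Wxy Wyx Wyy ->
    (eps + itg 0 1 (fun y => w (k y)))^-1 * itg 0 1 (fun y => y * w (k y)) =
    (eps + itg 0 1 (fun y => W (k y)))^-1 * itg 0 1 (fun y => y * W (k y)).
  move=> r; rewrite (eq_itg (f := fun y => W (k y)) (g := fun y => w (k y))); last first.
    by move=> y hy; rewrite (reg_box r) //; exact: bk.
  rewrite (eq_itg (f := fun y => y * W (k y)) (g := fun y => y * w (k y))) //.
  by move=> y hy; rewrite (reg_box r) //; exact: bk.
rewrite (e _ _ _ _ _ _ _ _ _ rm) (e _ _ _ _ _ _ _ _ _ rn).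
have [_ [_ _ m0]] := Zu; have [_ [_ _ n0]] := Zv.
apply: barycenter_diff => //; [cnt|cnt| |] => y hy.
  exact: (Mpos _ _ _ _ _ _ _ _ _ _ rm).
exact: (Mpos _ _ _ _ _ _ _ _ _ _ rn).
Qed.

Lemma mbar_y_diff (x t : R) : 0 < x < 1 -> 0 < t < T ->
  `|mbar_y eps m x t - mbar_y eps n x t| <= 2 / eps * I1 x t.
Proof.
move=> hx ht; apply: (mean_difference (k := fun y => (x, y, t))); first by cnt.
by move=> y hy; split => //; exact: oo_cc.
Qed.

Lemma mbar_x_diff (y t : R) : 0 < y < 1 -> 0 < t < T ->
  `|mbar_x eps m y t - mbar_x eps n y t| <= 2 / eps * I2 y t.
Proof.
move=> hy ht; apply: (mean_difference (k := fun x => (x, y, t))); first by cnt.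
by move=> x hx; split => //; exact: oo_cc.
Qed.

Lemma hjb_difference_le (x y t : R) : 0 < x < 1 -> 0 < y < 1 -> 0 < t < T ->
  `|f (x, y, t)| <= D * K * `|Ux (x, y, t) - Vx (x, y, t)| + D * K * `|Uy (x, y, t) - Vy (x, y, t)|
    + (D * (2 / eps) * I1 x t + D * (2 / eps) * I2 y t).
Proof.
move=> hx hy ht.
have Op : Omega (x, y) by split.
have Qp : Q 0 T (x, y, t) by split.
have Cp : closure (@Omega R) (x, y) by rewrite closureOmega; exact: Omega_sq.
have [Cg [ab [_ [_ [_ [_ [_ [_ [gD _ _]]]]]]]]] := adm.
have [a0 b0] := ab _ Cp.
have [hu _ _] := su; have [hv _ _] := sv.
have := hjb_balance (lt0r_neq0 a0) (lt0r_neq0 b0) (hu _ _ _ Qp) (hv _ _ _ Qp).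
have [_ _ eUt] := reg_t ru; have [_ _ eUxx] := reg_xx ru; have [_ _ eUyy] := reg_yy ru.
have [_ _ eUx] := reg_x ru; have [_ _ eUy] := reg_y ru.
have [_ _ eVt] := reg_t rv; have [_ _ eVxx] := reg_xx rv; have [_ _ eVyy] := reg_yy rv.
have [_ _ eVx] := reg_x rv; have [_ _ eVy] := reg_y rv.
have [_ _ eS1] := reg1_0 rS1; have [_ _ eS2] := reg1_0 rS2.
have [_ _ eP1] := reg1_0 rP1; have [_ _ eP2] := reg1_0 rP2.
rewrite -eUt // -eVt // -eUxx // -eUyy // -eVxx // -eVyy // -eUx // -eUy // -eVx // -eVy //.
rewrite -eS1 // -eS2 //.
rewrite -[phi1 d (x, y) ^+ 2 / _]/(phi1sq_a0 d (x, y)) -[phi2 d (x, y) ^+ 2 / _]/(phi2sq_b0 d (x, y)) -eP1 // -eP2 //.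
rewrite -/(f (x, y, t)) => ->.
have [_ bUx bUy] := bounds_u (x, y, t); have [_ bVx bVy] := bounds_v (x, y, t).
have [bP1 _ _] := bounds_P1 (x, y); have [bP2 _ _] := bounds_P2 (x, y).
have mid (a b : R) : `|a| <= K -> `|b| <= K -> `|2^-1 * (a + b)| <= K.
  move=> ha hb; rewrite normrM ger0_norm ?invr_ge0 // mulrC ler_pdivrMr //.
  by apply: le_trans (ler_normD _ _) _; rewrite mulr2n mulrDr mulr1; exact: lerD.
apply: le_trans (ler_normB _ _) _; apply: lerD.
  apply: le_trans (ler_normD _ _) _; apply: lerD.
    by rewrite normrM ler_wpM2r // normrM; apply: ler_pM => //; exact: mid.
  by rewrite normrM ler_wpM2r // normrM; apply: ler_pM => //; exact: mid.
apply: le_trans (C1_lipschitz Cg gD _ _ _ _) _; rewrite -!mulrA; apply: lerD; rewrite ler_wpM2l ?(ltW D0) //.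
  have -> : x - mbar_y eps m x t - (x - mbar_y eps n x t) = - (mbar_y eps m x t - mbar_y eps n x t) by ring.
  by rewrite normrN mulrA; exact: mbar_y_diff.
have -> : y - mbar_x eps m y t - (y - mbar_x eps n y t) = - (mbar_x eps m y t - mbar_x eps n y t) by ring.
by rewrite normrN mulrA; exact: mbar_x_diff.
Qed.

Let q t := J (fun p => (M (p, t) - N (p, t)) ^+ 2).
Let G t := J (fun p => (Ux (p, t) - Vx (p, t)) ^+ 2 + (Uy (p, t) - Vy (p, t)) ^+ 2).

Lemma cnt_f : cnt f.
Proof.
by rewrite /f; cnt.
Qed.
Lemma cnt_qd : cnt q.
Proof.
by rewrite /q; cnt.
Qed.
Lemma cnt_Gd : cnt G.
Proof. by rewrite /G; cnt.
Qed.
Lemma qd_ge0 t : 0 <= q t.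
Proof. by apply: J_ge0 => x y _ _; exact: sqr_ge0. Qed.
Lemma Gd_ge0 t : 0 <= G t.
Proof. by apply: J_ge0 => x y _ _; rewrite addr_ge0 ?sqr_ge0. Qed.

Lemma f_le_in t : 0 < t < T -> J (fun p => f (p, t) ^+ 2) <= B * (q t + G t).
Proof.
move=> ht.
have cf := cnt_f.
have ch : cnt (fun p => (M (p, t) - N (p, t)) ^+ 2) by cnt.
pose e := 4 * (D * (2 / eps)) ^+ 2.
pose g p := 4 * (D * K) ^+ 2 * ((Ux (p, t) - Vx (p, t)) ^+ 2 + (Uy (p, t) - Vy (p, t)) ^+ 2).
pose r1 (p : R * R) := itg 0 1 (fun y => (M (p.1, y, t) - N (p.1, y, t)) ^+ 2).
pose r2 (p : R * R) := itg 0 1 (fun x => (M (x, p.2, t) - N (x, p.2, t)) ^+ 2).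
have cr1 : cnt r1.
  by apply: (cnt_itg (F := fun z : R * R * R => (M (z.1.1, z.2, t) - N (z.1.1, z.2, t)) ^+ 2)) => //; cnt.
have cr2 : cnt r2.
  by apply: (cnt_itg (F := fun z : R * R * R => (M (z.2, z.1.2, t) - N (z.2, z.1.2, t)) ^+ 2)) => //; cnt.
have cg : cnt g by rewrite /g; cnt.
have le : J (fun p => f (p, t) ^+ 2) <= J (fun p => g p + e * (r1 p + r2 p)).
  apply: J_le_oo; [cnt|cnt|move=> x y hx hy].
  apply: le_trans (sqr4_le (hjb_difference_le hx hy ht)) _.
  apply: lerD.
    by rewrite /g !exprMn !real_normK ?num_real // le_eqVlt; apply/orP; left; apply/eqP; ring.
  have i1 : I1 x t ^+ 2 <= r1 (x, y) by apply: itg_abs_sqr; cnt.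
  have i2 : I2 y t ^+ 2 <= r2 (x, y) by apply: itg_abs_sqr; cnt.
  have -> : 4 * ((D * (2 / eps) * I1 x t) ^+ 2 + (D * (2 / eps) * I2 y t) ^+ 2) = e * (I1 x t ^+ 2 + I2 y t ^+ 2).
    rewrite /e [(D * (2 / eps) * I1 x t) ^+ 2]exprMn [(D * (2 / eps) * I2 y t) ^+ 2]exprMn.
    by rewrite -[RHS]mulrA [_ ^+ 2 * (_ + _)]mulrDr.
  by apply: ler_wpM2l (lerD i1 i2); rewrite /e mulr_ge0 // sqr_ge0.
apply: le_trans le _.
have Jr1 : J r1 = q t by exact: (J_marginal_y ch).
have Jr2 : J r2 = q t by exact: (J_marginal_x ch).
have Jg : J g = 4 * (D * K) ^+ 2 * G t.
  rewrite /g; have c := @JZ R (4 * (D * K) ^+ 2) (fun p => (Ux (p, t) - Vx (p, t)) ^+ 2 + (Uy (p, t) - Vy (p, t)) ^+ 2).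
  by apply: c; cnt.
have -> : J (fun p => g p + e * (r1 p + r2 p)) = J g + e * (J r1 + J r2).
  have c12 : cnt (fun p => r1 p + r2 p) by cnt.
  by rewrite JD; [rewrite JZ // JD|cnt|cnt].
rewrite Jr1 Jr2 Jg /e; exact: source_combine (qd_ge0 t) (Gd_ge0 t) D0.
Qed.

(** The abstract system asks for the bound at every real time. Clamping reduces it to [[0, T]], and
    the end points are limits of interior times. *)
Lemma f_le_all t : J (fun p => f (p, t) ^+ 2) <= B * (q t + G t).
Proof.
have cf := cnt_f; have cq := cnt_qd; have cG := cnt_Gd.
have cJ : cnt (fun t => J (fun p => f (p, t) ^+ 2)).
  by cnt.
pose E t := J (fun p => f (p, t) ^+ 2) - B * (q t + G t).
have cE : cnt E by rewrite /E; cnt.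
have E_le t' : 0 <= t' <= T -> E t' <= 0.
  move=> ht'; have c : cnt (fun s : R => E ((1 - s) * t' + s * (T / 2))) by cnt.
  have := le_limit c; rewrite subr0 mul1r mul0r addr0; apply=> s hs.
  by rewrite /E subr_le0; apply: f_le_in; exact: mid_path.
have -> : J (fun p => f (p, t) ^+ 2) = J (fun p => f (p, cl T t) ^+ 2).
  apply: eq_J => x y _ _; rewrite /f /= (Ext_cl T0 (reg_t ru)) (Ext_cl T0 (reg_t rv)) (Ext_cl T0 (reg_xx ru)).
  by rewrite (Ext_cl T0 (reg_xx rv)) (Ext_cl T0 (reg_yy ru)) (Ext_cl T0 (reg_yy rv)).
have -> : q t = q (cl T t).
  by apply: eq_J => x y _ _; rewrite (Ext_cl T0 (reg_0 rm)) (Ext_cl T0 (reg_0 rn)).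
have -> : G t = G (cl T t).
  apply: eq_J => x y _ _; rewrite (Ext_cl T0 (reg_x ru)) (Ext_cl T0 (reg_x rv)).
  by rewrite (Ext_cl T0 (reg_y ru)) (Ext_cl T0 (reg_y rv)).
by rewrite -subr_le0; apply: E_le; exact: cl_bounds.
Qed.

(** The difference of the products m u_x and n v_x is m (u_x - v_x) + (m - n) v_x; the last term is
    the diffusion flux left over by the weak form. *)
Let F1 (z : R * R * R) := P1 z.1 * (M z * (Ux z - Vx z) + (M z - N z) * Vx z) - 2^-1 * S1x z.1 * (M z - N z).
Let F2 (z : R * R * R) := P2 z.1 * (M z * (Uy z - Vy z) + (M z - N z) * Vy z) - 2^-1 * S2y z.1 * (M z - N z).

Lemma cnt_F12 : cnt F1 /\ cnt F2.
Proof.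
by split; rewrite ?/F1 ?/F2; cnt.
Qed.

Lemma F_le_all t : J (fun p => F1 (p, t) ^+ 2 + F2 (p, t) ^+ 2) <= B * (q t + G t).
Proof.
have [cF1 cF2] := cnt_F12.
pose a := 4 * D ^+ 2 * K ^+ 2; pose b := 2 * (4 * D ^+ 2 * K ^+ 2 + 4 * D ^+ 2).
apply: (@le_trans _ _ (a * G t + b * q t)); last exact: flux_combine (qd_ge0 t) (Gd_ge0 t) D0.
have le : J (fun p => F1 (p, t) ^+ 2 + F2 (p, t) ^+ 2) <=
  J (fun p => a * ((Ux (p, t) - Vx (p, t)) ^+ 2 + (Uy (p, t) - Vy (p, t)) ^+ 2) + b * (M (p, t) - N (p, t)) ^+ 2).
  apply: J_le; [cnt|cnt|move=> x y _ _].
  have [_ bVx bVy] := bounds_v (x, y, t); have [bM _ _] := bounds_m (x, y, t).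
  have [bP1 _ _] := bounds_P1 (x, y); have [bP2 _ _] := bounds_P2 (x, y).
  have [_ bS1 _] := bounds_S1 (x, y); have [_ _ bS2] := bounds_S2 (x, y).
  have l1 := flux_sqr_le (Ux (x, y, t) - Vx (x, y, t)) (M (x, y, t) - N (x, y, t)) (ltW D0) (ltW K0) bP1 bS1 bM bVx.
  have l2 := flux_sqr_le (Uy (x, y, t) - Vy (x, y, t)) (M (x, y, t) - N (x, y, t)) (ltW D0) (ltW K0) bP2 bS2 bM bVy.
  apply: le_trans (lerD l1 l2) _; rewrite le_eqVlt; apply/orP; left; apply/eqP; rewrite /a /b; ring.
apply: le_trans le _.
rewrite JD; [|cnt|cnt]; rewrite JZ; last by cnt.
by rewrite JZ; last by cnt.
Qed.

Let cstS : constant_near_boundary (sigma1sq d) /\ constant_near_boundary (sigma2sq d).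
Proof. by have [_ [_ [_ [_ [_ [hc _]]]]]] := adm. Qed.
Let Nu p nu t : Gamma1 p -> outward_normal p nu -> 0 < t < T -> normal_derivative_is (slice u t) p nu 0.
Proof. by move=> a b c; have [_ _ [_ hn]] := su; have [] := hn p nu t a b c. Qed.
Let Nm p nu t : Gamma1 p -> outward_normal p nu -> 0 < t < T -> normal_derivative_is (slice m t) p nu 0.
Proof. by move=> a b c; have [_ _ [_ hn]] := su; have [] := hn p nu t a b c. Qed.
Let Nv p nu t : Gamma1 p -> outward_normal p nu -> 0 < t < T -> normal_derivative_is (slice v t) p nu 0.
Proof. by move=> a b c; have [_ _ [_ hn]] := sv; have [] := hn p nu t a b c. Qed.
Let Nn p nu t : Gamma1 p -> outward_normal p nu -> 0 < t < T -> normal_derivative_is (slice n t) p nu 0.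
Proof. by move=> a b c; have [_ _ [_ hn]] := sv; have [] := hn p nu t a b c. Qed.

Let al (p : R * R) := 2^-1 * S1 p.
Let be (p : R * R) := 2^-1 * S2 p.

Lemma weak_difference (s : test R) t : 0 < t < T ->
  J (fun p => (Mt (p, t) - Nt (p, t)) * tv s p) =
  - aform al be (fun p => Mx (p, t) - Nx (p, t)) (fun p => My (p, t) - Ny (p, t)) (tx s) (ty s)
  + J (fun p => F1 (p, t) * tx s p + F2 (p, t) * ty s p).
Proof.
move=> ht.
have [_ fpu _] := su; have [_ fpv _] := sv.
have wu := weak_form rS1 rS2 rP1 rP2 ru rm cstS.1 cstS.2 (neumann_x0 T0 ru Nu) (neumann_y0 T0 ru Nu)
  (neumann_y1 T0 ru Nu) (neumann_x0 T0 rm Nm) (neumann_y0 T0 rm Nm) (neumann_y1 T0 rm Nm) fpu s ht.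
have wv := weak_form rS1 rS2 rP1 rP2 rv rn cstS.1 cstS.2 (neumann_x0 T0 rv Nv) (neumann_y0 T0 rv Nv)
  (neumann_y1 T0 rv Nv) (neumann_x0 T0 rn Nn) (neumann_y0 T0 rn Nn) (neumann_y1 T0 rn Nn) fpv s ht.
have [cF1 cF2] := cnt_F12.
have cv := cnt_tv s; have cx := cnt_tx s; have cy := cnt_ty s.
have E0 : J (fun p => (Mt (p, t) - Nt (p, t)) * tv s p) = J (fun p => Mt (p, t) * tv s p) - J (fun p => Nt (p, t) * tv s p).
  by rewrite -JB; [|cnt|cnt]; apply: eq_J => x y _ _; rewrite mulrBl.
rewrite E0 wu wv.
set A1 := J (fun p => 2^-1 * S1 p * (Mx (p, t) * tx s p) + _).
set A2 := J (fun p => 2^-1 * S1 p * (Nx (p, t) * tx s p) + _).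
set L1 := J (fun p => (P1 p * M (p, t) * Ux (p, t) - _) * _ + _).
set L2 := J (fun p => (P1 p * N (p, t) * Vx (p, t) - _) * _ + _).
have -> : aform al be (fun p => Mx (p, t) - Nx (p, t)) (fun p => My (p, t) - Ny (p, t)) (tx s) (ty s) = A1 - A2.
  by rewrite /aform /A1 /A2 -JB; [|cnt|cnt]; apply: eq_J => x y _ _; rewrite /al /be; ring.
have -> : J (fun p => F1 (p, t) * tx s p + F2 (p, t) * ty s p) = L1 - L2.
  by rewrite /L1 /L2 -JB; [|cnt|cnt]; apply: eq_J => x y _ _; rewrite /F1 /F2 /=; ring.
by rewrite opprB opprD addrACA opprK; congr (_ + _); rewrite addrC.
Qed.

Let D_le_B : D <= B := source_bound_ge K eps D.
Let B0 : 0 < B := lt_le_trans D0 D_le_B.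

(** The abstract coefficients are sigma_1^2 / 2 and sigma_2^2 / 2: the assumption with 2 sigma_0
    gives ellipticity with constant sigma_0. *)
Lemma difference_estimates : estimates T s0 B (fun q => U q - V q) (fun q => Ux q - Vx q)
  (fun q => Uy q - Vy q) (fun q => Ut q - Vt q) (fun q => Uxx q - Vxx q) (fun q => Uxy q - Vxy q)
  (fun q => Uyy q - Vyy q) (fun q => M q - N q) (fun q => Mx q - Nx q) (fun q => My q - Ny q).
Proof.
have [cF1 cF2] := cnt_F12.
have hal : cnt al by rewrite /al; cnt.
have hbe : cnt be by rewrite /be; cnt.
have half w : `|w| <= D -> `|2^-1 * w| <= B.
  move=> hw; apply: le_trans D_le_B; apply: le_trans hw.
  by rewrite normrM ler_piMl // ger0_norm ?invr_ge0 // invf_le1 // ler1n.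
have half_ge w : 2 * s0 <= w -> s0 <= 2^-1 * w by move=> hw; rewrite ler_pdivlMl.
have [_ [_ [_ [_ [sg _]]]]] := adm.
have [_ _ [du _]] := su; have [_ _ [dv _]] := sv.
apply: (@core_estimates R T s0 B al (fun p => 2^-1 * S1x p) (fun p => 2^-1 * S1y p) be
  (fun p => 2^-1 * S2x p) (fun p => 2^-1 * S2y p) _ _ _ _ _ _ (fun q => Uyx q - Vyx q) _ _ _ _
  (fun q => Mt q - Nt q) F1 F2) => //; try cnt.
- by move=> x y _ _; apply: half_ge; apply: (reg1_ge rS1) => p /sg[].
- by move=> x y _ _; apply: half_ge; apply: (reg1_ge rS2) => p /sg[].
- move=> x y _ _; have [b1 b2 b3] := bounds_S1 (x, y); have [b4 b5 b6] := bounds_S2 (x, y).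
  by split; split; exact: half.
- exact: (dXZ 2^-1 (reg1_dx rS1)).
- exact: (dYZ 2^-1 (reg1_dy rS1)).
- exact: (dXZ 2^-1 (reg1_dx rS2)).
- exact: (dYZ 2^-1 (reg1_dy rS2)).
- by move=> t; exact: (dXB (reg_dx ru t) (reg_dx rv t)).
- by move=> t; exact: (dYB (reg_dy ru t) (reg_dy rv t)).
- by move=> x y t hx hy ht; exact: (drB (reg_dt ru hx hy ht) (reg_dt rv hx hy ht)).
- by move=> t; exact: (dXB (reg_dxx ru t) (reg_dxx rv t)).
- by move=> t; exact: (dYB (reg_dxy ru t) (reg_dxy rv t)).
- by move=> t; exact: (dXB (reg_dyx ru t) (reg_dyx rv t)).
- by move=> t; exact: (dYB (reg_dyy ru t) (reg_dyy rv t)).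
- by move=> t; exact: (dXB (reg_dx rm t) (reg_dx rn t)).
- by move=> t; exact: (dYB (reg_dy rm t) (reg_dy rn t)).
- by move=> x y t hx hy ht; exact: (drB (reg_dt rm hx hy ht) (reg_dt rn hx hy ht)).
- move=> y t hy; apply: (dirichlet_x1 T0 ru rv _ _ hy) => p t' Gp ht'.
  by have [-> _] := du p t' Gp ht'; have [-> _] := dv p t' Gp ht'.
- move=> y t hy; apply: (dirichlet_x1 T0 rm rn _ _ hy) => p t' Gp ht'.
  by have [_ ->] := du p t' Gp ht'; have [_ ->] := dv p t' Gp ht'.
- by move=> y t hy; rewrite (neumann_x0 T0 ru Nu) // (neumann_x0 T0 rv Nv) // subrr.
- by move=> x t hx; rewrite (neumann_y0 T0 ru Nu) // (neumann_y0 T0 rv Nv) // subrr.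
- by move=> x t hx; rewrite (neumann_y1 T0 ru Nu) // (neumann_y1 T0 rv Nv) // subrr.
- exact: f_le_all.
- exact: F_le_all.
- exact: weak_difference.
Qed.

End Difference.

Section Derivatives.
Context {R : realType}.

Lemma deriveB_on (V : normedModType R) (A : set V) (a b : V) (f g : V -> R) : open A ->
  (forall q, A q -> derivable f q a) -> (forall q, A q -> derivable g q a) ->
  (forall q, A q -> derivable ('D_a f) q b) -> (forall q, A q -> derivable ('D_a g) q b) ->
  forall q, A q -> 'D_b ('D_a (fun z => f z - g z)) q = 'D_b ('D_a f) q - 'D_b ('D_a g) q.
Proof.
move=> oA df dg ddf ddg q Aq.
have e z : A z -> 'D_a (fun z => f z - g z) z = 'D_a f z - 'D_a g z.
  by move=> Az; exact: (deriveB (df z Az) (dg z Az)).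
rewrite (@near_eq_derive _ _ _ _ (fun z => 'D_a f z - 'D_a g z)).
  exact: (deriveB (ddf q Aq) (ddg q Aq)).
by apply: filterS (open_nbhs_nbhs (conj oA Aq)) => z /e.
Qed.

Lemma dX_dx (F G : R * R -> R) p : dX F G -> Omega p -> dx F p = G p.
Proof.
move: p => [x y] dF [/= hx hy]; have [_ <-] := dF x y hx (oo_cc hy).
have E : (fun h : R => h^-1 *: (F (h *: (1, 0) + (x, y)) - F (x, y))) =
   (fun h : R => h^-1 *: ((fun z => F (z, y)) (h *: 1 + x) - F (x, y))).
  apply/funext => h; congr (_ *: (F _ - _)).
  by apply/pair_equal_spec; split => //=; rewrite [_ *: 0]mulr0 add0r.
by rewrite /dx /derive E.
Qed.
Lemma dY_dy (F G : R * R -> R) p : dY F G -> Omega p -> dy F p = G p.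
Proof.
move: p => [x y] dF [/= hx hy]; have [_ <-] := dF x y (oo_cc hx) hy.
have E : (fun h : R => h^-1 *: (F (h *: (0, 1) + (x, y)) - F (x, y))) =
   (fun h : R => h^-1 *: ((fun z => F (x, z)) (h *: 1 + y) - F (x, y))).
  apply/funext => h; congr (_ *: (F _ - _)).
  by apply/pair_equal_spec; split => //=; rewrite [_ *: 0]mulr0 add0r.
by rewrite /dy /derive E.
Qed.

End Derivatives.

Section DifferenceRecord.
Context {R : realType}.

(** What the final argument needs to know about two solutions. [diff_terminal] is a separate field
    because time [T] lies outside the open cylinder, so the derivatives of the terminal slices do
    not follow from [diff_first]. *)
Record difference (T s0 B K : R) (u m U Ux Uy Ut Uxx Uxy Uyy M Mx My : R * R * R -> R) : Prop := Difference {
  diff_estimates : estimates T s0 B U Ux Uy Ut Uxx Uxy Uyy M Mx My;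
  diff_cU : cnt U; diff_cUx : cnt Ux; diff_cUy : cnt Uy; diff_cUt : cnt Ut;
  diff_cUxx : cnt Uxx; diff_cUxy : cnt Uxy; diff_cUyy : cnt Uyy;
  diff_cM : cnt M; diff_cMx : cnt Mx; diff_cMy : cnt My;
  diff_bound : forall q, `|M q| <= 2 * K;
  diff_box : forall q, box T q -> u q = U q /\ m q = M q;
  diff_first : forall q, Q 0 T q -> [/\ pdx u q = Ux q, pdy u q = Uy q & pdt u q = Ut q];
  diff_second : forall q, Q 0 T q -> [/\ pdx (pdx u) q = Uxx q, pdy (pdx u) q = Uxy q & pdy (pdy u) q = Uyy q];
  diff_firstm : forall q, Q 0 T q -> pdx m q = Mx q /\ pdy m q = My q;
  diff_terminal : forall p, Omega p -> 
    (dx (slice u T) p = Ux (p, T) /\ dy (slice u T) p = Uy (p, T)) /\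
    (dx (slice m T) p = Mx (p, T) /\ dy (slice m T) p = My (p, T))
}.

Lemma difference_exists (T K s0 D eps : R) (d : mfg_data R) (Psi u m v n : R * R * R -> R) :
  0 < T -> 0 < K -> 0 < s0 -> 0 < D -> 0 < eps -> admissible_data T s0 D d ->
  in_Z T K u m -> in_Z T K v n -> mfg_solution T eps d Psi u m -> mfg_solution T eps d Psi v n ->
  exists U Ux Uy Ut Uxx Uxy Uyy M Mx My, difference T s0 (source_bound D K eps) K
    (fun q => u q - v q) (fun q => m q - n q) U Ux Uy Ut Uxx Uxy Uyy M Mx My.
Proof.
move=> T0 K0 s00 D0 e0 adm Zu Zv su sv.
have [_ [_ [_ [[C1S C2S] [_ [_ [[C1P C2P] _]]]]]]] := adm.
have [S1 [S1x [S1y rS1]]] := C1_reg C1S; have [S2 [S2x [S2y rS2]]] := C1_reg C2S.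
have [P1 [P1x [P1y rP1]]] := C1_reg C1P; have [P2 [P2x [P2y rP2]]] := C1_reg C2P.
have [[Cu Cm] _] := Zu; have [[Cv Cn] _] := Zv.
have [U [Ux [Uy [Ut [Uxx [Uxy [Uyx [Uyy ru]]]]]]]] := C21_reg T0 Cu.
have [M [Mx [My [Mt [Mxx [Mxy [Myx [Myy rm]]]]]]]] := C21_reg T0 Cm.
have [V [Vx [Vy [Vt [Vxx [Vxy [Vyx [Vyy rv]]]]]]]] := C21_reg T0 Cv.
have [N [Nx [Ny [Nt [Nxx [Nxy [Nyx [Nyy rn]]]]]]]] := C21_reg T0 Cn.
have est := difference_estimates T0 K0 s00 D0 e0 adm Zu Zv su sv rS1 rS2 rP1 rP2 ru rm rv rn.
exists (fun q => U q - V q), (fun q => Ux q - Vx q), (fun q => Uy q - Vy q), (fun q => Ut q - Vt q),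
  (fun q => Uxx q - Vxx q), (fun q => Uxy q - Vxy q), (fun q => Uyy q - Vyy q),
  (fun q => M q - N q), (fun q => Mx q - Nx q), (fun q => My q - Ny q).
have [c1 _ e1] := reg_0 rm; have [c2 _ e2] := reg_0 rn; have [c19 _ e19] := reg_0 ru; have [c20 _ e20] := reg_0 rv.
have [c3 _ e3] := reg_x ru; have [c4 _ e4] := reg_x rv; have [c5 _ e5] := reg_y ru; have [c6 _ e6] := reg_y rv.
have [c7 _ e7] := reg_x rm; have [c8 _ e8] := reg_x rn; have [c9 _ e9] := reg_y rm; have [c10 _ e10] := reg_y rn.
have [c21 _ e21] := reg_t ru; have [c22 _ e22] := reg_t rv.
have [c23 _ e23] := reg_xx ru; have [c24 _ e24] := reg_xx rv; have [c25 _ e25] := reg_xy ru; have [c26 _ e26] := reg_xy rv.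
have [c29 _ e29] := reg_yy ru; have [c30 _ e30] := reg_yy rv.
have oQ := @open_Q R T.
apply: Difference; first exact: est.
all: try by cnt.
- move=> q; have [b1 _ _] := bounds_m T0 Zu rm q; have [b2 _ _] := bounds_n T0 Zv rn q.
  by apply: le_trans (ler_normB _ _) _; rewrite mulr2n mulrDl mul1r; exact: lerD.
- by move=> q bq; rewrite (reg_box ru bq) (reg_box rv bq) (reg_box rm bq) (reg_box rn bq).
- move=> q Qq; rewrite e3 // e4 // e5 // e6 // e21 // e22 //; split.
  + exact: (deriveB (reg_derx ru Qq) (reg_derx rv Qq)).
  + exact: (deriveB (reg_dery ru Qq) (reg_dery rv Qq)).
  + exact: (deriveB (reg_dert ru Qq) (reg_dert rv Qq)).
- move=> q Qq; rewrite e23 // e24 // e25 // e26 // e29 // e30 //; split.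
  + exact: (deriveB_on oQ (reg_derx ru) (reg_derx rv) (reg_derxx ru) (reg_derxx rv) Qq).
  + exact: (deriveB_on oQ (reg_derx ru) (reg_derx rv) (reg_derxy ru) (reg_derxy rv) Qq).
  + exact: (deriveB_on oQ (reg_dery ru) (reg_dery rv) (reg_deryy ru) (reg_deryy rv) Qq).
- move=> q Qq; rewrite e7 // e8 // e9 // e10 //; split.
  + exact: (deriveB (reg_derx rm Qq) (reg_derx rn Qq)).
  + exact: (deriveB (reg_dery rm Qq) (reg_dery rn Qq)).
- have key w W Wx Wy Wt Wxx Wxy Wyx Wyy z Z Zx Zy Zt Zxx Zxy Zyx Zyy :
      reg21 T w W Wx Wy Wt Wxx Wxy Wyx Wyy -> reg21 T z Z Zx Zy Zt Zxx Zxy Zyx Zyy ->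
      forall p, Omega p -> dx (slice (fun q => w q - z q) T) p = Wx (p, T) - Zx (p, T) /\
                dy (slice (fun q => w q - z q) T) p = Wy (p, T) - Zy (p, T).
    move=> rw rz p Op.
    have ne : \forall p' \near p, slice (fun q => w q - z q) T p' = (fun p => W (p, T) - Z (p, T)) p'.
      apply: filterS (open_nbhs_nbhs (conj (@open_Omega R) Op)) => -[x y] [/= hx hy].
      have bz : box T (x, y, T) by split => /=; rewrite ?lexx ?(ltW T0) //; exact: oo_cc.
      by rewrite /slice (reg_box rw bz) (reg_box rz bz).
    split.
    + rewrite -(dX_dx (dXB (reg_dx rw T) (reg_dx rz T)) Op); exact: near_eq_derive.
    + rewrite -(dY_dy (dYB (reg_dy rw T) (reg_dy rz T)) Op); exact: near_eq_derive.
  by move=> p Op; split; [exact: (key _ _ _ _ _ _ _ _ _ _ _ _ _ _ _ _ _ _ ru rv)|exact: (key _ _ _ _ _ _ _ _ _ _ _ _ _ _ _ _ _ _ rm rn)].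
Qed.

End DifferenceRecord.

(** * Stability and uniqueness *)

Section Norms.
Context {R : realType}.

Lemma L2_norm_Q (g T : R) (f F : R * R * R -> R) : cnt F ->
  (forall q, Q g T q -> `|f q| = `|F q|) ->
  L2_norm (@leb3 R) (Q g T) f = (Num.sqrt (itg g T (fun t => J (fun p => F (p, t) ^+ 2))))%:E.
Proof.
move=> cF fF; rewrite /L2_norm.
have cF2 : cnt (fun q => F q ^+ 2) by cnt.
have -> : (\int[@leb3 R]_(q in Q g T) (`|f q| ^+ 2)%:E = \int[@leb3 R]_(q in Q g T) (F q ^+ 2)%:E)%E.
  by apply: eq_integral => q /set_mem Qq; rewrite fF // real_normK ?num_real.
rewrite (leb3_itg g T cF2 (fun q => sqr_ge0 (F q))) poweR_EFin powR12_sqrt //.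
by apply: itg_ge0 => t _; apply: J_ge0 => x y _ _; exact: sqr_ge0.
Qed.

Lemma L2_norm_Q_le (g T Y : R) (f F : R * R * R -> R) (H : R * R * R -> R) : cnt F -> cnt H -> g <= T ->
  (forall q, Q g T q -> `|f q| = `|F q|) -> (forall q, F q ^+ 2 <= H q) ->
  itg g T (fun t => J (fun p => H (p, t))) <= Y ->
  (L2_norm (@leb3 R) (Q g T) f <= (Num.sqrt Y)%:E)%E.
Proof.
move=> cF cH gT fF FH HY; rewrite (L2_norm_Q cF fF) lee_fin.
apply: ler_wsqrtr; apply: le_trans HY; apply: itg_le.
- by cnt.
- by cnt.
- by move=> t _; apply: J_le; [cnt|cnt|move=> x y _ _].
Qed.

Lemma L2_norm_sq (f F : R * R -> R) : cnt F -> (forall p, Omega p -> f p = F p) ->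
  (L2_norm (@leb2 R) (@Omega R) f `^ 2)%E = (J (fun p => F p ^+ 2))%:E.
Proof.
move=> cF fF; rewrite /L2_norm.
have cF2 : cnt (fun p => F p ^+ 2) by cnt.
have -> : (\int[@leb2 R]_(p in @Omega R) (`|f p| ^+ 2)%:E = \int[@leb2 R]_(p in @Omega R) (F p ^+ 2)%:E)%E.
  by apply: eq_integral => p /set_mem Op; rewrite fF // real_normK ?num_real.
have J0 : 0 <= J (fun p => F p ^+ 2) by apply: J_ge0 => x y _ _; exact: sqr_ge0.
rewrite (leb2_J cF2 (fun p => sqr_ge0 (F p))).1 poweR_EFin powR12_sqrt // poweR_EFin.
by rewrite (powR_mulrn 2) ?sqrtr_ge0 // sqr_sqrtr.
Qed.

Lemma H1_norm_le (f F Fx Fy : R * R -> R) (e : R) : 0 < e -> cnt F -> cnt Fx -> cnt Fy ->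
  (forall p, Omega p -> f p = F p) -> (forall p, Omega p -> dx f p = Fx p) ->
  (forall p, Omega p -> dy f p = Fy p) -> (H1_norm f <= e%:E)%E ->
  J (fun p => F p ^+ 2) <= e ^+ 2 /\ J (fun p => Fx p ^+ 2 + Fy p ^+ 2) <= e ^+ 2.
Proof.
move=> e0 cF cFx cFy fF fFx fFy.
have -> : H1_norm f = (((J (fun p => F p ^+ 2))%:E + (J (fun p => Fx p ^+ 2))%:E + (J (fun p => Fy p ^+ 2))%:E) `^ 2^-1)%E.
  congr (poweR (_ + _ + _)%E _); exact: L2_norm_sq.
have J0 G : 0 <= J (fun p : R * R => G p ^+ 2) by apply: J_ge0 => x y _ _; exact: sqr_ge0.
rewrite -!EFinD poweR_EFin powR12_sqrt ?addr_ge0 // lee_fin.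
have key X : 0 <= X -> Num.sqrt X <= e -> X <= e ^+ 2.
  by move=> X0 h; rewrite -(sqr_sqrtr X0); apply: lerXn2r => //; rewrite nnegrE ?sqrtr_ge0 // ltW.
have cx : cnt (fun p => Fx p ^+ 2) by cnt.
have cy : cnt (fun p => Fy p ^+ 2) by cnt.
move=> /key h; have {}h := h (addr_ge0 (addr_ge0 (J0 F) (J0 Fx)) (J0 Fy)).
rewrite (JD cx cy); split; apply: le_trans h.
  by rewrite -addrA lerDl addr_ge0.
by rewrite -addrA lerDr.
Qed.

End Norms.

(** * From the Carleman estimate to uniqueness and decay *)

Section Consequences.
Context {R : realType}.
Variables (T s0 B K : R) (u m U Ux Uy Ut Uxx Uxy Uyy M Mx My : R * R * R -> R).
Hypotheses (T0 : 0 < T) (s00 : 0 < s0) (B0 : 0 < B) (K0 : 0 < K).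
Hypothesis df : difference T s0 B K u m U Ux Uy Ut Uxx Uxy Uyy M Mx My.

Let q t := J (fun p => M (p, t) ^+ 2).
Let G t := J (fun p => Ux (p, t) ^+ 2 + Uy (p, t) ^+ 2).
Let pu t := J (fun p => U (p, t) ^+ 2).
Let ps := psi s0 B.

Let q0 t : 0 <= q t. Proof. by apply: J_ge0 => x y _ _; exact: sqr_ge0. Qed.
Let G0 t : 0 <= G t. Proof. by apply: J_ge0 => x y _ _; rewrite addr_ge0 ?sqr_ge0. Qed.
Let cq : cnt q.
Proof. by have c := diff_cM df; rewrite /q; cnt. Qed.
Let cG : cnt G.
Proof.
have c1 := diff_cUx df; have c2 := diff_cUy df.
by rewrite /G; cnt.
Qed.

Lemma q_le t : q t <= 4 * K ^+ 2.
Proof.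
have c := diff_cM df; rewrite -[leRHS](@J_cst R); apply: J_le; [cnt|cnt|move=> x y _ _].
rewrite -(real_normK (num_real (M _))).
have -> : 4 * K ^+ 2 = (2 * K) ^+ 2 by ring.
by apply: lerXn2r; rewrite ?nnegrE ?mulr_ge0 ?(ltW K0) //; exact: (diff_bound df).
Qed.

(** The weight is increasing, so on [[a, T]] it is at least its value at [a]. Division by the
    initial weight exp (2 lam) makes the unknown initial value harmless, since [q 0] is at most 4
    K^2. *)
Lemma tail_bound (a lam : R) : 0 <= a -> a < T -> 1 <= lam -> Cpu s0 B <= lam ->
  expR (2 * lam * (ps a - 1)) * itg a T (fun t => q t + G t) <=
  4 * K ^+ 2 + expR (2 * lam * ps T) * (lam * Kc s0 B * ps T / s0 * q T + Nc s0 B * pu T).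
Proof.
move=> a0 aT l1 lC; have l0 : 0 <= lam := le_trans ler01 l1.
have [car _ _] := diff_estimates df.
have cw := cnt_wgt s0 B lam.
have cS : cnt (fun t => wgt s0 B lam t * (q t + G t)) by cnt.
have S0 t : 0 <= wgt s0 B lam t * (q t + G t).
  by rewrite mulr_ge0 ?addr_ge0 // ltW // wgt_gt0.
have h1 : itg a T (fun t => wgt s0 B lam t * (q t + G t)) <= itg 0 T (fun t => wgt s0 B lam t * (q t + G t)).
  by rewrite (itg_split cS a0 (ltW aT)) lerDr; apply: itg_ge0.
have h2 : wgt s0 B lam a * itg a T (fun t => q t + G t) <= itg a T (fun t => wgt s0 B lam t * (q t + G t)).
  rewrite -itgZ; last by cnt.
  apply: itg_le; [cnt|cnt|move=> t /andP[at' _]].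
  by apply: ler_wpM2r; [rewrite addr_ge0|exact: wgt_le].
have h3 := le_trans h2 (le_trans h1 (car lam l1 lC)).
have w0 : wgt s0 B lam 0 = expR (2 * lam) by rewrite /wgt /psi mulr0 expR0 mulr1.
have wa : wgt s0 B lam a = expR (2 * lam) * expR (2 * lam * (ps a - 1)).
  by rewrite -expRD /wgt /ps; congr expR; ring.
have e1 : 1 <= expR (2 * lam) by rewrite -[leLHS]expR0 ler_expR mulr_ge0.
have e0 : 0 < expR (2 * lam) := expR_gt0 _.
rewrite -(ler_pM2l e0) mulrA -wa; apply: le_trans h3 _; rewrite w0 [leRHS]mulrDr; apply: lerD.
  by rewrite ler_wpM2l ?(ltW e0) //; exact: q_le.
rewrite -/(ps T) -/(wgt s0 B lam T) [leRHS]mulrA; apply: ler_wpM2r.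
  have Kc1 := Kc_ge1 s00 B0; have N0 := Nc_gt0 s00 B0.
  have pu0 : 0 <= pu T by apply: J_ge0 => x y _ _; exact: sqr_ge0.
  have psT : 0 < ps T by exact: expR_gt0.
  apply: addr_ge0; last exact: mulr_ge0 (ltW N0) pu0.
  apply: mulr_ge0 (q0 T); apply: mulr_ge0; last by rewrite invr_ge0 ltW.
  by rewrite mulr_ge0 ?(ltW psT) // mulr_ge0 // (le_trans ler01 Kc1).
by apply: (ler_peMl (ltW (wgt_gt0 s0 B lam T)) e1).
Qed.

Lemma vanishing : (forall p, Omega p -> u (p, T) = 0 /\ m (p, T) = 0) ->
  forall z, box T z -> u z = 0 /\ m z = 0.
Proof.
move=> term.
have cU := diff_cU df; have cM := diff_cM df.
have bT p : Omega p -> box T (p, T).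
  by move: p => [x y] [/= hx hy]; split => /=; rewrite ?lexx ?(ltW T0) //; exact: oo_cc.
have qT : q T = 0.
  rewrite -[RHS](@J_cst R 0); apply: eq_J_oo; [cnt|cnt|move=> x y hx hy].
  have Op : Omega (x, y) by split.
  by have [_ <-] := diff_box df (bT _ Op); have [_ ->] := term _ Op; rewrite expr0n.
have puT : pu T = 0.
  rewrite -[RHS](@J_cst R 0); apply: eq_J_oo; [cnt|cnt|move=> x y hx hy].
  have Op : Omega (x, y) by split.
  by have [<- _] := diff_box df (bT _ Op); have [-> _] := term _ Op; rewrite expr0n.
have I0 a : 0 < a -> a < T -> itg a T (fun t => q t + G t) = 0.
  move=> a0 aT; set I := itg _ _ _.
  have I_ge0 : 0 <= I by apply: itg_ge0 => t _; rewrite addr_ge0.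
  apply/eqP; rewrite eq_le I_ge0 andbT leNgt; apply/negP => Ipos.
  have k0 : 0 < 2 * (ps a - 1).
    rewrite mulr_gt0 // subr_gt0 -[ltLHS]expR0 ltr_expR mulr_gt0 //.
    exact: lt_le_trans ltr01 (Kc_ge1 s00 B0).
  (* With exp x >= 1 + x, the third entry makes the left side of [tail_bound] at least I + 4 K^2,
     which contradicts its right side 4 K^2. *)
  pose lam := Num.max (Num.max 1 (Cpu s0 B)) (4 * K ^+ 2 / (I * (2 * (ps a - 1)))).
  have l1 : 1 <= lam by rewrite !le_max lexx.
  have l2 : Cpu s0 B <= lam by rewrite !le_max lexx orbT.
  have l3 : 4 * K ^+ 2 / (I * (2 * (ps a - 1))) <= lam by rewrite le_max lexx orbT.
  have := tail_bound (ltW a0) aT l1 l2; rewrite -/I qT puT !mulr0 addr0 mulr0 addr0 => h.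
  have {}l3 : 4 * K ^+ 2 <= lam * (I * (2 * (ps a - 1))) by rewrite -ler_pdivrMr // mulr_gt0.
  have e := expR_ge1Dx (2 * lam * (ps a - 1)).
  have : (1 + 2 * lam * (ps a - 1)) * I <= 4 * K ^+ 2 by apply: le_trans h; rewrite ler_wpM2r.
  have -> : (1 + 2 * lam * (ps a - 1)) * I = I + lam * (I * (2 * (ps a - 1))) by ring.
  by move=> h2; have := le_trans h2 l3; rewrite gerDr leNgt Ipos.
have S0 t : 0 < t < T -> q t + G t = 0.
  move=> /andP[t0 tT]; have t2 : 0 < t / 2 by rewrite divr_gt0.
  have t3 : t / 2 < t by rewrite ltr_pdivrMr // mulr_natr mulr2n ltrDr.
  have cS : cnt (fun t => q t + G t) by cnt.
  apply: (itg0_eq0 cS _ (I0 _ t2 (lt_trans t3 tT))); last by rewrite t3.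
  by move=> x _; rewrite addr_ge0.
(* [q] and [G] vanish at each interior time; Poincare passes from the gradient of u to u itself. *)
have [_ _ poin] := diff_estimates df.
have Z t x y : 0 < t < T -> 0 < x < 1 -> 0 < y < 1 -> U (x, y, t) = 0 /\ M (x, y, t) = 0.
  move=> ht hx hy; have /eqP := S0 t ht; rewrite paddr_eq0 // => /andP[/eqP qt /eqP Gt].
  have put : pu t = 0.
    apply/eqP; rewrite eq_le -[X in _ <= X]Gt (poin t) /=.
    by apply: J_ge0 => x' y' _ _; exact: sqr_ge0.
  have cU2 : cnt (fun p => U (p, t) ^+ 2) by cnt.
  have cM2 : cnt (fun p => M (p, t) ^+ 2) by cnt.
  have hU := J_eq0 cU2 (fun p => sqr_ge0 (U (p, t))) put hx hy.
  have hM := J_eq0 cM2 (fun p => sqr_ge0 (M (p, t))) qt hx hy.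
  by split; apply/eqP; rewrite -sqrf_eq0; apply/eqP.
move=> z bz; have [-> ->] := diff_box df bz.
have cU1 : cnt (fun q => `|U q|) by cnt.
have cM1 : cnt (fun q => `|M q|) by cnt.
split; apply/eqP; rewrite -normr_le0.
  by apply: (box_le T0 cU1) bz => -[[x y] t] [[/= hx hy] ht]; have [-> _] := Z t x y ht hx hy; rewrite normr0.
by apply: (box_le T0 cM1) bz => -[[x y] t] [[/= hx hy] ht]; have [_ ->] := Z t x y ht hx hy; rewrite normr0.
Qed.

(** A quarter of the exponent 2 (psi(a) - 1) of [tail_bound]. The loss keeps the final exponent
    rate(1) / (4 psi(T)) below 1/8. *)
Definition rate (a : R) : R := (ps a - 1) / 2.
(** The summands come from the initial value, from [q T], from [pu T] and, for the 1, from [G T]. *)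
Definition decay_const : R := 4 * K ^+ 2 + Kc s0 B * ps T / s0 + Nc s0 B + 1.

Lemma decay_const_ge0 : 0 <= decay_const.
Proof.
have Kc1 := le_trans ler01 (Kc_ge1 s00 B0); have N0 := ltW (Nc_gt0 s00 B0).
have h1 : 0 <= Kc s0 B * ps T / s0 by exact: divr_ge0 (mulr_ge0 Kc1 (expR_ge0 _)) (ltW s00).
have h2 := sqr_ge0 K.
by rewrite /decay_const !addr_ge0 // mulr_ge0.
Qed.

Lemma Creg_gt0 (a b : R) : a < b -> 0 < Creg T s0 B a b.
Proof.
move=> ab; have h1 := Ch2_ge0 s00 B0; have h2 := Kgrad_ge0 s00 B0 T0 ab.
have h3 : 0 < (1 + 4 / s0 ^+ 2) * (B + Ce B).
  rewrite mulr_gt0 //; first by rewrite ltr_wpDr // divr_ge0 // sqr_ge0.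
  by rewrite ltr_wpDr // /Ce addr_ge0 ?mulr_ge0 ?sqr_ge0 // ltW.
rewrite /Creg -[X in 0 < X + _]addrA; apply: ltr_wpDr => //; apply: ltr_wpDr => //.
Qed.

(** Here e is the size of the terminal data and the terminal weight is 1 / e, so the weighted
    terminal terms are of size lam e; the factor lam is swallowed by lam <= exp lam. *)
Lemma decay (a lam : R) : 0 <= a -> a < T -> 1 <= lam -> Cpu s0 B <= lam ->
  let e := expR (- (2 * lam * ps T)) in q T <= e ^+ 2 -> pu T <= e ^+ 2 -> G T <= e ^+ 2 ->
  itg a T (fun t => q t + G t) + G T <= decay_const * expR (- (rate a * lam)).
Proof.
move=> a0 aT l1 lC e qT puT GT; have l0 : 0 <= lam := le_trans ler01 l1.
have psT1 : 1 <= ps T by apply: psi_ge1 => //; exact: ltW.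
have psa1 : 1 <= ps a by apply: psi_ge1.
have psaT : ps a <= ps T by apply: psi_le => //; exact: ltW.
have Kc1 := Kc_ge1 s00 B0; have N0 := Nc_gt0 s00 B0.
set x := expR (- (rate a * lam)).
have e0 : 0 < e := expR_gt0 _.
have e1 : e <= 1 by rewrite -[leRHS]expR0 ler_expR oppr_le0 !mulr_ge0 // (le_trans ler01).
have h3 : lam * e <= x.
  apply: (@le_trans _ _ (expR lam * e)).
    by rewrite ler_wpM2r ?(ltW e0) // (le_trans _ (expR_ge1Dx lam)) // lerDr.
  rewrite -expRD ler_expR /rate; nra.
have h2 : e <= x by apply: le_trans h3; rewrite ler_peMl // ltW.
have h1 : expR (- (2 * lam * (ps a - 1))) <= x by rewrite ler_expR /rate; nra.
have e2 : e ^+ 2 <= e by rewrite expr2 ler_piMl // ltW.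
have := tail_bound a0 aT l1 lC.
set I := itg _ _ _; set c := Kc s0 B * ps T / s0.
have c0 : 0 <= c by rewrite /c mulr_ge0 ?invr_ge0 ?(ltW s00) // mulr_ge0 ?(le_trans ler01).
have -> : lam * Kc s0 B * ps T / s0 = lam * c by rewrite /c; ring.
move=> h.
have hW : expR (2 * lam * ps T) * (lam * c * q T + Nc s0 B * pu T) <= lam * c * e + Nc s0 B * e.
  have We : expR (2 * lam * ps T) * e ^+ 2 = e by rewrite expr2 mulrA -expRD subrr expR0 mul1r.
  have : lam * c * q T + Nc s0 B * pu T <= (lam * c + Nc s0 B) * e ^+ 2.
    rewrite mulrDl; apply: lerD; first exact: ler_wpM2l (mulr_ge0 l0 c0) _ _ qT.
    exact: ler_wpM2l (ltW N0) _ _ puT.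
  move=> hh; apply: le_trans (ler_wpM2l (ltW (expR_gt0 (2 * lam * ps T))) hh) _.
  by rewrite mulrCA We mulrDl.
have E0 : 0 < expR (- (2 * lam * (ps a - 1))) := expR_gt0 _.
have EI : I = expR (- (2 * lam * (ps a - 1))) * (expR (2 * lam * (ps a - 1)) * I).
  by rewrite mulrA -expRD addNr expR0 mul1r.
have E1 : expR (- (2 * lam * (ps a - 1))) <= 1.
  by rewrite -[leRHS]expR0 ler_expR oppr_le0 !mulr_ge0 // subr_ge0.
have r0 : 0 <= lam * c * e + Nc s0 B * e.
  by rewrite addr_ge0 // mulr_ge0 ?(ltW e0) ?(ltW N0) // mulr_ge0.
have k0 : 0 <= 4 * K ^+ 2 by rewrite mulr_ge0 // sqr_ge0.
have bI : I <= 4 * K ^+ 2 * x + (c * x + Nc s0 B * x).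
  rewrite EI; apply: (@le_trans _ _ (expR (- (2 * lam * (ps a - 1))) * (4 * K ^+ 2 + (lam * c * e + Nc s0 B * e)))).
    by rewrite ler_wpM2l ?(ltW E0) // (le_trans h) // lerD2l.
  rewrite mulrDr; apply: lerD; first by rewrite mulrC ler_wpM2l.
  apply: (@le_trans _ _ (lam * c * e + Nc s0 B * e)); first by rewrite ler_piMl.
  apply: lerD; last by rewrite ler_wpM2l // ltW.
  by rewrite -mulrA mulrCA ler_wpM2l.
have GTx : G T <= x := le_trans GT (le_trans e2 h2).
apply: le_trans (lerD bI GTx) _; rewrite /decay_const -/c.
by rewrite le_eqVlt; apply/orP; left; apply/eqP; ring.
Qed.

End Consequences.

Lemma summand_le (R : realFieldType) (x1 x2 x3 x4 x5 x6 x7 x8 x9 x10 h : R) :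
  0 <= x1 -> 0 <= x2 -> 0 <= x3 -> 0 <= x4 -> 0 <= x5 ->
  0 <= x6 -> 0 <= x7 -> 0 <= x8 -> 0 <= x9 -> 0 <= x10 ->
  h = x1 + (x2 + x3 + x4) + (x5 + x6) + x7 + (x8 + x9) + x10 ->
  [/\ x1 <= h, x2 <= h, x3 <= h & x4 <= h] /\ [/\ x5 + x6 <= h, x7 <= h, x8 + x9 <= h & x10 <= h].
Proof. by move=> ? ? ? ? ? ? ? ? ? ? ->; split; split; lra. Qed.

Lemma norms_le (R : realType) (T s0 B K b Y : R) (u m U Ux Uy Ut Uxx Uxy Uyy M Mx My : R * R * R -> R) :
  difference T s0 B K u m U Ux Uy Ut Uxx Uxy Uyy M Mx My -> 0 < b -> b < T ->
  itg b T (fun t => J (fun p => Ut (p, t) ^+ 2 + (Uxx (p, t) ^+ 2 + Uxy (p, t) ^+ 2 + Uyy (p, t) ^+ 2)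
    + (Ux (p, t) ^+ 2 + Uy (p, t) ^+ 2) + U (p, t) ^+ 2 + (Mx (p, t) ^+ 2 + My (p, t) ^+ 2) + M (p, t) ^+ 2)) <= Y ->
  let L2 := L2_norm (@leb3 R) (Q b T) in
  is_true (L2 (pdt u) + L2 (pdx (pdx u)) + L2 (pdy (pdx u)) + L2 (pdy (pdy u))
   + L2 (grad_length u) + L2 u + L2 (grad_length m) + L2 m <= (8 * Num.sqrt Y)%:E)%E.
Proof.
move=> df b0 bT HY L2.
have c1 := diff_cU df; have c2 := diff_cUx df; have c3 := diff_cUy df; have c4 := diff_cUt df.
have c5 := diff_cUxx df; have c6 := diff_cUxy df; have c7 := diff_cUyy df.
have c8 := diff_cM df; have c9 := diff_cMx df; have c10 := diff_cMy df.
pose H q := Ut q ^+ 2 + (Uxx q ^+ 2 + Uxy q ^+ 2 + Uyy q ^+ 2) + (Ux q ^+ 2 + Uy q ^+ 2) + U q ^+ 2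
  + (Mx q ^+ 2 + My q ^+ 2) + M q ^+ 2.
have cH : cnt H by rewrite /H; cnt.
have Qb q : Q b T q -> Q 0 T q.
  by move=> [Op /andP[h1 h2]]; split => //; rewrite h2 (lt_trans b0 h1).
have le (f F : R * R * R -> R) : cnt F -> (forall q, Q 0 T q -> `|f q| = `|F q|) ->
    (forall q, F q ^+ 2 <= H q) -> (L2 f <= (Num.sqrt Y)%:E)%E.
  move=> cF fF FH; apply: (L2_norm_Q_le cF cH (ltW bT) _ FH HY).
  by move=> q /Qb; exact: fF.
have HH q := @summand_le _ _ _ _ _ _ _ _ _ _ _ (H q) (sqr_ge0 (Ut q)) (sqr_ge0 (Uxx q)) (sqr_ge0 (Uxy q)) (sqr_ge0 (Uyy q))
  (sqr_ge0 (Ux q)) (sqr_ge0 (Uy q)) (sqr_ge0 (U q)) (sqr_ge0 (Mx q)) (sqr_ge0 (My q)) (sqr_ge0 (M q)) erefl.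
have s0' (x y : R) : 0 <= x ^+ 2 + y ^+ 2 by rewrite addr_ge0 ?sqr_ge0.
have b1 : (L2 (pdt u) <= (Num.sqrt Y)%:E)%E.
  apply: (le _ Ut c4) => [q Qq|q]; last by have [[h1 h2 h3 h4] _] := HH q; exact: h1.
  by have [e1 e2 e3] := diff_first df Qq; rewrite e3.
have b2 : (L2 (pdx (pdx u)) <= (Num.sqrt Y)%:E)%E.
  apply: (le _ Uxx c5) => [q Qq|q]; last by have [[h1 h2 h3 h4] _] := HH q; exact: h2.
  by have [e1 e2 e3] := diff_second df Qq; rewrite e1.
have b3 : (L2 (pdy (pdx u)) <= (Num.sqrt Y)%:E)%E.
  apply: (le _ Uxy c6) => [q Qq|q]; last by have [[h1 h2 h3 h4] _] := HH q; exact: h3.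
  by have [e1 e2 e3] := diff_second df Qq; rewrite e2.
have b4 : (L2 (pdy (pdy u)) <= (Num.sqrt Y)%:E)%E.
  apply: (le _ Uyy c7) => [q Qq|q]; last by have [[h1 h2 h3 h4] _] := HH q; exact: h4.
  by have [e1 e2 e3] := diff_second df Qq; rewrite e3.
have b5 : (L2 (grad_length u) <= (Num.sqrt Y)%:E)%E.
  apply: (le _ (fun q => Num.sqrt (Ux q ^+ 2 + Uy q ^+ 2))) => [|q Qq|q]; first by apply: cnt_sqrt; cnt.
    by rewrite /grad_length; have [e1 e2 e3] := diff_first df Qq; rewrite e1 e2.
  by rewrite sqr_sqrtr //; have [_ [h1 h2 h3 h4]] := HH q; exact: h1.
have b6 : (L2 (u) <= (Num.sqrt Y)%:E)%E.
  apply: (le _ U c1) => [q Qq|q]; last by have [_ [h1 h2 h3 h4]] := HH q; exact: h2.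
  by have [e1 e2] := diff_box df (Q_box Qq); rewrite e1.
have b7 : (L2 (grad_length m) <= (Num.sqrt Y)%:E)%E.
  apply: (le _ (fun q => Num.sqrt (Mx q ^+ 2 + My q ^+ 2))) => [|q Qq|q]; first by apply: cnt_sqrt; cnt.
    by rewrite /grad_length; have [e1 e2] := diff_firstm df Qq; rewrite e1 e2.
  by rewrite sqr_sqrtr //; have [_ [h1 h2 h3 h4]] := HH q; exact: h3.
have b8 : (L2 (m) <= (Num.sqrt Y)%:E)%E.
  apply: (le _ M c8) => [q Qq|q]; last by have [_ [h1 h2 h3 h4]] := HH q; exact: h4.
  by have [e1 e2] := diff_box df (Q_box Qq); rewrite e2.
apply: le_trans (leeD (leeD (leeD (leeD (leeD (leeD (leeD b1 b2) b3) b4) b5) b6) b7) b8) _.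
rewrite -!EFinD lee_fin; move: (Num.sqrt Y) => z; clear; lra.
Qed.

Theorem theorem7p2 (R : realType) (T gamma M1 sigma0 D eps : R)
    (hT : 1 < T) (hgamma : 1 < gamma < T) (hM1 : 0 < M1) (hsigma0 : 0 < sigma0)
    (hD : 0 < D) (heps : 0 < eps) :
  (exists delta1 rho C2 : R,
    [/\ 0 < delta1 < 1, 0 < rho < 6^-1 & 0 < C2] /\
    forall (d : mfg_data R) (Psi u1 m1 u2 m2 : R * R * R -> R),
      admissible_data T sigma0 D d ->
      in_Z T M1 u1 m1 -> in_Z T M1 u2 m2 ->
      mfg_solution T eps d Psi u1 m1 -> mfg_solution T eps d Psi u2 m2 ->
      let u := fun q => u1 q - u2 q in
      let m := fun q => m1 q - m2 q in
      let L2 := L2_norm (@leb3 R) (Q gamma T) in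
      forall delta : R, 0 < delta < delta1 ->
        (H1_norm (slice u T) <= delta%:E)%E ->
        (H1_norm (slice m T) <= delta%:E)%E ->
        (L2 (pdt u) + L2 (pdx (pdx u)) + L2 (pdy (pdx u)) + L2 (pdy (pdy u))
          + L2 (grad_length u) + L2 u + L2 (grad_length m) + L2 m
          <= (C2 * delta `^ rho)%:E)%E) /\
  (forall (d : mfg_data R) (Psi u1 m1 u2 m2 : R * R * R -> R),
      admissible_data T sigma0 D d ->
      in_Z T M1 u1 m1 -> in_Z T M1 u2 m2 ->
      mfg_solution T eps d Psi u1 m1 -> mfg_solution T eps d Psi u2 m2 ->
      (forall p, Omega p -> u1 (p, T) = u2 (p, T) /\ m1 (p, T) = m2 (p, T)) ->
      forall q, closure (Q 0 T) q -> u1 q = u2 q /\ m1 q = m2 q).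
Proof.
have rho_lt (x y : R) : 1 < x -> x <= y -> (x - 1) / 2 < 6^-1 * (4 * y) by move=> ? ?; lra.
have T0 : 0 < T := lt_trans ltr01 hT.
pose B := source_bound D M1 eps.
have B0 : 0 < B := lt_le_trans hD (source_bound_ge M1 eps D).
have [g1 gT] := andP hgamma; have g0 : 0 < gamma := lt_trans ltr01 g1.
split; last first.
  move=> d Psi u1 m1 u2 m2 adm Z1 Z2 s1 s2 term q.
  have [U [Ux [Uy [Ut [Uxx [Uxy [Uyy [M [Mx [My df]]]]]]]]]] :=
    difference_exists T0 hM1 hsigma0 hD heps adm Z1 Z2 s1 s2.
  rewrite closureQ // => bq.
  have [] := vanishing T0 hsigma0 B0 hM1 df _ bq.
    by move=> p /term[-> ->]; rewrite !subrr.
  by move=> /subr0_eq -> /subr0_eq ->.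
pose psT := psi sigma0 B T.
have Kc0 : 0 < Kc sigma0 B := lt_le_trans ltr01 (Kc_ge1 hsigma0 B0).
have ps1 : 1 < psi sigma0 B 1 by rewrite -[ltLHS]expR0 ltr_expR mulr1.
have ps1T : psi sigma0 B 1 <= psT by apply: psi_le => //; exact: ltW.
have psT0 : 0 < psT := expR_gt0 _.
(* The decay is used on [[1, T]]; since gamma > 1, the gap from 1 to gamma is available for
   [regularity]. *)
pose k := rate sigma0 B 1; have k0 : 0 < k by rewrite divr_gt0 // subr_gt0.
pose A := decay_const T sigma0 B M1; pose C := Creg T sigma0 B 1 gamma.
pose L := Num.max 1 (Cpu sigma0 B).
have L1 : 1 <= L by rewrite le_max lexx.
have L0 : 0 < L := lt_le_trans ltr01 L1.
(* lam is tied to delta by delta = exp (- 2 lam psT), so delta < delta1 means L < lam. The square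
   root halves the decay exp (- k lam), and exp (- k lam / 2) is delta to the power k / (4 psT). The
   8 counts the norms; the added 1 makes the constant positive. *)
exists (expR (- (2 * L * psT))), (k / (4 * psT)), (8 * Num.sqrt (C * A) + 1); split.
  split.
  - by rewrite expR_gt0 /= -[ltRHS]expR0 ltr_expR oppr_lt0 !mulr_gt0.
  - have p4 : 0 < 4 * psT by rewrite mulr_gt0.
    apply/andP; split; first exact: divr_gt0.
    rewrite ltr_pdivrMr //; exact: rho_lt ps1 ps1T.
  - by rewrite ltr_wpDl // mulr_ge0 ?sqrtr_ge0.
move=> d Psi u1 m1 u2 m2 adm Z1 Z2 s1 s2 u m L2 delta /andP[d0 dlt] Hu Hm.
have [U [Ux [Uy [Ut [Uxx [Uxy [Uyy [M [Mx [My df]]]]]]]]]] :=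
  difference_exists T0 hM1 hsigma0 hD heps adm Z1 Z2 s1 s2.
pose lam := - ln delta / (2 * psT).
have deltaE : delta = expR (- (2 * lam * psT)).
  have -> : - (2 * lam * psT) = ln delta by rewrite /lam; field; exact: lt0r_neq0.
  by rewrite lnK.
have Llam : L <= lam.
  move: dlt; rewrite deltaE ltr_expR ltrN2 (ltr_pM2r psT0) ltr_pM2l //; exact: ltW.
have l1 : 1 <= lam := le_trans L1 Llam.
have lC : Cpu sigma0 B <= lam by apply: le_trans Llam; rewrite le_max lexx orbT.
have c1 := diff_cU df; have c2 := diff_cUx df; have c3 := diff_cUy df.
have c8 := diff_cM df; have c9 := diff_cMx df; have c10 := diff_cMy df.
have bT p : Omega p -> box T (p, T).
  by move: p => [x y] [/= hx hy]; split => /=; rewrite ?lexx ?(ltW T0) //; exact: oo_cc.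
have [puT GT] : J (fun p => U (p, T) ^+ 2) <= delta ^+ 2 /\ J (fun p => Ux (p, T) ^+ 2 + Uy (p, T) ^+ 2) <= delta ^+ 2.
  apply: (H1_norm_le d0 _ _ _ _ _ _ Hu); try cnt.
  - by move=> p Op; have [<- _] := diff_box df (bT p Op).
  - by move=> p Op; have [[-> _] _] := diff_terminal df Op.
  - by move=> p Op; have [[_ ->] _] := diff_terminal df Op.
have [qT _] : J (fun p => M (p, T) ^+ 2) <= delta ^+ 2 /\ J (fun p => Mx (p, T) ^+ 2 + My (p, T) ^+ 2) <= delta ^+ 2.
  apply: (H1_norm_le d0 _ _ _ _ _ _ Hm); try cnt.
  - by move=> p Op; have [_ <-] := diff_box df (bT p Op).
  - by move=> p Op; have [_ [-> _]] := diff_terminal df Op.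
  - by move=> p Op; have [_ [_ ->]] := diff_terminal df Op.
rewrite deltaE in puT GT qT.
have dec := decay T0 hsigma0 B0 hM1 df ler01 hT l1 lC qT puT GT.
have [_ reg _] := diff_estimates df.
have C0 : 0 <= C := ltW (Creg_gt0 T0 hsigma0 B0 g1).
have Y := le_trans (reg 1 gamma ler01 g1 gT) (ler_wpM2l C0 dec).
apply: le_trans (norms_le df g0 gT Y) _; rewrite lee_fin.
have -> : delta `^ (k / (4 * psT)) = expR (- (k * lam / 2)).
  by rewrite deltaE -expRM; congr expR; field; exact: lt0r_neq0.
have -> : expR (- (k * lam / 2)) = Num.sqrt (expR (- (k * lam))).
  have -> : - (k * lam) = - (k * lam / 2) + - (k * lam / 2) by field.
  by rewrite expRD -expr2 sqrtr_sqr gtr0_norm // expR_gt0.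
rewrite [C * (_ * _)]mulrA sqrtrM; last exact: mulr_ge0 C0 (decay_const_ge0 T M1 hsigma0 B0).
by rewrite [leRHS]mulrDl mul1r [leLHS]mulrA lerDl sqrtr_ge0.
Qed.
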